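(* (Rellich theorem in hyperbolic space.) Let $n\ge2$, $\mu>0$, and let $\Omega$ be a bounded domain in hyperbolic space $\mathbb{B}^n$. Assume that $u\in C^2(\mathbb{B}^n\setminus\Omega)$ satisfies the Helmholtz equation $$-\Delta_{\mathbb{B}^n}u-\frac{(n-1)^2}{4}u-\mu^2u=0\quad\text{in }\mathbb{B}^n\setminus\Omega.$$ If $$\lim_{R\to+\infty}\int_{\partial B_{\mathbb{B}^n}(0,R)}|u|^2\,d\sigma_{\mathbb{B}^n}=0,$$ then $u$ is equal to zero in $\mathbb{B}^n\setminus\Omega$.
   Context: $\mathbb{B}^n=\{x\in\mathbb{R}^n:|x|<1\}$ is the Poincaré ball model of hyperbolic space, with metric $\bigl(\tfrac{2}{1-|x|^2}\bigr)^2g_e$ ($g_e$ Euclidean) and Laplace–Beltrami operator $\Delta_{\mathbb{B}^n}=\frac{1-|x|^2}{4}\bigl((1-|x|^2)\Delta_{\mathbb{R}^n}+2(n-2)\sum_i x_i\partial_{x_i}\bigr)$. ''Bounded'' means bounded for the hyperbolic distance. $B_{\mathbb{B}^n}(0,R)$ is the hyperbolic ball of radius $R$ centered at $0$, i.e. the Euclidean ball of radius $\tanh(R/2)$, and $d\sigma_{\mathbb{B}^n}=\bigl(\tfrac{2}{1-|x|^2}\bigr)^{n-1}d\sigma$ is the hyperbolic surface measure on its boundary ($d\sigma$ Euclidean surface measure). Functions are complex-valued.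
   Formalization: Two hypotheses on Ω are added: the interior of B^n∖Ω is connected, and B^n∖Ω lies in the closure of its interior. Without them the claim fails, e.g. for Ω a spherical shell (u zero outside, a nonzero solution inside) or a ball with a point removed. *)

(* Defs.v *)
From HB Require Import structures.
From mathcomp Require Import all_boot all_order all_algebra.
From mathcomp Require Import all_classical all_reals all_analysis.
From mathcomp Require Import measurable_realfun complex.
From mathcomp Require Import ring lra.

Set Implicit Arguments.
Unset Strict Implicit.
Unset Printing Implicit Defensive.

Import Order.TTheory GRing.Theory Num.Theory.
Import numFieldNormedType.Exports.

Local Open Scope classical_set_scope.
Local Open Scope ring_scope.
Local Open Scope complex_scope.

(* The library norm on 'rV[R]_n is the sup norm (it induces the usual
   topology); lengths in the ball model are Euclidean. *)
Definition enorm {R : realType} {n : nat} (x : 'rV[R]_n) : R :=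
  Num.sqrt (\sum_i x 0 i ^+ 2).

Definition tanh {R : realType} (t : R) : R :=
  (expR t - expR (- t)) / (expR t + expR (- t)).

Definition arcosh {R : realType} (t : R) : R := ln (t + Num.sqrt (t ^+ 2 - 1)).

Definition pball (R : realType) (n : nat) : set 'rV[R]_n :=
  [set x | enorm x < 1].
Arguments pball {R n}.

(* Distance of the metric (2 / (1 - |x|^2))^2 g_e. *)
Definition hdist {R : realType} {n : nat} (x y : 'rV[R]_n) : R :=
  arcosh (1 + 2 * enorm (x - y) ^+ 2 /
                ((1 - enorm x ^+ 2) * (1 - enorm y ^+ 2))).

Lemma hdist0_lt {R : realType} {n : nat} (x : 'rV[R]_n) (rho : R) :
  pball x -> (hdist 0 x < rho) = (enorm x < tanh (rho / 2)).
Proof.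
move=> /=; rewrite /pball /=; rewrite /hdist.
have -> : enorm (0 : 'rV[R]_n) = 0.
  by rewrite /enorm big1 ?sqrtr0// => i _; rewrite mxE expr0n.
have -> : enorm (0 - x) = enorm x.
  by congr Num.sqrt; apply: eq_bigr => i _; rewrite !mxE sub0r sqrrN.
have := sqrtr_ge0 (\sum_i x 0 i ^+ 2); rewrite -/(enorm x).
move: (enorm x) => a a0 a1; rewrite /arcosh expr0n subr0 mul1r.
have b0 : 0 < 1 - a ^+ 2 by nra.
have -> : (1 + 2 * a ^+ 2 / (1 - a ^+ 2)) ^+ 2 - 1 =
    (2 * a / (1 - a ^+ 2)) ^+ 2 by field; rewrite gt_eqF.
rewrite sqrtr_sqr ger0_norm; last by rewrite divr_ge0 ?mulr_ge0 ?(ltW b0).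
have -> : 1 + 2 * a ^+ 2 / (1 - a ^+ 2) + 2 * a / (1 - a ^+ 2) =
    (1 + a) / (1 - a).
  by field; rewrite !gt_eqF//=; lra.
have q0 : 0 < (1 + a) / (1 - a) by rewrite divr_gt0; lra.
rewrite -ltr_expR lnK ?posrE// ltr_pdivrMr ?subr_gt0//.
rewrite /tanh [in LHS](_ : rho = rho / 2 + rho / 2) ?expRD; last by field.
have E0 := expR_gt0 (rho / 2); rewrite expRN.
move: (expR _) E0 => e e0.
have -> : (e - e^-1) / (e + e^-1) = (e * e - 1) / (e * e + 1).
  by field; rewrite ?gt_eqF//=; nra.
by rewrite ltr_pdivlMr; [apply/idP/idP; lra|nra].
Qed.

Definition hbounded {R : realType} {n : nat} (A : set 'rV[R]_n) : Prop :=
  exists M : R, forall x y, A x -> A y -> hdist x y <= M.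

Definition is_domain {R : realType} {n : nat} (A : set 'rV[R]_n) : Prop :=
  [/\ A !=set0, open A & connected A].

Definition partial {R : realType} {n : nat} (i : 'I_n) (f : 'rV[R]_n -> R) :
  'rV[R]_n -> R := 'D_(delta_mx 0 i) f.

Definition hlaplacian {R : realType} {n : nat} (f : 'rV[R]_n -> R)
    (x : 'rV[R]_n) : R :=
  (1 - enorm x ^+ 2) / 4 *
  ((1 - enorm x ^+ 2) * (\sum_i partial i (partial i f) x)
   + 2 * (n%:R - 2) * (\sum_i x 0 i * partial i f x)).

(* C^2 up to the boundary: C^2 in the interior of E, with f and its partial
   derivatives of order at most 2 extending continuously to E.  When E is open
   this is the usual C^2(E). *)
Definition extends_continuously {R : realType} {n : nat} (E : set 'rV[R]_n)
    (g : 'rV[R]_n -> R) : Prop :=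
  exists2 h : 'rV[R]_n -> R,
    {within E, continuous h} & forall x, E° x -> h x = g x.

Definition C2 {R : realType} {n : nat} (E : set 'rV[R]_n)
    (f : 'rV[R]_n -> R) : Prop :=
  [/\ {within E, continuous f},
      forall x i, E° x -> derivable f x (delta_mx 0 i),
      forall i, extends_continuously E (partial i f),
      forall x i j, E° x -> derivable (partial i f) x (delta_mx 0 j)
    & forall i j, extends_continuously E (partial j (partial i f))].

(* Complex-valued functions are differentiated through their real and
   imaginary parts. *)
Definition re_fun {R : realType} {n : nat} (u : 'rV[R]_n -> R[i]) x : R :=
  complex.Re (u x).
Definition im_fun {R : realType} {n : nat} (u : 'rV[R]_n -> R[i]) x : R :=
  complex.Im (u x).

Definition C2_complex {R : realType} {n : nat} (E : set 'rV[R]_n)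
    (u : 'rV[R]_n -> R[i]) : Prop :=
  C2 E (re_fun u) /\ C2 E (im_fun u).

Definition hlaplacian_complex {R : realType} {n : nat} (u : 'rV[R]_n -> R[i])
    (x : 'rV[R]_n) : R[i] :=
  hlaplacian (re_fun u) x +i* hlaplacian (im_fun u) x.

(* Lebesgue measure on R^n, carried by n.-tuple R with its product
   sigma-algebra: the pushforward of lebesgue_measure \x lebesgue^n by cons. *)
Section lebesgue_tuple.
Context {R : realType}.
Local Notation T := (measurableTypeR R).

Definition tcons n (p : T * n.-tuple T) : n.+1.-tuple T :=
  [tuple of p.1 :: p.2].

Lemma measurable_tcons n : measurable_fun [set: T * n.-tuple T] (@tcons n).
Proof. exact: measurable_cons. Qed.

Section step.
Context (n : nat) (m : {sigma_finite_measure set (n.-tuple T) -> \bar R}).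

Definition lebesgue_cons : set (n.+1.-tuple T) -> \bar R :=
  pushforward (@lebesgue_measure R \x m)%E (@tcons n).

Let push := measure_function_pushforward__canonical__measure_function_Measure
  (@lebesgue_measure R \x m)%E (@measurable_tcons n).

Let lebesgue_cons0 : lebesgue_cons set0 = 0%E.
Proof. exact: (@measure0 _ _ _ push). Qed.

Let lebesgue_cons_ge0 A : (0 <= lebesgue_cons A)%E.
Proof. exact: (@measure_ge0 _ _ _ push). Qed.

Let lebesgue_cons_sigma_additive : semi_sigma_additive lebesgue_cons.
Proof. exact: (@measure_semi_sigma_additive _ _ _ push). Qed.

HB.instance Definition _ := isMeasure.Build _ _ _ lebesgue_cons
  lebesgue_cons0 lebesgue_cons_ge0 lebesgue_cons_sigma_additive.

Let lebesgue_cons_sigma_finite : sigma_finite setT lebesgue_cons.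
Proof.
have /sigma_finiteP[F [TF ndF Foo]] := sigma_finiteT (@lebesgue_measure R).
have /sigma_finiteP[G [TG ndG Goo]] := sigma_finiteT m.
pose H k := F k `*` G k.
have TH : \bigcup_k H k = setT.
  rewrite -subTset => -[x y] _.
  have [i _ Fx] : (\bigcup_k F k) x by rewrite -TF.
  have [j _ Gy] : (\bigcup_k G k) y by rewrite -TG.
  exists (maxn i j) => //; split.
    by move: x Fx; exact/subsetPset/ndF/leq_maxl.
  by move: y Gy; exact/subsetPset/ndG/leq_maxr.
pose g (t : n.+1.-tuple T) : T * n.-tuple T := (thead t, [tuple of behead t]).
have mg : measurable_fun setT g.
  apply/measurable_fun_pairP; split => /=.
    exact: (@measurable_tnth _ _ n.+1 ord0).
  exact: measurable_behead.
exists (fun k => g @^-1` H k).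
  by rewrite -preimage_bigcup TH preimage_setT.
move=> k; have [mF Fk] := Foo k; have [mG Gk] := Goo k; split.
  by rewrite -[X in measurable X]setTI; apply: mg => //; exact: measurableX.
rewrite /lebesgue_cons /pushforward -comp_preimage.
rewrite (_ : g \o _ = id); last first.
  apply/funext => -[a t] /=.
  by rewrite /g /tcons theadE; congr (_, _); exact/val_inj.
by rewrite preimage_id product_measure1E// lte_mul_pinfty// ge0_fin_numE.
Qed.

HB.instance Definition _ := Measure_isSigmaFinite.Build _ _ _ lebesgue_cons
  lebesgue_cons_sigma_finite.
End step.

Fixpoint lebesgue_tuple (n : nat) :
    {sigma_finite_measure set (n.-tuple T) -> \bar R} :=
  match n with
  | 0 => \d_([tuple] : 0.-tuple T)
  | k.+1 => lebesgue_cons (lebesgue_tuple k)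
  end.

End lebesgue_tuple.

Definition vec_of_tuple {R : realType} {n : nat}
  (t : n.-tuple (measurableTypeR R)) : 'rV[R]_n := \row_i tnth t i.

Section sphere_measure.
Context {R : realType} (n : nat).
Local Notation T := (n.-tuple (measurableTypeR R)).

Lemma measurable_enorm_tuple :
  measurable_fun [set: T] (fun t => enorm (vec_of_tuple t)).
Proof.
rewrite /enorm; apply: measurableT_comp.
  by apply: continuous_measurable_fun; exact: sqrt_continuous.
apply: measurable_sum => i; apply: measurable_funX.
rewrite (_ : (fun _ => _) = (@tnth n (measurableTypeR R))^~ i).
  exact: measurable_tnth.
by apply/funext => t; rewrite mxE.
Qed.

Definition radial (r : R) (t : T) : T :=
  [tuple r / enorm (vec_of_tuple t) * tnth t i | i < n].

Lemma measurable_radial (r : R) : measurable_fun [set: T] (radial r).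
Proof.
apply/measurable_fun_tnthP => i.
rewrite (_ : _ \o _ = fun t : T =>
    r * powR (enorm (vec_of_tuple t)) (-1) * tnth t i); last first.
  apply/funext => t; rewrite /= tnth_mktuple powR_inv1 //; exact: sqrtr_ge0.
apply: measurable_funM; last exact: measurable_tnth.
apply: measurable_funM => //.
apply: (@measurableT_comp _ _ _ _ _ _ (fun x : R => powR x (-1))).
  exact: measurable_powR.
exact: measurable_enorm_tuple.
Qed.

Lemma measurable_eball_tuple (r : R) :
  measurable [set t : T | enorm (vec_of_tuple t) <= r].
Proof.
rewrite -[X in measurable X]setTI.
exact: (measurable_enorm_tuple measurableT (measurable_itv `]-oo, r])).
Qed.

(* Surface measure of the sphere |x| = r, r > 0, as the cone measure
   (n / r) * lebesgue {t | |t| <= r /\ r t / |t| \in A}; see sphere_measureE.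
   The absolute value only serves to make the factor nonnegative for all r. *)
Definition sphere_measure (r : R) : {measure set T -> \bar R} :=
  mscale (NngNum (normr_ge0 (n%:R / r)))
    (measure_function_pushforward__canonical__measure_function_Measure
       (mrestr (lebesgue_tuple n) (measurable_eball_tuple r))
       (measurable_radial r)).

Lemma sphere_measureE (r : R) (A : set T) : 0 < r ->
  sphere_measure r A = ((n%:R / r)%:E * lebesgue_tuple n
    [set t | (enorm (vec_of_tuple t) <= r)%R /\ A (radial r t)])%E.
Proof.
move=> r0; rewrite /sphere_measure /= /mscale /= ger0_norm ?divr_ge0 ?(ltW r0)//.
by congr (_ * _)%E; congr (lebesgue_tuple n _); rewrite setIC.
Qed.

End sphere_measure.

Definition hsphere_integral {R : realType} {n : nat}
    (f : 'rV[R]_n -> R) (rho : R) : \bar R :=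
  (\int[sphere_measure n (tanh (rho / 2))]_(t in
      [set t | enorm (vec_of_tuple t) = tanh (rho / 2)])
    (f (vec_of_tuple t) *
     (2 / (1 - enorm (vec_of_tuple t) ^+ 2)) ^+ n.-1)%R%:E)%E.

(* Main.v *)
(* Let f be the real or imaginary part of u. Integrating f against the zonal
   polynomials (w . x)^k over the spheres |x| = r = tanh(t / 2) gives moments
   m_k(t). The rotation fields x_i d_j - x_j d_i have zero integral over spheres,
   so the Helmholtz equation becomes a radial ODE for m_k with source m_(k-2);
   once m_(k-2) = 0, the function w = sinh^((n-1)/2) m_k satisfies
   w'' = - mu^2 w + K w / sinh^2, and its energy w'^2 + mu^2 w^2 only varies by a
   bounded factor. The decay of the surface integrals makes w, hence the energy,
   tend to 0 at infinity, so by induction on k all moments vanish; since powers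
   of (1 + w . x/|x|) / 2 concentrate at the direction w, f = 0 near infinity.
   With zero Cauchy data instead of decay, the same ODE argument around an
   arbitrary point, brought to the origin by a hyperbolic inversion, gives unique
   continuation, and f = 0 on the whole connected exterior. *)

Require Import Defs.
From HB Require Import structures.
From mathcomp Require Import all_boot all_order all_algebra.
From mathcomp Require Import all_classical all_reals all_analysis.
From mathcomp Require Import measurable_realfun complex.
From mathcomp Require Import ring lra.

Set Implicit Arguments.
Unset Strict Implicit.
Unset Printing Implicit Defensive.

Import Order.TTheory GRing.Theory Num.Theory.
Import numFieldNormedType.Exports.

Local Open Scope classical_set_scope.
Local Open Scope ring_scope.
Local Open Scope complex_scope.

(** * Calculus on R^n *)

(** The shift (n-1)^2/4 is the bottom of the spectrum: conjugating by sinh^((n-1)/2) removes the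
    first-order term of the radial equation and leaves only the potential K / sinh^2, integrable at
    infinity. This and mu > 0 make the energy almost conserved. The square of the same factor is the
    growth of the area of spheres, so the hypothesis on u forces w to tend to 0; w' is then
    recovered from the equation.

    The moments are encoded as volume integrals over the fixed shell 1/4 < |x| < 1/2 of functions of
    r x/|x|. The radius enters only the integrand, so one may differentiate under the integral sign,
    and the vanishing for rotation fields becomes integration by parts for a compactly supported C^1
    function. Plain powers (w . x)^k stand in for spherical harmonics; the price is the source of
    order k - 2, absorbed by induction.

    Moments only see annuli around one centre. Inversions transport the equation unchanged, so the
    centre may be taken close to any limit point of the zero set; the estimates are uniform in the
    centre, which lets it be chosen last. *)

Section calculus.
Context {R : realType}.

Lemma cvg_rV (T : Type) (F : set_system T) {FF : Filter F} n
    (g : T -> 'rV[R]_n) (p : 'rV[R]_n) :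
  (forall i, g t 0 i @[t --> F] --> p 0 i) -> g t @[t --> F] --> p.
Proof.
move=> H A [P Pp sPA].
apply: (filterS (P := fun t => forall i, P 0 i (g t 0 i))).
  by move=> t Ht; apply: sPA => i j; rewrite ord1.
by apply: filter_forall => i; apply: (H i); exact: Pp.
Qed.

Lemma cvg_near_eq (T : Type) (U : topologicalType) (F : set_system T)
    {FF : Filter F} (f g : T -> U) (l : U) :
  (\forall t \near F, f t = g t) -> f t @[t --> F] --> l -> g t @[t --> F] --> l.
Proof. by move=> /near_eq_cvg; exact: cvg_trans. Qed.

Lemma coord_continuous_rV n k : continuous (fun x : 'rV[R]_n => x 0 k).
Proof. by move=> x; exact: coord_continuous. Qed.

Lemma normr_coord n (x : 'rV[R]_n) i : `|x 0 i| <= `|x|.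
Proof.
rewrite [leRHS]/Num.norm /= mx_normrE.
by apply: le_trans (le_bigmax _ _ (0, i)) => /=.
Qed.

Lemma normr_rV_le n (x : 'rV[R]_n) e :
  0 <= e -> (forall i, `|x 0 i| <= e) -> `|x| <= e.
Proof.
move=> e0 H; rewrite [leLHS]/Num.norm /= mx_normrE.
by apply: bigmax_le => // -[i j] _ /=; rewrite ord1.
Qed.

Lemma is_derive_line (V : normedModType R) (f : V -> R) (p v : V) (s d : R) :
  is_derive (p + s *: v) v f d <-> is_derive s 1 (fun s => f (p + s *: v)) d.
Proof.
have E : (fun h : R => h^-1 *: ((fun s => f (p + s *: v)) (h *: (1 : R) + s)
      - f (p + s *: v))) =
    (fun h => h^-1 *: (f (h *: v + (p + s *: v)) - f (p + s *: v))).
  by apply/funext => h; rewrite /= scalerDl addrCA [h *: 1]mulr1.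
by split=> -[H1 H2]; (apply: DeriveDef;
  [move: H1; rewrite /derivable E | move: H2; rewrite /derive E]).
Qed.

Lemma is_derive_line0 (V : normedModType R) (f : V -> R) (x v : V) (d : R) :
  is_derive x v f d <-> is_derive (0 : R) 1 (fun s => f (x + s *: v)) d.
Proof.
have := is_derive_line f x v 0 d.
by rewrite scale0r addr0.
Qed.

Lemma is_derive_comp1 (V : normedModType R) (f : V -> R) (g : R -> R)
    (x v : V) (df dg : R) :
  is_derive x v f df -> is_derive (f x) 1 g dg ->
  is_derive x v (fun y => g (f y)) (dg * df).
Proof.
move=> /is_derive_line0 Df Dg; apply/is_derive_line0.
have Dg' : is_derive (f (x + (0 : R) *: v)) 1 g dg by rewrite scale0r addr0.
exact: (@is_derive1_comp _ g (fun s => f (x + s *: v)) _ _ _ Dg' Df).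
Qed.

Lemma is_derive_coord n (x v : 'rV[R]_n) k :
  is_derive x v (fun y : 'rV[R]_n => y 0 k) (v 0 k).
Proof.
have H : h^-1 *: ((h *: v + x) 0 k - x 0 k) @[h --> (0 : R)^'] --> v 0 k.
  apply: cvg_near_eq (cvg_cst (v 0 k)).
  near=> h; rewrite !mxE addrK /= [RHS]mulrA mulVf ?mul1r//.
  by near: h; exact: nbhs_dnbhs_neq.
apply: DeriveDef; first by apply/cvg_ex; exists (v 0 k).
exact/cvg_lim.
Unshelve. all: by end_near. Qed.

Lemma mean_value0 (f : R -> R) (d : R) :
  (forall c, `|c| <= `|d| -> derivable f c 1) ->
  exists2 c, `|c| <= `|d| & f d - f 0 = 'D_1 f c * d.
Proof.
move=> df.
have cf (a b : R) : (forall c, c \in `[a, b] -> `|c| <= `|d|) ->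
    {within `[a, b], continuous f}.
  by move=> H; apply: derivable_within_continuous => x /H /df.
have [d0|d0] := leP 0 d.
  have H c : c \in `[0, d] -> `|c| <= `|d|.
    by rewrite in_itv/= => /andP[c0 cd]; rewrite !ger0_norm.
  have [|c /H cd ->] := @MVT_segment _ f ('D_1 f) _ _ d0 _ (cf _ _ H).
    by move=> x /subset_itv_oo_cc/H/df/derivableP.
  by exists c; rewrite ?subr0.
have H c : c \in `[d, 0] -> `|c| <= `|d|.
  by rewrite in_itv/= => /andP[c0 cd]; rewrite !ler0_norm ?lerN2// ltW.
have [|c /H cd E] := @MVT_segment _ f ('D_1 f) _ _ (ltW d0) _ (cf _ _ H).
  by move=> x /subset_itv_oo_cc/H/df/derivableP.
by exists c => //; rewrite -opprB E sub0r mulrN opprK.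
Qed.

(* Move from [p] to [p + d] one coordinate at a time. *)
Lemma partial_mean_value n (F : 'rV[R]_n -> R) (p : 'rV[R]_n) (e : R) :
  (forall y, `|y - p| < e -> forall i, derivable F y (delta_mx 0 i)) ->
  forall d : 'rV[R]_n, `|d| < e -> exists xi : 'I_n -> 'rV[R]_n,
    (forall k, `|xi k - p| <= `|d|) /\
    F (p + d) - F p = \sum_k partial k F (xi k) * d 0 k.
Proof.
move=> dF d de.
(* Vertices of the broken line: [y k] has already moved in the coordinates below [k]. *)
pose y (k : nat) : 'rV[R]_n := p + \row_j (if (j < k)%N then d 0 j else 0).
have step (k : 'I_n) : exists xi, `|xi - p| <= `|d| /\
    F (y k.+1) - F (y k) = partial k F xi * d 0 k.
  (* Truncating coordinates does not increase the sup norm, so the whole broken line stays in the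
     ball where [F] has partial derivatives. *)
  have bd s : `|s| <= `|d 0 k| -> `|y k + s *: delta_mx 0 k - p| <= `|d|.
    move=> sd; apply: normr_rV_le => // j; rewrite !mxE eqxx/=.
    case: (eqVneq j k) => [->|jk] /=.
      rewrite ltnn mulr1 addr0 addrAC subrr add0r (le_trans sd)//.
      exact: normr_coord.
    rewrite mulr0 addr0 addrAC subrr add0r; case: ifP => _.
      exact: normr_coord.
    by rewrite normr0.
  have [|c cd] := @mean_value0 (fun s => F (y k + s *: delta_mx 0 k)) (d 0 k).
    move=> c cd; have /derivableP : derivable F (y k + c *: delta_mx 0 k)
      (delta_mx 0 k) by apply: dF; apply: le_lt_trans de; exact: bd.
    by move/is_derive_line => -[].
  rewrite scale0r addr0 => E.
  exists (y k + c *: delta_mx 0 k); split; first exact: bd.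
  have -> : y k.+1 = y k + d 0 k *: delta_mx 0 k.
    apply/rowP => j; rewrite !mxE eqxx/= -addrA; congr (_ + _).
    rewrite ltnS leq_eqVlt; case: (eqVneq j k) => [->|jk] /=.
      by rewrite eqxx/= ltnn add0r mulr1.
    by rewrite mulr0 addr0 (negbTE (_ : nat_of_ord j != k)).
  rewrite E /partial; congr (_ * _).
  have /derivableP : derivable F (y k + c *: delta_mx 0 k)
      (delta_mx 0 k) by apply: dF; apply: le_lt_trans de; exact: bd.
  by move/is_derive_line => -[_ ->].
have /choice[xi xiP] := step.
exists xi; split; first by move=> k; exact: (xiP k).1.
rewrite -(eq_bigr _ (fun k _ => (xiP k).2)).
rewrite -(big_mkord xpredT (fun k => F (y k.+1) - F (y k))) telescope_sumr//.
congr (F _ - F _); rewrite /y; last first.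
  by rewrite [X in _ + X](_ : _ = 0) ?addr0//; apply/rowP => j; rewrite !mxE.
by congr (_ + _); apply/rowP => j; rewrite !mxE ltn_ord.
Qed.

(** Phrased with partial derivatives only, as [C2] is; their continuity yields the chain rule and
    the continuity of [F]. *)
Definition C1_on {n} (U : set 'rV[R]_n) (F : 'rV[R]_n -> R) : Prop :=
  forall x, U x -> forall i,
    derivable F x (delta_mx 0 i) /\ {for x, continuous (partial i F)}.

Definition C2_on {n} (U : set 'rV[R]_n) (F : 'rV[R]_n -> R) : Prop :=
  C1_on U F /\ forall i, C1_on U (partial i F).

Lemma open_sball n (U : set 'rV[R]_n) p : open U -> U p ->
  exists2 e, 0 < e & forall y, `|y - p| < e -> U y.
Proof.
move=> oU Up; have /nbhs_ballP[e /= e0 He] := open_nbhs_nbhs (conj oU Up).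
by exists e => // y yp; apply: He; rewrite -ball_normE /= distrC.
Qed.

(** The mean value formula writes the increment of [F] with partial derivatives at intermediate
    points; these points tend to [g x], and the partial derivatives are continuous there. [g] is
    only differentiated along the line of direction [v]. *)
Lemma C1_on_is_derive_comp n (V : normedModType R) (U : set 'rV[R]_n)
    (F : 'rV[R]_n -> R) (g : V -> 'rV[R]_n) (dg : 'I_n -> R) (x v : V) :
  open U -> C1_on U F -> U (g x) ->
  (forall k, is_derive x v (fun y => g y 0 k) (dg k)) ->
  is_derive x v (fun y => F (g y)) (\sum_k partial k F (g x) * dg k).
Proof.
move=> oU CF Ux dgk.
have [e e0 He] := open_sball oU Ux.
set p := g x in Ux He *.
have [xi xiP] : exists xi : 'rV[R]_n -> 'I_n -> 'rV[R]_n, forall d, `|d| < e ->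
    (forall k, `|xi d k - p| <= `|d|) /\
    F (p + d) - F p = \sum_k partial k F (xi d k) * d 0 k.
  pose P (d : 'rV[R]_n) (xi : 'I_n -> 'rV[R]_n) := `|d| < e ->
    (forall k, `|xi k - p| <= `|d|) /\
    F (p + d) - F p = \sum_k partial k F (xi k) * d 0 k.
  suff /choice[xi xiP] : forall d, exists xi, P d xi by exists xi.
  move=> d; rewrite /P.
  (* Large increments get a default value, so that [xi] is total and [choice] applies. *)
  case: (ltP `|d| e) => de; last by exists (fun=> 0).
  have [|xi H] := @partial_mean_value n F p e _ d de; last by exists xi.
  by move=> y /He Uy i; exact: (CF _ Uy i).1.
pose D h := g (h *: v + x) - p.
have Dk k : h^-1 * D h 0 k @[h --> (0 : R)^'] --> dg k.
  have [dk <-] := dgk k; move: dk; rewrite /derivable => dk.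
  by rewrite /D; under eq_fun do rewrite !mxE; exact: dk.
have D0 : D h @[h --> (0 : R)^'] --> (0 : 'rV[R]_n).
  apply: cvg_rV => k; rewrite [X in _ --> X](_ : _ = 0 * dg k); last first.
    by rewrite mxE mul0r.
  have h0 : h @[h --> (0 : R)^'] --> (0 : R) by exact: cvg_within.
  apply: cvg_near_eq (cvgM h0 (Dk k)).
  near=> h; rewrite mulrA mulfV ?mul1r//.
  by near: h; exact: nbhs_dnbhs_neq.
have De : \forall h \near (0 : R)^', `|D h| < e.
  by move/cvgr0_norm_lt : D0; apply.
have xip k : xi (D h) k @[h --> (0 : R)^'] --> p.
  apply/cvgrPdist_lt => r r0.
  have Dr : \forall h \near (0 : R)^', `|D h| < r.
    by move/cvgr0_norm_lt : D0; apply.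
  near=> h; rewrite distrC; apply: le_lt_trans (_ : `|D h| < r).
    by apply: (xiP (D h) _).1; near: h.
  by near: h.
have key : h^-1 *: (F (g (h *: v + x)) - F (g x)) @[h --> (0 : R)^'] -->
    \sum_k partial k F p * dg k.
  have H : \sum_k partial k F (xi (D h) k) * (h^-1 * D h 0 k) @[h --> (0 : R)^']
     --> \sum_k partial k F p * dg k.
    apply: cvg_big => [|k _]; first exact: add_continuous.
    apply: (cvgM _ (Dk k)).
    by apply: continuous_cvg; [exact: (CF _ Ux k).2|exact: xip].
  apply: cvg_near_eq H; near=> h.
  have De' : `|D h| < e by near: h.
  have := (xiP (D h) De').2; rewrite [p + D h]addrC subrK => ->.
  rewrite /= [RHS]mulr_sumr; apply: eq_bigr => k _.
  by rewrite mulrCA.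
apply: DeriveDef; first by apply/cvg_ex; exists (\sum_k partial k F p * dg k).
exact/cvg_lim.
Unshelve. all: by end_near. Qed.

Lemma C1_on_continuous n (U : set 'rV[R]_n) (F : 'rV[R]_n -> R) x :
  open U -> C1_on U F -> U x -> {for x, continuous F}.
Proof.
move=> oU CF Ux; have [e e0 He] := open_sball oU Ux.
have [xi xiP] : exists xi : 'rV[R]_n -> 'I_n -> 'rV[R]_n, forall y, `|y - x| < e ->
    (forall k, `|xi y k - x| <= `|y - x|) /\
    F y = F x + \sum_k partial k F (xi y k) * (y - x) 0 k.
  pose P (y : 'rV[R]_n) (xi : 'I_n -> 'rV[R]_n) := `|y - x| < e ->
    (forall k, `|xi k - x| <= `|y - x|) /\
    F y = F x + \sum_k partial k F (xi k) * (y - x) 0 k.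
  suff /choice[xi xiP] : forall y, exists xi, P y xi by exists xi.
  move=> y; rewrite /P.
  case: (ltP `|y - x| e) => de; last by exists (fun=> 0).
  have [|xi [H1 H2]] := @partial_mean_value n F x e _ (y - x) de.
    by move=> z /He Uz i; exact: (CF _ Uz i).1.
  by exists xi => _; split => //; rewrite -H2 [x + _]addrC subrK addrC subrK.
have ye : \forall y \near x, `|y - x| < e.
  by apply/nbhs_ballP; exists e => //= y; rewrite -ball_normE/= distrC.
have xic k : xi y k @[y --> x] --> x.
  apply/(@cvgrPdist_lt _ _ _ (nbhs x)) => r r0.
  have yr : \forall y \near x, `|y - x| < r.
    by apply/nbhs_ballP; exists r => //= y; rewrite -ball_normE/= distrC.
  near=> y; rewrite distrC; apply: le_lt_trans (_ : `|y - x| < r).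
    by apply: (xiP y _).1; near: y.
  by near: y.
have H : F x + \sum_k partial k F (xi y k) * (y 0 k - x 0 k) @[y --> x] --> F x + 0.
  apply: (@cvgD _ _ _ (nbhs x) _ (cst (F x))); first exact: cvg_cst.
  rewrite [X in _ --> X](_ : _ = \sum_k partial k F x * (x 0 k - x 0 k)).
    apply: cvg_big => [|k _]; first exact: add_continuous.
    apply: (@cvgM _ _ (nbhs x)); last first.
      by apply: (@cvgB _ _ _ (nbhs x)); [exact: coord_continuous_rV|exact: cvg_cst].
    exact: (@cvg_comp _ _ _ (fun y => xi y k) (partial k F) (nbhs x) (nbhs x)
      (nbhs (partial k F x)) (xic k) (CF _ Ux k).2).
  by rewrite big1// => k _; rewrite subrr mulr0.
rewrite addr0 in H; apply: (@cvg_near_eq _ _ (nbhs x) _ _ _ _ _ H); near=> y.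
have ye' : `|y - x| < e by near: y.
rewrite [RHS](xiP y ye').2; congr (_ + _); apply: eq_bigr => k _.
by rewrite !mxE.
Unshelve. all: by end_near. Qed.

End calculus.

(** * Lebesgue measure on tuples: cubes, Fubini, integrals of derivatives *)

Section lebesgue_tuple_theory.
Context {R : realType}.
Local Notation T := (measurableTypeR R).
Implicit Types n : nat.

Lemma tnth_tcons0 n (a : T) (t : n.-tuple T) : tnth (tcons (a, t)) ord0 = a.
Proof. by rewrite /tcons tnth0. Qed.

Lemma tnth_tconsS n (a : T) (t : n.-tuple T) (i : 'I_n) :
  tnth (tcons (a, t)) (lift ord0 i) = tnth t i.
Proof. by rewrite /tcons tnthS. Qed.

Definition cube n (c : 'I_n -> R) (r : R) : set (n.-tuple T) :=
  [set t | forall i, `|tnth t i - c i| <= r].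

Lemma measurable_cube n (c : 'I_n -> R) r : measurable (cube c r).
Proof.
rewrite (_ : cube c r = \bigcap_(i in [set: 'I_n])
    ((fun t => tnth t i) @^-1` `[c i - r, c i + r])); last first.
  apply/seteqP; split => [t H i _|t H i].
    by rewrite /= in_itv/= -ler_distl.
  by have := H i I; rewrite /= in_itv/= -ler_distl.
apply: fin_bigcap_measurable; first exact: finite_finset.
move=> i _; rewrite -[X in measurable X]setTI.
exact: (measurable_tnth i measurableT (measurable_itv _)).
Qed.

Lemma lebesgue_cube n (c : 'I_n -> R) r : 0 <= r ->
  lebesgue_tuple n (cube c r) = ((2 * r) ^+ n)%:E.
Proof.
move=> r0; elim: n c => [c|n IH c].
  rewrite expr0 /= diracE mem_set//.
  by case.
rewrite /= /lebesgue_cons /pushforward.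
rewrite (_ : _ @^-1` _ = `[c ord0 - r, c ord0 + r] `*`
    cube (fun i => c (lift ord0 i)) r); last first.
  apply/seteqP; split => [[a t] /= H|[a t] /= [H1 H2] i].
    split; first by have := H ord0; rewrite tnth_tcons0 /= in_itv/= -ler_distl.
    by move=> i; have := H (lift ord0 i); rewrite tnth_tconsS.
  case: (unliftP ord0 i) => [k ->|->]; first by rewrite tnth_tconsS; exact: H2.
  by rewrite tnth_tcons0 ler_distl; rewrite in_itv/= in H1.
rewrite product_measure1E//; last exact: measurable_cube.
have L : lebesgue_measure (`[c ord0 - r, c ord0 + r]%classic : set R) =
    (2 * r)%:E.
  rewrite lebesgue_measure_itv/= lte_fin; case: ltP => h.
    by rewrite -EFinD; congr (_%:E); lra.
  by congr (_%:E); lra.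
rewrite IH [X in (X * _)%E](_ : _ = (2 * r)%:E); last exact: L.
by rewrite -EFinM exprS.
Qed.

(** The cube [-1, 1]^n contains the shell 1/4 < |x| < 1/2; its finite measure makes bounded
    measurable functions supported in it integrable. *)
Definition unit_cube n : set (n.-tuple T) := cube (fun=> 0) 1.

Lemma lebesgue_unit_cube_fin n : (lebesgue_tuple n (@unit_cube n) < +oo)%E.
Proof. by rewrite lebesgue_cube ?ltry. Qed.

Lemma unit_cube_integrable n (f : n.-tuple T -> R) (C : R) :
  measurable_fun setT f -> (forall t, `|f t| <= C) ->
  (forall t, ~ @unit_cube n t -> f t = 0) ->
  (lebesgue_tuple n).-integrable setT (EFin \o f).
Proof.
move=> mf fC f0.
have mU : measurable (@unit_cube n) by exact: measurable_cube.
have -> : EFin \o f = (EFin \o f) \_ (@unit_cube n).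
  apply/funext => t; rewrite /patch; case: ifPn => // /negP nt.
  by rewrite /= f0// => tU; apply: nt; rewrite inE.
apply/(integrable_mkcond _ mU).1.
apply: measurable_bounded_integrable => //.
- exact: lebesgue_unit_cube_fin.
- exact: measurable_funTS.
- exists C; split; first exact: num_real.
  by move=> x /ltW Cx t _; exact: le_trans Cx.
Qed.

Definition tset n (t : n.-tuple T) (j : 'I_n) (s : R) : n.-tuple T :=
  [tuple if i == j then s else tnth t i | i < n].

Lemma tset_tcons0 n a (t : n.-tuple T) s : tset (tcons (a, t)) ord0 s = tcons (s, t).
Proof.
apply: eq_from_tnth => i; rewrite tnth_mktuple.
case: (unliftP ord0 i) => [k ->|->]; last by rewrite eqxx tnth_tcons0.
by rewrite !tnth_tconsS.
Qed.

Lemma tset_tconsS n a (t : n.-tuple T) (j : 'I_n) s :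
  tset (tcons (a, t)) (lift ord0 j) s = tcons (a, tset t j s).
Proof.
apply: eq_from_tnth => i; rewrite tnth_mktuple.
case: (unliftP ord0 i) => [k ->|->]; last by rewrite !tnth_tcons0.
by rewrite !tnth_tconsS tnth_mktuple (inj_eq lift_inj).
Qed.

Lemma unit_cube_tcons n a (t : n.-tuple T) :
  @unit_cube n.+1 (tcons (a, t)) <-> `|a| <= 1 /\ @unit_cube n t.
Proof.
split=> [H|[H1 H2] i].
  split; first by have := H ord0; rewrite tnth_tcons0 subr0.
  by move=> i; have := H (lift ord0 i); rewrite tnth_tconsS.
case: (unliftP ord0 i) => [k ->|->]; first by rewrite tnth_tconsS; exact: H2.
by rewrite tnth_tcons0 subr0.
Qed.

(** Both orders of integration are recorded: in [integral_partial0] the differentiated coordinate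
    has to be innermost, and it may be the first one or a later one. *)
Lemma integral_tcons n (f : n.+1.-tuple T -> R) (C : R) :
  measurable_fun setT f -> (forall t, `|f t| <= C) ->
  (forall t, ~ @unit_cube n.+1 t -> f t = 0) ->
  (\int[lebesgue_tuple n.+1]_t (f t)%:E =
   \int[lebesgue_measure]_a \int[lebesgue_tuple n]_t (f (tcons (a, t)))%:E)%E /\
  (\int[lebesgue_tuple n.+1]_t (f t)%:E =
   \int[lebesgue_tuple n]_t \int[lebesgue_measure]_a (f (tcons (a, t)))%:E)%E.
Proof.
move=> mf fC f0.
have mU : measurable (`[-1, 1] `*` @unit_cube n : set (T * n.-tuple T)).
  by apply: measurableX => //; exact: measurable_cube.
have mft : measurable_fun [set: T * n.-tuple T] (f \o @tcons R n).
  by apply: measurableT_comp => //; exact: measurable_tcons.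
have intf : (lebesgue_measure \x lebesgue_tuple n)%E.-integrable setT
    (EFin \o f \o @tcons R n).
  have -> : EFin \o f \o @tcons R n =
      (EFin \o f \o @tcons R n) \_ (`[-1, 1] `*` @unit_cube n).
    apply/funext => -[a t]; rewrite /patch; case: ifPn => // /negP nt.
    rewrite /= f0// => /unit_cube_tcons[aU tU]; apply: nt; rewrite inE; split => //=.
    by rewrite in_itv/= -ler_norml.
  apply/(integrable_mkcond _ mU).1.
  apply: (@measurable_bounded_integrable _ _ _ _ (f \o @tcons R n)) => //.
  - pose A : set R := `[-1, 1]%classic.
    suff E : ((lebesgue_measure \x lebesgue_tuple n)
        (A `*` @unit_cube n) < +oo)%E by exact: E.
    rewrite product_measure1E; last exact: measurable_cube.
    have L : lebesgue_measure A = (1 + 1)%:E.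
      by rewrite lebesgue_measure_itv/= lte_fin (lt_trans (ltrN10 R) ltr01) -EFinD opprK.
    rewrite [X in (_ * X)%E](lebesgue_cube _ ler01).
    by rewrite [X in (X * _)%E](_ : _ = (1 + 1)%:E) ?ltry//; exact: L.
    exact: measurable_itv.
  - exact: (measurable_funS measurableT _ mft).
  - exists C; split; first exact: num_real.
    by move=> x /ltW Cx t _; exact: (le_trans (fC _) Cx).
have -> : (\int[lebesgue_tuple n.+1]_t (f t)%:E =
    \int[(lebesgue_measure \x lebesgue_tuple n)%E]_z (EFin \o f \o @tcons R n) z)%E.
  rewrite -(@integral_pushforward _ _ _ _ _ (@tcons R n) (@measurable_tcons R n) _
    setT (EFin \o f)) ?preimage_setT//.
  exact/measurable_EFinP.
split; first by rewrite -(integral12_prod_meas1 intf).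
by rewrite -(integral21_prod_meas1 intf).
Qed.

Lemma integral_derivative0 (G D : R -> R) :
  (forall s : R, is_derive s 1 G (D s)) -> continuous D ->
  (forall s, ~ `|s| <= 1 -> G s = 0) -> (forall s, ~ `|s| <= 1 -> D s = 0) ->
  (\int[lebesgue_measure]_s (D s)%:E = 0)%E.
Proof.
move=> dG cD G0 D0.
(* The interval exceeds [-1, 1] because [G] is known to vanish only outside [-1, 1]; at the
   endpoints -2 and 2 it does. *)
have -> : (fun s => (D s)%:E) = (EFin \o D) \_ `[-2, 2].
  apply/funext => s; rewrite /patch; case: ifPn => // /negP ns.
  rewrite D0// => s1; apply: ns; rewrite inE/= in_itv/=.
  by move: s1; rewrite ler_norml; lra.
rewrite -integral_mkcond.
have cG x : {for x, continuous G}.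
  by apply/differentiable_continuous/derivable1_diffP; exact: (@ex_derive _ _ _ _ _ _ _ (dG x)).
rewrite (@continuous_FTC2 _ D G).
- by rewrite !G0 ?subee//; [rewrite ler_norml|rewrite ler_norml]; lra.
- by rewrite -subr_gt0; lra.
- exact: continuous_subspaceT.
- split.
  + by move=> x _; exact: (@ex_derive _ _ _ _ _ _ _ (dG x)).
  + by apply: cvg_at_right_filter; exact: cG.
  + by apply: cvg_at_left_filter; exact: cG.
- by move=> x _; rewrite derive1E; exact: (@derive_val _ _ _ _ _ _ _ (dG x)).
Qed.

(** Fubini brings the coordinate [j] innermost, where the fundamental theorem of calculus gives 0;
    the induction peels off the coordinates before [j]. *)
Lemma integral_partial0 n (j : 'I_n) (G D : n.-tuple T -> R) (C : R) :
  measurable_fun setT D -> (forall t, `|D t| <= C) ->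
  (forall t, ~ @unit_cube n t -> D t = 0) ->
  (forall t, ~ @unit_cube n t -> G t = 0) ->
  (forall t (s : R), is_derive s 1 (fun s => G (tset t j s)) (D (tset t j s))) ->
  (forall t, continuous (fun s => D (tset t j s))) ->
  (\int[lebesgue_tuple n]_t (D t)%:E = 0)%E.
Proof.
elim: n j G D => [[]//|n IH] j G D mD DC D0 G0 dG cD.
have [E1 E2] := integral_tcons mD DC D0.
case: (unliftP ord0 j) => [k|] jk; move: dG cD; rewrite {j}jk => dG cD.
  rewrite E1; apply: integral0_eq => a _.
  apply: (IH k (fun t => G (tcons (a, t)))) => //.
  - apply: (measurableT_comp mD).
    apply: (measurableT_comp (@measurable_tcons R n)).
    exact: measurable_pair1.
  - by move=> t H; apply: D0 => /unit_cube_tcons[].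
  - by move=> t H; apply: G0 => /unit_cube_tcons[].
  - by move=> t s; have := dG (tcons (a, t)) s; under eq_fun do rewrite tset_tconsS; rewrite tset_tconsS.
  - by move=> t; have := cD (tcons (a, t)); under eq_fun do rewrite tset_tconsS.
rewrite E2; apply: integral0_eq => t _.
apply: (integral_derivative0 (G := fun a => G (tcons (a, t)))).
- by move=> s; have := dG (tcons (0, t)) s; under eq_fun do rewrite tset_tcons0; rewrite tset_tcons0.
- by have := cD (tcons (0, t)); under eq_fun do rewrite tset_tcons0.
- by move=> s H; apply: G0 => /unit_cube_tcons[].
- by move=> s H; apply: D0 => /unit_cube_tcons[].
Qed.

End lebesgue_tuple_theory.

(** * Pointwise differentiation rules for real-valued functions *)

Section derive_rules.
Context {R : realType} (V : normedModType R).
Implicit Types (f g : V -> R) (x v : V).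

Lemma is_derive_mul f g x v a b : is_derive x v f a -> is_derive x v g b ->
  is_derive x v (fun y => f y * g y) (a * g x + f x * b).
Proof.
move=> Df Dg; apply: (is_derive_eq (is_deriveM Df Dg)).
by rewrite addrC; congr (_ + _); exact: mulrC.
Qed.

Lemma is_derive_add f g x v a b : is_derive x v f a -> is_derive x v g b ->
  is_derive x v (fun y => f y + g y) (a + b).
Proof. exact: is_deriveD. Qed.

Lemma is_derive_opp f x v a : is_derive x v f a ->
  is_derive x v (fun y => - f y) (- a).
Proof. exact: is_deriveN. Qed.

Lemma is_derive_sub f g x v a b : is_derive x v f a -> is_derive x v g b ->
  is_derive x v (fun y => f y - g y) (a - b).
Proof. exact: is_deriveB. Qed.

Lemma is_derive_const (c : R) x v : is_derive x v (fun=> c) 0.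
Proof. exact: is_derive_cst. Qed.

Lemma is_derive_cmul f x v a (c : R) : is_derive x v f a ->
  is_derive x v (fun y => c * f y) (c * a).
Proof.
move=> Df; apply: (is_derive_eq (is_derive_mul (is_derive_const c x v) Df)).
by rewrite mul0r add0r.
Qed.

Lemma is_derive_bigsum n (f : 'I_n -> V -> R) x v (a : 'I_n -> R) :
  (forall i, is_derive x v (f i) (a i)) ->
  is_derive x v (fun y => \sum_i f i y) (\sum_i a i).
Proof.
move=> H; have := is_derive_sum H.
by congr (is_derive _ _ _ _); apply/funext => y; rewrite fct_sumE.
Qed.

Lemma is_derive_pow f x v a k : is_derive x v f a ->
  is_derive x v (fun y => f y ^+ k) (k%:R * f x ^+ k.-1 * a).
Proof.
move=> Df.
have Dg : is_derive (f x) 1 (fun y : R => y ^+ k) (k%:R * f x ^+ k.-1).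
  have := @is_deriveX _ _ id k (f x) 1 1 (is_derive_id _ _).
  by rewrite exprfctE [_ *: 1]mulr1.
exact: (is_derive_comp1 (g := fun y : R => y ^+ k) Df Dg).
Qed.

Lemma is_derive_inv f x v a : f x != 0 -> is_derive x v f a ->
  is_derive x v (fun y => (f y)^-1) (- (f x) ^- 2 * a).
Proof.
move=> fx Df.
have Dg : is_derive (f x) 1 (fun y : R => y^-1) (- (f x) ^- 2).
  have := @is_deriveV _ id (f x) 1 1 fx (is_derive_id _ _).
  by rewrite [_ *: 1]mulr1.
exact: (is_derive_comp1 (g := fun y : R => y^-1) Df Dg).
Qed.

End derive_rules.

(** * Euclidean norm, inner product and radial projection *)

Section euclidean.
Context {R : realType}.
Implicit Types n : nat.

Definition dot n (x y : 'rV[R]_n) : R := \sum_k x 0 k * y 0 k.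

Lemma enorm_ge0 n (x : 'rV[R]_n) : 0 <= enorm x.
Proof. exact: sqrtr_ge0. Qed.

Lemma enorm_sqr n (x : 'rV[R]_n) : enorm x ^+ 2 = \sum_k x 0 k ^+ 2.
Proof. by rewrite sqr_sqrtr// sumr_ge0// => k _; exact: sqr_ge0. Qed.

Lemma dotxx n (x : 'rV[R]_n) : dot x x = enorm x ^+ 2.
Proof. by rewrite enorm_sqr; apply: eq_bigr => k _; rewrite expr2. Qed.

Lemma dotC n (x y : 'rV[R]_n) : dot x y = dot y x.
Proof. by apply: eq_bigr => k _; rewrite mulrC. Qed.

Lemma dotDl n (x y z : 'rV[R]_n) : dot (x + y) z = dot x z + dot y z.
Proof. by rewrite -big_split; apply: eq_bigr => k _; rewrite mxE mulrDl. Qed.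

Lemma dotZl n a (x z : 'rV[R]_n) : dot (a *: x) z = a * dot x z.
Proof. by rewrite mulr_sumr; apply: eq_bigr => k _; rewrite mxE mulrA. Qed.

Lemma dotDr n (x y z : 'rV[R]_n) : dot z (x + y) = dot z x + dot z y.
Proof. by rewrite dotC dotDl !(dotC z). Qed.

Lemma dotZr n a (x z : 'rV[R]_n) : dot z (a *: x) = a * dot z x.
Proof. by rewrite dotC dotZl (dotC z). Qed.

Lemma dotNl n (x z : 'rV[R]_n) : dot (- x) z = - dot x z.
Proof. by rewrite -scaleN1r dotZl mulN1r. Qed.

Lemma dotNr n (x z : 'rV[R]_n) : dot z (- x) = - dot z x.
Proof. by rewrite dotC dotNl dotC. Qed.

Lemma enorm0 n : enorm (0 : 'rV[R]_n) = 0.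
Proof. by rewrite /enorm big1 ?sqrtr0// => k _; rewrite mxE expr0n. Qed.

Lemma enormZ n a (x : 'rV[R]_n) : enorm (a *: x) = `|a| * enorm x.
Proof.
apply/eqP; rewrite -(eqrXn2 (n := 2))// ?enorm_ge0 ?mulr_ge0 ?enorm_ge0//.
rewrite exprMn !enorm_sqr mulr_sumr; apply/eqP/eq_bigr => k _.
by rewrite mxE exprMn real_normK ?num_real.
Qed.

Lemma enormN n (x : 'rV[R]_n) : enorm (- x) = enorm x.
Proof. by rewrite -scaleN1r enormZ normrN1 mul1r. Qed.

Lemma normr_coord_enorm n (x : 'rV[R]_n) i : `|x 0 i| <= enorm x.
Proof.
rewrite -(ler_pXn2r (n := 2))// ?nnegrE ?enorm_ge0//.
rewrite enorm_sqr real_normK ?num_real// (bigD1 i)//= lerDl.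
by apply: sumr_ge0 => k _; exact: sqr_ge0.
Qed.

Lemma normr_le_enorm n (x : 'rV[R]_n) : `|x| <= enorm x.
Proof. by apply: normr_rV_le => [|i]; [exact: enorm_ge0|exact: normr_coord_enorm]. Qed.

Lemma enorm_eq0 n (x : 'rV[R]_n) : (enorm x == 0) = (x == 0).
Proof.
apply/idP/idP => [/eqP E|/eqP ->]; last by rewrite enorm0.
by rewrite -normr_le0 -E normr_le_enorm.
Qed.

Lemma enorm_gt0 n (x : 'rV[R]_n) : (0 < enorm x) = (x != 0).
Proof. by rewrite lt_def enorm_ge0 andbT enorm_eq0. Qed.

(** Cauchy-Schwarz, by expanding the square of | |y| x - |x| y |. *)
Lemma dot_le_enorm n (x y : 'rV[R]_n) : dot x y <= enorm x * enorm y.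
Proof.
have [->|x0] := eqVneq x 0.
  by rewrite enorm0 mul0r /dot big1// => k _; rewrite mxE mul0r.
have [->|y0] := eqVneq y 0.
  by rewrite enorm0 mulr0 /dot big1// => k _; rewrite mxE mulr0.
have a0 : 0 < enorm x by rewrite enorm_gt0.
have b0 : 0 < enorm y by rewrite enorm_gt0.
have := sqr_ge0 (enorm (enorm y *: x - enorm x *: y)).
rewrite -dotxx !(dotDl, dotDr, dotNl, dotNr, dotZl, dotZr) !dotxx (dotC y x).
have ab := mulr_gt0 a0 b0.
by move=> H; rewrite -(ler_pM2l ab); lra.
Qed.

Lemma normr_dot_le n (x y : 'rV[R]_n) : `|dot x y| <= enorm x * enorm y.
Proof.
rewrite ler_norml dot_le_enorm andbT lerNl -dotNl -(enormN x).
exact: dot_le_enorm.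
Qed.

Lemma enorm_triangle n (x y : 'rV[R]_n) : enorm (x + y) <= enorm x + enorm y.
Proof.
rewrite -(ler_pXn2r (n := 2))// ?nnegrE ?addr_ge0 ?enorm_ge0//.
rewrite -dotxx dotDl !dotDr !dotxx (dotC y x) sqrrD.
by have := dot_le_enorm x y; lra.
Qed.

Lemma continuous_bigsum n (T : topologicalType) (f : 'I_n -> T -> R) (x : T) :
  (forall i, {for x, continuous (f i)}) ->
  {for x, continuous (fun y => \sum_i f i y)}.
Proof. by move=> H; apply: cvg_big => [|k _]; [exact: add_continuous|exact: H]. Qed.

Lemma enorm_continuous n : continuous (@enorm R n).
Proof.
move=> x; apply: (continuous_comp (g := Num.sqrt)); last exact: sqrt_continuous.
apply: continuous_bigsum => k.
rewrite (_ : (fun y : 'rV_n => _) = (fun y : 'rV_n => y 0 k * y 0 k)).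
  by apply: continuousM; exact: coord_continuous_rV.
by apply/funext => y; rewrite expr2.
Qed.

Definition unitv n (x : 'rV[R]_n) : 'rV[R]_n := (enorm x)^-1 *: x.

Lemma enorm_unitv n (x : 'rV[R]_n) : x != 0 -> enorm (unitv x) = 1.
Proof.
move=> x0; rewrite enormZ ger0_norm ?invr_ge0 ?enorm_ge0// mulVf//.
by rewrite enorm_eq0.
Qed.

Definition annulus n (a b : R) : set 'rV[R]_n := [set x | a < enorm x < b].

Lemma annulus_scale_unitv n a b r (x : 'rV[R]_n) : 0 <= a -> a < r < b -> x != 0 ->
  annulus a b (r *: unitv x).
Proof.
move=> a0 /andP[ar rb] x0; rewrite /annulus/= enormZ enorm_unitv// mulr1.
by rewrite ger0_norm ?ar// ltW// (le_lt_trans a0).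
Qed.

Lemma open_annulus n a b : open (@annulus n a b).
Proof.
rewrite (_ : annulus a b = @enorm R n @^-1` `]a, b[%classic); last first.
  by apply/seteqP; split => x /=; rewrite in_itv.
by apply: open_comp; [move=> x _; exact: enorm_continuous|exact: interval_open].
Qed.

Lemma delta_rV n (j k : 'I_n) : (delta_mx 0 j : 'rV[R]_n) 0 k = (k == j)%:R.
Proof. by rewrite mxE eqxx. Qed.

Lemma sum_deltal n (f : 'I_n -> R) j : \sum_k (k == j)%:R * f k = f j.
Proof.
rewrite (bigD1 j)//= eqxx mul1r big1 ?addr0// => k kj.
by rewrite (negbTE kj) mul0r.
Qed.

Lemma enorm_delta n (j : 'I_n) : enorm (delta_mx 0 j : 'rV[R]_n) = 1.
Proof.
rewrite /enorm (eq_bigr (fun k => (k == j)%:R * 1)); first by rewrite sum_deltal sqrtr1.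
by move=> k _; rewrite delta_rV; case: eqP => _; rewrite ?expr1n ?expr0n ?mulr1.
Qed.

Lemma is_derive_sqnorm n (x : 'rV[R]_n) j :
  is_derive x (delta_mx 0 j) (fun y => \sum_k y 0 k ^+ 2) (2 * x 0 j).
Proof.
apply: (is_derive_eq (is_derive_bigsum
  (fun k => is_derive_pow 2 (is_derive_coord x (delta_mx 0 j) k)))).
under eq_bigr do rewrite expr1 delta_rV mulrC.
by rewrite sum_deltal.
Qed.

Lemma is_derive_enorm n (x : 'rV[R]_n) j : x != 0 ->
  is_derive x (delta_mx 0 j) (@enorm R n) (x 0 j / enorm x).
Proof.
move=> x0; have e0 : 0 < enorm x by rewrite enorm_gt0.
have q0 : 0 < \sum_k x 0 k ^+ 2 by rewrite -enorm_sqr exprn_gt0.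
apply: (is_derive_eq (is_derive_comp1 (is_derive_sqnorm x j)
  (is_derive1_sqrt q0))).
by rewrite -/(enorm x); field; rewrite gt_eqF.
Qed.

Lemma is_derive_unitv n (x : 'rV[R]_n) j k : x != 0 ->
  is_derive x (delta_mx 0 j) (fun y => unitv y 0 k)
    (((k == j)%:R - unitv x 0 k * unitv x 0 j) / enorm x).
Proof.
move=> x0; have e0 : enorm x != 0 by rewrite enorm_eq0.
rewrite (_ : (fun y => _) = (fun y => (enorm y)^-1 * y 0 k)); last first.
  by apply/funext => y; rewrite mxE.
apply: (is_derive_eq (is_derive_mul
   (is_derive_inv e0 (is_derive_enorm j x0)) (is_derive_coord x _ k))).
by rewrite delta_rV !mxE; field.
Qed.

Lemma unitv_continuous n (x : 'rV[R]_n) : x != 0 ->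
  {for x, continuous (@unitv n)}.
Proof.
move=> x0; apply: (@cvg_rV _ _ (nbhs x)) => k; rewrite mxE.
under eq_fun do rewrite mxE.
apply: cvgM; last exact: coord_continuous_rV.
by apply: cvgV; [rewrite enorm_eq0|exact: enorm_continuous].
Qed.

Lemma scale_unitv_continuous n (r : R) (x : 'rV[R]_n) : x != 0 ->
  {for x, continuous (fun y : 'rV[R]_n => r *: unitv y)}.
Proof. by move=> x0; exact: (continuousZl_tmp (unitv_continuous x0)). Qed.

End euclidean.

(** * Integrals over shells and rotation fields *)

Section shell_integrals.
Context {R : realType}.
Local Notation T := (measurableTypeR R).
Implicit Types n : nat.

Let near_left_dist (x y z : R) : 0 < z -> x - z < y -> y < x -> `|x - y| <= z.
Proof. by move=> *; rewrite ler_norml; lra. Qed.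

Let dist_double (x y z w : R) :
  `|x - z| <= w -> `|y - z| <= w -> `|y - x| <= w * 2.
Proof. by rewrite !ler_norml; lra. Qed.

(** Tuples carry the product sigma-algebra while continuity refers to the topology of row vectors.
    The link is that an open set is a countable union of cubes with rational centres, which are
    measurable. *)
Lemma measurable_continuous_vec n (f : 'rV[R]_n -> R) : continuous f ->
  measurable_fun [set: n.-tuple T] (fun t => f (vec_of_tuple t)).
Proof.
move=> /continuousP cf; apply: (measurability _ (RGenOpens.measurableE R)).
move=> _ [_ [a [b ->] <-]]; rewrite setTI.
have oO : open (f @^-1` `]a, b[%classic) by apply: cf; exact: interval_open.
move: oO; set O := f @^-1` _ => oO.
pose B (q : {ffun 'I_n -> rat} * nat) : set (n.-tuple T) :=
  cube (fun i => ratr (q.1 i)) q.2.+1%:R^-1.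
pose P (q : {ffun 'I_n -> rat} * nat) := B q `<=` [set t | O (vec_of_tuple t)].
rewrite (_ : _ @^-1` _ = \bigcup_q (if `[< P q >] then B q else set0)); last first.
  apply/seteqP; split => [t /= tO|t [q _]]; last first.
    by case: asboolP => // Pq Bq; exact: Pq.
  have [e e0 He] := open_sball oO tO.
  have [k ke] : exists k, k.+1%:R^-1 < e / 2 :> R.
    have [k _ /(_ _ (leqnn k))] := near_infty_natSinv_lt (PosNum (divr_gt0 e0 (ltr0n _ 2))).
    by exists k.
  have k0 : 0 < k.+1%:R^-1 :> R by rewrite invr_gt0.
  have /choice[q qP] : forall i : 'I_n, exists q : rat,
      `|tnth t i - ratr q| <= k.+1%:R^-1.
    move=> i; have /rat_in_itvoo[q] : tnth t i - k.+1%:R^-1 < tnth t i.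
      by rewrite ltrBlDr ltrDl invr_gt0.
    rewrite in_itv/= => /andP[q1 q2]; exists q.
    exact: (near_left_dist k0 q1 q2).
  exists ([ffun i => q i], k) => //.
  have Bt : B ([ffun i => q i], k) t by move=> i; rewrite /= ffunE.
  case: asboolP => // nP; exfalso; apply: nP => s Bs; apply: He.
  (* [t] and [s] lie in the same cube, so their distance is at most twice its radius; hence the
     choice of a radius below e / 2. *)
  apply: le_lt_trans (_ : k.+1%:R^-1 * 2 < e); last by rewrite -ltr_pdivlMr.
  apply: normr_rV_le => [|i]; first by rewrite mulr_ge0.
  rewrite !mxE; have := Bs i; have := Bt i; rewrite /= ffunE.
  exact: dist_double.
apply: countable_bigcupT_measurable; first exact: countableP.
move=> q; case: asboolP => // _; exact: measurable_cube.
Qed.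

Lemma compact_fun_bounded n (A : set 'rV[R]_n) (f : 'rV[R]_n -> R) :
  compact A -> (forall x, A x -> {for x, continuous f}) ->
  exists C, forall x, A x -> `|f x| <= C.
Proof.
move=> cA cf.
have cfA : {within A, continuous f}.
  by apply: continuous_in_subspaceT => x; rewrite inE; exact: cf.
have := compact_bounded (continuous_compact cfA cA).
move=> [M [_ HM]]; exists (M + 1) => x Ax.
by apply: (HM (M + 1)); [rewrite ltrDl|exists x].
Qed.

Lemma closed_annulus_compact n (a b : R) :
  compact [set x : 'rV[R]_n | a <= enorm x <= b].
Proof.
apply: bounded_closed_compact.
  exists b; split; first exact: num_real.
  move=> x bx y /= /andP[_ yb]; apply: le_trans (normr_le_enorm _) _.
  exact: le_trans yb (ltW bx).
rewrite (_ : [set x | _] = @enorm R n @^-1` `[a, b]%classic); last first.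
  by apply/seteqP; split => x /=; rewrite in_itv.
apply: closed_comp; last exact: interval_closed.
by move=> x _; exact: enorm_continuous.
Qed.

(** The support avoids a neighbourhood of the origin, where x/|x| is singular, and lies in
    [unit_cube]. *)
Definition shell_weight n (phi : 'rV[R]_n -> R) : Prop :=
  continuous phi /\ forall x, phi x != 0 -> 1/4 < enorm x < 1/2.

Lemma shell_weight_near0 n (phi : 'rV[R]_n -> R) : shell_weight phi ->
  \forall x \near (0 : 'rV[R]_n), phi x = 0.
Proof.
move=> [_ H].
have : \forall x \near (0 : 'rV[R]_n), enorm x < 1/4.
  have := @enorm_continuous R n 0; rewrite /continuous_at enorm0.
  by move/cvgr_lt; apply; lra.
by apply: filterS => x x4; apply/eqP/negPn/negP => /H; lra.
Qed.

Lemma shell_weight0 n (phi : 'rV[R]_n -> R) : shell_weight phi -> phi 0 = 0.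
Proof. by move/shell_weight_near0/nbhs_singleton. Qed.

(** [K] may be singular at 0: the product is locally zero there. *)
Lemma shell_weight_continuousM n (phi K : 'rV[R]_n -> R) : shell_weight phi ->
  (forall x, x != 0 -> {for x, continuous K}) ->
  continuous (fun x => phi x * K x).
Proof.
move=> sw cK x; have [->|x0] := eqVneq x 0; last first.
  by apply: continuousM; [exact: sw.1|exact: cK].
rewrite /continuous_at (shell_weight0 sw) mul0r.
apply: (@cvg_near_eq _ _ (nbhs (0 : 'rV[R]_n)) _ (fun=> 0)); last exact: cvg_cst.
by apply: filterS (shell_weight_near0 sw) => y ->; rewrite mul0r.
Qed.

Lemma shell_weightM n (phi K : 'rV[R]_n -> R) : shell_weight phi ->
  (forall x, x != 0 -> {for x, continuous K}) ->
  shell_weight (fun x => phi x * K x).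
Proof.
move=> sw cK; split; first exact: shell_weight_continuousM.
by move=> x; rewrite mulf_eq0 negb_or => /andP[/sw.2].
Qed.

Lemma shell_weight_bounded n (phi : 'rV[R]_n -> R) : shell_weight phi ->
  exists C, forall x, `|phi x| <= C.
Proof.
move=> sw; have [C HC] := compact_fun_bounded (@closed_annulus_compact n 0 1)
  (fun x _ => sw.1 x).
exists C => x; have [->|/sw.2 x0] := eqVneq (phi x) 0.
  rewrite normr0; apply: le_trans (HC 0 _) => //=.
  by rewrite enorm0 lexx ler01.
by apply: HC => /=; lra.
Qed.

Lemma shell_weight_cube n (phi : 'rV[R]_n -> R) (t : n.-tuple T) :
  shell_weight phi -> ~ @unit_cube R n t -> phi (vec_of_tuple t) = 0.
Proof.
move=> sw; apply: contra_notP => /eqP/sw.2/andP[_ t1] i.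
rewrite subr0; have := normr_coord_enorm (vec_of_tuple t) i.
by rewrite mxE => /le_trans; apply; lra.
Qed.

Lemma measurable_shell n (phi : 'rV[R]_n -> R) : shell_weight phi ->
  measurable_fun [set: n.-tuple T] (fun t => phi (vec_of_tuple t)).
Proof. by move=> sw; apply: measurable_continuous_vec; exact: sw.1. Qed.

Lemma shell_integrable n (phi : 'rV[R]_n -> R) : shell_weight phi ->
  (lebesgue_tuple n).-integrable setT
    (EFin \o (fun t => phi (vec_of_tuple t))).
Proof.
move=> sw; have [C HC] := shell_weight_bounded sw.
apply: (@unit_cube_integrable _ _ _ C).
- exact: measurable_shell.
- by move=> t; exact: HC.
- by move=> t; exact: shell_weight_cube.
Qed.

Definition shell_int n (phi : 'rV[R]_n -> R) : R :=
  \int[lebesgue_tuple n]_t phi (vec_of_tuple t).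

Lemma shell_intD n (phi psi : 'rV[R]_n -> R) :
  shell_weight phi -> shell_weight psi ->
  shell_int (fun x => phi x + psi x) = shell_int phi + shell_int psi.
Proof. by move=> H1 H2; apply: RintegralD => //; exact: shell_integrable. Qed.

Lemma shell_intB n (phi psi : 'rV[R]_n -> R) :
  shell_weight phi -> shell_weight psi ->
  shell_int (fun x => phi x - psi x) = shell_int phi - shell_int psi.
Proof. by move=> H1 H2; apply: RintegralB => //; exact: shell_integrable. Qed.

Lemma shell_intZ n (phi : 'rV[R]_n -> R) c :
  shell_weight phi -> shell_int (fun x => c * phi x) = c * shell_int phi.
Proof. by move=> H1; apply: RintegralZl => //; exact: shell_integrable. Qed.

Lemma shell_weightD n (phi psi : 'rV[R]_n -> R) :
  shell_weight phi -> shell_weight psi ->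
  shell_weight (fun x => phi x + psi x).
Proof.
move=> [c1 H1] [c2 H2]; split.
  by move=> x; apply: continuousD; [exact: c1|exact: c2].
move=> x; have [->|/H1//] := eqVneq (phi x) 0.
by rewrite add0r => /H2.
Qed.

Lemma shell_weightZ n (phi : 'rV[R]_n -> R) c :
  shell_weight phi -> shell_weight (fun x => c * phi x).
Proof.
move=> [c1 H1]; split.
  by move=> x; apply: continuousM; [exact: cst_continuous|exact: c1].
by move=> x; rewrite mulf_eq0 negb_or => /andP[_ /H1].
Qed.

Lemma shell_weightB n (phi psi : 'rV[R]_n -> R) :
  shell_weight phi -> shell_weight psi ->
  shell_weight (fun x => phi x - psi x).
Proof.
move=> H1 H2; under eq_fun do rewrite -mulN1r.
by apply: shell_weightD => //; exact: shell_weightZ.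
Qed.

Lemma shell_weight_cst0 n : shell_weight (fun _ : 'rV[R]_n => 0).
Proof. by split; [exact: cst_continuous|move=> x; rewrite eqxx]. Qed.

Lemma shell_weight_sum n (I : Type) (s : seq I) (phi : I -> 'rV[R]_n -> R) :
  (forall i, shell_weight (phi i)) ->
  shell_weight (fun x => \sum_(i <- s) phi i x).
Proof.
move=> H; elim: s => [|i s IH].
  by under eq_fun do rewrite big_nil; exact: shell_weight_cst0.
under eq_fun do rewrite big_cons; exact: shell_weightD.
Qed.

Lemma shell_int_sum n (I : Type) (s : seq I) (phi : I -> 'rV[R]_n -> R) :
  (forall i, shell_weight (phi i)) ->
  shell_int (fun x => \sum_(i <- s) phi i x) = \sum_(i <- s) shell_int (phi i).
Proof.
move=> H; elim: s => [|i s IH].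
  rewrite big_nil (_ : (fun x => _) = (fun x => 0 * (0 : R))).
    by rewrite (shell_intZ 0 (shell_weight_cst0 n)) mul0r.
  by apply/funext => x; rewrite big_nil mul0r.
rewrite big_cons -IH -shell_intD//; last exact: shell_weight_sum.
by congr shell_int; apply/funext => x; rewrite big_cons.
Qed.

Lemma is_derive_shell_weightM n (phi dphi K dK : 'rV[R]_n -> R) x v :
  shell_weight phi -> shell_weight dphi ->
  is_derive x v phi (dphi x) -> (x != 0 -> is_derive x v K (dK x)) ->
  is_derive x v (fun y => phi y * K y) (dphi x * K x + phi x * dK x).
Proof.
move=> sw dsw Dphi DK; have [x0|/DK{}DK] := eqVneq x 0; last exact: is_derive_mul.
subst x; rewrite (shell_weight0 sw) (shell_weight0 dsw) !mul0r addr0.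
apply: (near_eq_is_derive _ (is_derive_cst 0 0 v)).
by apply: filterS (shell_weight_near0 sw) => y ->; rewrite mul0r.
Qed.

(** Integration by parts: the integrand is the j-th partial derivative of [phi K], which is C^1 and
    compactly supported even if [K] is singular at 0. *)
Lemma shell_int_partial n (j : 'I_n) (phi dphi K dK : 'rV[R]_n -> R) :
  shell_weight phi -> shell_weight dphi ->
  (forall x, is_derive x (delta_mx 0 j) phi (dphi x)) ->
  (forall x, x != 0 -> is_derive x (delta_mx 0 j) K (dK x)) ->
  (forall x, x != 0 -> {for x, continuous K}) ->
  (forall x, x != 0 -> {for x, continuous dK}) ->
  shell_int (fun x => dphi x * K x + phi x * dK x) = 0.
Proof.
move=> sw dsw Dphi DK cK cdK.
have swK := shell_weightM sw cK.
have swD : shell_weight (fun x => dphi x * K x + phi x * dK x).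
  by apply: shell_weightD; exact: shell_weightM.
have [C HC] := shell_weight_bounded swD.
(* Changing one entry of a tuple moves along an affine line, based at the point whose j-th
   coordinate is 0. *)
have line (t : n.-tuple T) s : vec_of_tuple (tset t j s) =
    (vec_of_tuple t - tnth t j *: delta_mx 0 j) + s *: delta_mx 0 j.
  apply/rowP => i; rewrite !mxE tnth_mktuple eqxx/=.
  by case: (eqVneq i j) => [->|_] /=; rewrite ?mulr1 ?mulr0; lra.
rewrite /shell_int /Rintegral.
suff -> : (\int[lebesgue_tuple n]_t (dphi (vec_of_tuple t) * K (vec_of_tuple t) +
    phi (vec_of_tuple t) * dK (vec_of_tuple t))%:E = 0)%E by [].
apply: (integral_partial0 (j := j) (C := C)
  (G := fun t => phi (vec_of_tuple t) * K (vec_of_tuple t))).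
- exact: (measurable_shell swD).
- by move=> t; exact: HC.
- by move=> t; exact: (shell_weight_cube swD).
- by move=> t; exact: (shell_weight_cube swK).
- move=> t s; under eq_fun do rewrite line.
  rewrite line; apply/(is_derive_line (fun x => phi x * K x)).
  exact: is_derive_shell_weightM.
- move=> t s; under eq_fun do rewrite line.
  set g := fun s : R => vec_of_tuple t - tnth t j *: delta_mx 0 j + s *: delta_mx 0 j.
  have cg : {for s, continuous g}.
    by apply: cvgD; [exact: cvg_cst|apply: cvgZr_tmp; exact: cvg_id].
  exact: (continuous_comp cg (swD.1 (g s))).
Qed.

End shell_integrals.

(** * A radial C^1 cutoff *)

Section radial_bump.
Context {R : realType}.

(** Squaring makes the positive part C^1: at 0 the difference quotient is bounded by [|h|]. *)
Lemma is_derive_sqr_pos_part (y : R) :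
  is_derive y 1 (fun z => Num.max 0 z ^+ 2) (2 * Num.max 0 y).
Proof.
have [y0|y0|y0] := ltgtP y 0.
- rewrite mulr0.
  apply: (near_eq_is_derive _ (is_derive_const (0 : R) y (1 : R))).
  near=> z; rewrite max_l ?expr0n//; apply/ltW; near: z; exact: lt_nbhsl.
- have D := is_derive_pow 2 (is_derive_id y (1 : R)).
  rewrite expr1 mulr1 in D.
  apply: (near_eq_is_derive _ D).
  near=> z; rewrite max_r//; apply/ltW; near: z; exact: lt_nbhsr.
rewrite y0 mulr0.
have H : h^-1 *: (Num.max 0 (h *: (1 : R) + 0) ^+ 2 - Num.max 0 (0 : R) ^+ 2)
    @[h --> (0 : R)^'] --> (0 : R).
  apply/cvgr0Pnorm_le => e e0; near=> h.
  have h0 : h != 0 by near: h; exact: nbhs_dnbhs_neq.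
  have he : `|h| <= e by near: h; exact: dnbhs0_le.
  rewrite maxxx expr0n subr0 addr0 [h *: 1]mulr1 [_ *: _]/(h^-1 * _).
  apply: le_trans he; rewrite normrM normfV ler_pdivrMl ?normr_gt0//.
  rewrite -expr2 ger0_norm ?sqr_ge0// -[leRHS]ger0_norm ?sqr_ge0//.
  rewrite normrX normr_id ler_pXn2r ?nnegrE ?le_max ?lexx//.
  by rewrite ge_max normr_ge0 ler_norm.
apply: DeriveDef; first by apply/cvg_ex; exists 0.
exact/cvg_lim.
Unshelve. all: by end_near. Qed.

(* C1, and positive exactly for 1/4 < |x| < 1/2: weighting by [bump] turns
   integrals over the unit sphere into volume integrals. *)
Definition bump n (x : 'rV[R]_n) : R :=
  Num.max 0 ((\sum_k x 0 k ^+ 2 - 1/16) * (1/4 - \sum_k x 0 k ^+ 2)) ^+ 2.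

(** The common factor of the gradient of [bump], which is [dbump x] times the vector x. *)
Definition dbump n (x : 'rV[R]_n) : R :=
  Num.max 0 ((\sum_k x 0 k ^+ 2 - 1/16) * (1/4 - \sum_k x 0 k ^+ 2)) *
  (4 * (5/16 - 2 * \sum_k x 0 k ^+ 2)).

Lemma is_derive_bump n (x : 'rV[R]_n) j :
  is_derive x (delta_mx 0 j) (@bump n) (x 0 j * dbump x).
Proof.
have Dq := is_derive_sqnorm x j.
have Dp := is_derive_mul
  (is_derive_sub Dq (is_derive_const (1/16) x (delta_mx 0 j)))
  (is_derive_sub (is_derive_const (1/4) x (delta_mx 0 j)) Dq).
apply: (is_derive_eq (is_derive_comp1
  (g := fun z => Num.max 0 z ^+ 2) Dp (is_derive_sqr_pos_part _))).
rewrite /dbump /=; set q := \sum_k _; set m := Num.max _ _.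
by field.
Qed.

Lemma sqnorm_continuous n : continuous (fun x : 'rV[R]_n => \sum_k x 0 k ^+ 2).
Proof.
move=> x; rewrite (_ : (fun y : 'rV_n => _) = (fun y => enorm y * enorm y)).
  by apply: continuousM; exact: enorm_continuous.
by apply/funext => y; rewrite -enorm_sqr expr2.
Qed.

Lemma bump_gt0 n (x : 'rV[R]_n) :
  ((\sum_k x 0 k ^+ 2 - 1/16) * (1/4 - \sum_k x 0 k ^+ 2) > 0) ->
  1/4 < enorm x < 1/2.
Proof.
rewrite -enorm_sqr => H; have e0 := enorm_ge0 x.
have h1 : 1/16 < enorm x ^+ 2.
  by rewrite ltNge; apply/negP => h; nra.
have h2 : enorm x ^+ 2 < 1/4.
  by rewrite ltNge; apply/negP => h; nra.
apply/andP; split; rewrite ltNge; apply/negP => h; nra.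
Qed.

Let max0_neq0 (z : R) : Num.max 0 z != 0 -> 0 < z.
Proof. by have [] := ltP 0 z => //; rewrite eqxx. Qed.

Let arg_continuous n : continuous (fun x : 'rV[R]_n => Num.max 0
  ((\sum_k x 0 k ^+ 2 - 1/16) * (1/4 - \sum_k x 0 k ^+ 2))).
Proof.
move=> x.
have c2 : {for x, continuous (fun x : 'rV[R]_n =>
    (\sum_k x 0 k ^+ 2 - 1/16) * (1/4 - \sum_k x 0 k ^+ 2))}.
  by apply: continuousM; apply: continuousB;
    [exact: sqnorm_continuous|exact: cst_continuous|exact: cst_continuous|
     exact: sqnorm_continuous].
exact: (@continuous_max R _ (fun=> 0) _ x (@cst_continuous _ _ 0 x) c2).
Qed.

Lemma shell_weight_bump n : shell_weight (@bump n).
Proof.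
split; last by move=> x; rewrite /bump expf_eq0/= => /max0_neq0/bump_gt0.
move=> x; exact: (continuousM (@arg_continuous n x) (@arg_continuous n x)).
Qed.

Lemma shell_weight_dbump n : shell_weight (@dbump n).
Proof.
split; last first.
  by move=> x; rewrite /dbump mulf_eq0 negb_or => /andP[/max0_neq0/bump_gt0].
have c : continuous (fun x : 'rV[R]_n => 4 * (5/16 - 2 * \sum_k x 0 k ^+ 2)).
  move=> x; have c1 : {for x, continuous (fun x : 'rV[R]_n =>
      2 * \sum_k x 0 k ^+ 2)}.
    exact: (continuousM (@cst_continuous _ _ (2 : R) x) (@sqnorm_continuous n x)).
  have c3 := continuousB (@cst_continuous _ _ (5/16 : R) x) c1.
  exact: (continuousM (@cst_continuous _ _ (4 : R) x) c3).
by move=> x; exact: (continuousM (@arg_continuous n x) (c x)).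
Qed.

Lemma bump_ge0 n (x : 'rV[R]_n) : 0 <= bump x.
Proof. exact: sqr_ge0. Qed.

End radial_bump.

(** * Rotation and Euler fields under spherical integrals *)

Section sphere_calculus.
Context {R : realType}.
Local Notation T := (measurableTypeR R).
Implicit Types n : nat.

(** Generator of the rotations of the (i, j)-plane, a field tangent to the spheres centred at 0. *)
Definition rot n (i j : 'I_n) (F : 'rV[R]_n -> R) (y : 'rV[R]_n) : R :=
  y 0 i * partial j F y - y 0 j * partial i F y.

(** The radial derivative r d/dr. *)
Definition euler n (F : 'rV[R]_n -> R) (y : 'rV[R]_n) : R :=
  \sum_k y 0 k * partial k F y.

Lemma unitv_coord_continuous n (x : 'rV[R]_n) k : x != 0 ->
  {for x, continuous (fun y : 'rV[R]_n => unitv y 0 k)}.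
Proof.
move=> x0; exact: (continuous_comp (unitv_continuous x0)
  (@coord_continuous_rV R n k (unitv x))).
Qed.

Lemma annulus_comp_continuous n (a b r : R) (F : 'rV[R]_n -> R) (x : 'rV[R]_n) :
  0 <= a -> a < r < b -> (forall y, annulus a b y -> {for y, continuous F}) ->
  x != 0 -> {for x, continuous (fun x => F (r *: unitv x))}.
Proof.
move=> a0 arb cF x0.
exact: (continuous_comp (scale_unitv_continuous (r := r) x0)
  (cF _ (annulus_scale_unitv a0 arb x0))).
Qed.

Lemma is_derive_annulus_comp n (a b r : R) (F : 'rV[R]_n -> R) (x : 'rV[R]_n) j :
  0 <= a -> a < r < b -> C1_on (annulus a b) F -> x != 0 ->
  is_derive x (delta_mx 0 j) (fun x => F (r *: unitv x))
    (\sum_k partial k F (r *: unitv x) *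
      (r * (((k == j)%:R - unitv x 0 k * unitv x 0 j) / enorm x))).
Proof.
move=> a0 arb CF x0.
apply: (C1_on_is_derive_comp (@open_annulus R n a b) CF).
  exact: annulus_scale_unitv.
move=> k; under eq_fun do rewrite mxE.
by apply: is_derive_cmul; exact: is_derive_unitv.
Qed.

(** With G(x) = F(r x/|x|), the field x_i d_j - x_j d_i applied to G gives [rot i j F] at r x/|x|;
    it also annihilates the radial function [bump], so integration by parts leaves nothing. *)
Lemma shell_int_rot n (a b r : R) (F : 'rV[R]_n -> R) (i j : 'I_n) : i != j ->
  0 <= a -> a < r < b -> C1_on (annulus a b) F ->
  shell_int (fun x => bump x * rot i j F (r *: unitv x)) = 0.
Proof.
move=> ij a0 arb CF.
pose G (x : 'rV[R]_n) := F (r *: unitv x).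
pose dG j x := \sum_k partial k F (r *: unitv x) *
      (r * (((k == j)%:R - unitv x 0 k * unitv x 0 j) / enorm x)).
have cG x : x != 0 -> {for x, continuous G}.
  move=> x0; apply: (annulus_comp_continuous a0 arb _ x0) => y.
  exact: C1_on_continuous (@open_annulus R n a b) CF.
have cdG l x : x != 0 -> {for x, continuous (dG l)}.
  move=> x0; apply: continuous_bigsum => k; apply: continuousM.
    by apply: (annulus_comp_continuous a0 arb _ x0) => y /CF /(_ k)[].
  apply: continuousM; first exact: cst_continuous.
  apply: continuousM; last first.
    by apply: continuousV; [rewrite enorm_eq0|exact: enorm_continuous].
  apply: continuousB; first exact: cst_continuous.
  by apply: continuousM; exact: unitv_coord_continuous.
(* [W i j] is the j-th partial derivative of bump x_i G when i and j differ, so its integral is 0.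
   In [W i j - W j i] the [dbump] terms cancel. *)
pose W (i j : 'I_n) (x : 'rV[R]_n) := (x 0 j * dbump x) * (x 0 i * G x) +
    bump x * (x 0 i * dG j x).
have swd k : shell_weight (fun x : 'rV[R]_n => x 0 k * dbump x).
  under eq_fun do rewrite mulrC.
  by apply: shell_weightM => // [|x _]; [exact: shell_weight_dbump|exact: coord_continuous_rV].
have cKG k x : x != 0 -> {for x, continuous (fun x : 'rV[R]_n => x 0 k * G x)}.
  by move=> x0; apply: continuousM; [exact: coord_continuous_rV|exact: cG].
have cKdG k l x : x != 0 -> {for x, continuous (fun x : 'rV[R]_n => x 0 k * dG l x)}.
  by move=> x0; apply: continuousM; [exact: coord_continuous_rV|exact: cdG].
have W0 k l : k != l -> shell_int (W k l) = 0.
  move=> kl; apply: (shell_int_partial (j := l)).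
  - exact: shell_weight_bump.
  - exact: swd.
  - by move=> x; exact: is_derive_bump.
  - move=> x x0; apply: (is_derive_eq (is_derive_mul
      (is_derive_coord x (delta_mx 0 l) k) (is_derive_annulus_comp l a0 arb CF x0))).
    by rewrite delta_rV (negbTE kl) mul0r add0r.
  - by move=> x x0; exact: cKG.
  - by move=> x x0; exact: cKdG.
have swW k l : shell_weight (W k l).
  by apply: shell_weightD; apply: shell_weightM => //; [exact: cKG|exact: shell_weight_bump|exact: cKdG].
rewrite -[RHS](subrr 0) -{1}(W0 i j ij) -(W0 j i); last by rewrite eq_sym.
rewrite -shell_intB//; congr shell_int; apply/funext => x.
have [->|x0] := eqVneq x 0.
  rewrite /W (shell_weight0 (shell_weight_bump n)).
  rewrite (shell_weight0 (shell_weight_dbump n)).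
  by ring.
have -> : W i j x - W j i x = bump x * (x 0 i * dG j x - x 0 j * dG i x).
  by rewrite /W; ring.
congr (_ * _); rewrite /dG !mulr_sumr -sumrB /rot.
rewrite -(sum_deltal (fun k => (r *: unitv x) 0 i * partial k F (r *: unitv x)) j).
rewrite -(sum_deltal (fun k => (r *: unitv x) 0 j * partial k F (r *: unitv x)) i).
rewrite -sumrB; apply: eq_bigr => k _.
have e0 : enorm x != 0 by rewrite enorm_eq0.
by rewrite !mxE; field.
Qed.

(** Differentiation under the integral sign: the derivative of F(r v) in r is [euler F] at r v,
    divided by r, for a unit vector v. *)
Lemma is_derive_shell_int n (phi F : 'rV[R]_n -> R) (a b r : R) :
  shell_weight phi -> 0 <= a -> a < r < b -> C1_on (annulus a b) F ->
  is_derive r 1 (fun r => shell_int (fun x => phi x * F (r *: unitv x)))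
    (r^-1 * shell_int (fun x => phi x * euler F (r *: unitv x))).
Proof.
move=> sw a0 /andP[ar rb] CF.
(* The closed annulus between [u] and [v] is compact inside the open one, so the partial derivatives
   are bounded on it; this gives the dominating function. *)
pose u := (a + r) / 2; pose v := (r + b) / 2.
have uv : [/\ a < u, u < r, r < v & v < b] by rewrite /u /v; split; lra.
have [au ur rv vb] := uv.
have cF y : annulus a b y -> {for y, continuous F}.
  exact: C1_on_continuous (@open_annulus R n a b) CF.
pose f (s : R) (t : n.-tuple T) :=
  phi (vec_of_tuple t) * F (s *: unitv (vec_of_tuple t)).
have sab s : s \in `]u, v[ -> a < s < b.
  by rewrite in_itv/=; lra.
have Dfx s (x : 'rV[R]_n) : a < s < b ->
    is_derive s 1 (fun s => phi x * F (s *: unitv x))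
     (phi x * \sum_k partial k F (s *: unitv x) * unitv x 0 k).
  move=> asb; have [->|x0] := eqVneq x 0.
    rewrite (shell_weight0 sw) mul0r.
    by under eq_fun do rewrite mul0r; exact: is_derive_const.
  apply: is_derive_cmul.
  apply: (C1_on_is_derive_comp (@open_annulus R n a b) CF).
    exact: annulus_scale_unitv.
  move=> k; under eq_fun do rewrite mxE.
  apply: (is_derive_eq (is_derive_mul (is_derive_id s (1 : R)) (is_derive_const _ s 1))).
  by rewrite mul1r mulr0 addr0.
have [C [C0 HC]] : exists C, 0 <= C /\ forall y : 'rV[R]_n,
    u <= enorm y <= v -> \sum_k `|partial k F y| <= C.
  have cS (y : 'rV[R]_n) : u <= enorm y <= v ->
      {for y, continuous (fun y => \sum_k `|partial k F y|)}.
    move=> uyv; apply: continuous_bigsum => k.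
    have yab : annulus a b y by rewrite /annulus/=; lra.
    exact: (continuous_comp (CF _ yab k).2 (@norm_continuous _ _ _)).
  have [C HC] := compact_fun_bounded (@closed_annulus_compact R n u v) cS.
  exists `|C|; split => // y /HC/le_trans/(_ (ler_norm C)).
  by apply: le_trans; exact: ler_norm.
have swN : shell_weight (fun x => C * `|phi x|).
  apply: shell_weightZ; split.
    by move=> x; exact: (continuous_comp (sw.1 x) (@norm_continuous _ _ _)).
  by move=> x; rewrite normr_eq0 => /sw.2.
have swf s : a < s < b -> shell_weight (fun x => phi x * F (s *: unitv x)).
  move=> asb; apply: shell_weightM => // x x0.
  exact: (annulus_comp_continuous a0 asb cF x0).
have ruv : `]u, v[%classic r by rewrite /= in_itv/=; lra.
have derf s t : `]u, v[%classic s -> [set: n.-tuple T] t -> derivable (f ^~ t) s 1.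
  by move=> /sab/(Dfx _ (vec_of_tuple t))[].
have G_ub s t : `]u, v[%classic s -> [set: n.-tuple T] t ->
    `|partial1of2 f s t| <= C * `|phi (vec_of_tuple t)|.
  move=> suv _; rewrite partial1of2E.
  rewrite (@derive_val _ _ _ _ _ _ _ (Dfx _ (vec_of_tuple t) (sab _ suv))).
  have [->|x0] := eqVneq (vec_of_tuple t) 0.
    by rewrite (shell_weight0 sw) mul0r normr0 mulr0.
  rewrite normrM mulrC ler_wpM2r//.
  apply: le_trans (HC (s *: unitv (vec_of_tuple t)) _); last first.
    rewrite enormZ enorm_unitv// mulr1.
    by move: suv; rewrite /= in_itv/= => suv; rewrite ger0_norm; lra.
  apply: le_trans (ler_norm_sum _ _ _) _; apply: ler_sum => k _.
  rewrite normrM ler_piMr// (le_trans (normr_coord_enorm _ _))//.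
  by rewrite enorm_unitv.
have key := @cvg_differentiation_under_integral R _ _ (lebesgue_tuple n) f setT
  measurableT r u v ruv (fun s suv => shell_integrable (swf s (sab s suv))) derf
  (fun t => C * `|phi (vec_of_tuple t)|) (fun t => mulr_ge0 C0 (normr_ge0 _))
  (shell_integrable swN) G_ub.
have E : \int[lebesgue_tuple n]_(y in [set: n.-tuple T]) partial1of2 f r y =
    r^-1 * shell_int (fun x => phi x * euler F (r *: unitv x)).
  have r0 : r != 0 by rewrite gt_eqF//; lra.
  rewrite -shell_intZ; last first.
    apply: shell_weightM => // x x0.
    apply: (annulus_comp_continuous a0 (a := a) (b := b) _ _ x0); first by lra.
    move=> y aby; apply: continuous_bigsum => k; apply: continuousM.
      exact: coord_continuous_rV.
    exact: (CF _ aby k).2.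
  apply: eq_Rintegral => t _; rewrite partial1of2E.
  rewrite (@derive_val _ _ _ _ _ _ _ (Dfx _ (vec_of_tuple t) (sab _ ruv))).
  rewrite mulrCA; congr (_ * _); rewrite mulr_sumr; apply: eq_bigr => k _.
  by rewrite [in RHS]mxE; field.
rewrite E in key.
pose S s := shell_int (fun x => phi x * F (s *: unitv x)).
have key' : h^-1 *: (S (h *: (1 : R) + r) - S r) @[h --> (0 : R)^'] -->
    r^-1 * shell_int (fun x => phi x * euler F (r *: unitv x)).
  by under eq_fun do rewrite [_ *: 1]mulr1; exact: key.
apply: DeriveDef; last exact/cvg_lim.
by apply/cvg_ex; eexists; exact: key'.
Qed.
End sphere_calculus.

(** * Algebra of C^1 functions; the Laplacian through rotations *)

Section C1_rules.
Context {R : realType}.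
Variables (n : nat) (U : set 'rV[R]_n).
Hypothesis oU : open U.
Implicit Types F G : 'rV[R]_n -> R.

Lemma partial_val F x i d : is_derive x (delta_mx 0 i) F d -> partial i F x = d.
Proof. by move=> [_ <-]. Qed.

#[local] Opaque partial.

Lemma C1_on_derive F x i : C1_on U F -> U x ->
  is_derive x (delta_mx 0 i) F (partial i F x).
Proof. by move=> CF Ux; apply: derivableP; exact: (CF x Ux i).1. Qed.

Lemma near_in_open x : U x -> \forall y \near x, U y.
Proof. by move=> Ux; apply: open_nbhs_nbhs; split. Qed.

Lemma C1_onI F (dF : 'I_n -> 'rV[R]_n -> R) :
  (forall x, U x -> forall i, is_derive x (delta_mx 0 i) F (dF i x)) ->
  (forall x, U x -> forall i, {for x, continuous (dF i)}) ->
  C1_on U F.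
Proof.
move=> DF cdF x Ux i; split; first by have [] := DF x Ux i.
suff : partial i F y @[y --> x] --> dF i x by rewrite -(partial_val (DF x Ux i)).
apply: (@cvg_near_eq _ _ (nbhs x) _ (dF i)); last exact: cdF.
by apply: filterS (near_in_open Ux) => y Uy; rewrite (partial_val (DF y Uy i)).
Qed.

Lemma partialM F G x i : C1_on U F -> C1_on U G -> U x ->
  partial i (fun y => F y * G y) x = partial i F x * G x + F x * partial i G x.
Proof.
move=> CF CG Ux; apply: partial_val.
by apply: is_derive_mul; exact: C1_on_derive.
Qed.

Lemma partialB F G x i : C1_on U F -> C1_on U G -> U x ->
  partial i (fun y => F y - G y) x = partial i F x - partial i G x.
Proof.
move=> CF CG Ux; apply: partial_val.
by apply: is_derive_sub; exact: C1_on_derive.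
Qed.

Lemma C1_onM F G : C1_on U F -> C1_on U G -> C1_on U (fun y => F y * G y).
Proof.
move=> CF CG; apply: (C1_onI (dF := fun i x => partial i F x * G x + F x * partial i G x)).
  by move=> x Ux i; apply: is_derive_mul; exact: C1_on_derive.
move=> x Ux i.
have cF := C1_on_continuous oU CF Ux; have cG := C1_on_continuous oU CG Ux.
exact: (continuousD (continuousM (CF x Ux i).2 cG) (continuousM cF (CG x Ux i).2)).
Qed.

Lemma C1_onD F G : C1_on U F -> C1_on U G -> C1_on U (fun y => F y + G y).
Proof.
move=> CF CG; apply: (C1_onI (dF := fun i x => partial i F x + partial i G x)).
  by move=> x Ux i; apply: is_derive_add; exact: C1_on_derive.
by move=> x Ux i; exact: (continuousD (CF x Ux i).2 (CG x Ux i).2).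
Qed.

Lemma C1_onB F G : C1_on U F -> C1_on U G -> C1_on U (fun y => F y - G y).
Proof.
move=> CF CG; apply: (C1_onI (dF := fun i x => partial i F x - partial i G x)).
  by move=> x Ux i; apply: is_derive_sub; exact: C1_on_derive.
by move=> x Ux i; exact: (continuousB (CF x Ux i).2 (CG x Ux i).2).
Qed.

Lemma C1_on_const c : C1_on U (fun=> c).
Proof.
apply: (C1_onI (dF := fun i x => 0)).
by move=> x Ux i; exact: cst_continuous.
Qed.

Lemma C1_on_coord k : C1_on U (fun y => y 0 k).
Proof.
apply: (C1_onI (dF := fun i x => (delta_mx 0 i : 'rV_n) 0 k)).
  by move=> x Ux i; exact: is_derive_coord.
by move=> x Ux i; exact: cst_continuous.
Qed.

Lemma C1_on_sum m (F : 'I_m -> 'rV[R]_n -> R) :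
  (forall i, C1_on U (F i)) -> C1_on U (fun y => \sum_i F i y).
Proof.
move=> CF; apply: (C1_onI (dF := fun i x => \sum_l partial i (F l) x)).
  by move=> x Ux i; apply: is_derive_bigsum => l; exact: C1_on_derive.
by move=> x Ux i; apply: continuous_bigsum => l; exact: (CF l x Ux i).2.
Qed.

Lemma C1_on_pow F k : C1_on U F -> C1_on U (fun y => F y ^+ k).
Proof.
move=> CF; elim: k => [|k IH]; first by under eq_fun do rewrite expr0; exact: C1_on_const.
by under eq_fun do rewrite exprS; exact: C1_onM.
Qed.

Lemma C1_on_dot w : C1_on U (dot w).
Proof.
apply: C1_on_sum => k; apply: C1_onM; [exact: C1_on_const|exact: C1_on_coord].
Qed.

Lemma C1_on_euler F : C2_on U F -> C1_on U (euler F).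
Proof.
move=> [_ CF]; apply: C1_on_sum => k.
by apply: C1_onM; [exact: C1_on_coord|exact: CF].
Qed.

Lemma C1_on_rot i j F : C2_on U F -> C1_on U (rot i j F).
Proof.
move=> [_ CF].
exact: (C1_onB (C1_onM (C1_on_coord i) (CF j)) (C1_onM (C1_on_coord j) (CF i))).
Qed.

Lemma rotM i j F G x : C1_on U F -> C1_on U G -> U x ->
  rot i j (fun y => F y * G y) x = rot i j F x * G x + F x * rot i j G x.
Proof. by move=> CF CG Ux; rewrite /rot !partialM//; ring. Qed.

Lemma rotB i j F G x : C1_on U F -> C1_on U G -> U x ->
  rot i j (fun y => F y - G y) x = rot i j F x - rot i j G x.
Proof. by move=> CF CG Ux; rewrite /rot !partialB//; ring. Qed.

Lemma partial_coord k i x : partial i (fun y : 'rV[R]_n => y 0 k) x = (k == i)%:R.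
Proof. by rewrite (partial_val (is_derive_coord x _ k)) delta_rV. Qed.

Lemma euler_continuous F x : C1_on U F -> U x -> {for x, continuous (euler F)}.
Proof.
move=> CF Ux; apply: continuous_bigsum => k.
by apply: continuousM; [exact: coord_continuous_rV|exact: (CF x Ux k).2].
Qed.

Lemma euler2E F x : C2_on U F -> U x ->
  euler (euler F) x = euler F x +
    \sum_i \sum_j x 0 i * x 0 j * partial j (partial i F) x.
Proof.
move=> [_ CF] Ux; rewrite exchange_big -big_split/=; apply: eq_bigr => j _.
have E : partial j (euler F) x =
    partial j F x + \sum_i x 0 i * partial j (partial i F) x.
  apply: partial_val.
  apply: (is_derive_eq (is_derive_bigsum (fun i => is_derive_mul
    (is_derive_coord x (delta_mx 0 j) i) (C1_on_derive j (CF i) Ux)))).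
  rewrite big_split/=; congr (_ + _).
  by under eq_bigr do rewrite delta_rV; rewrite sum_deltal.
rewrite E mulrDr mulr_sumr; congr (_ + _); apply: eq_bigr => i _.
by rewrite mulrCA mulrA.
Qed.

(** The two orders of the mixed derivative are kept apart; in [sum_rot2] each of them sums to
    [euler (euler F) - euler F]. *)
Lemma rot2E i j F x : C2_on U F -> U x ->
  rot i j (rot i j F) x =
    x 0 i ^+ 2 * partial j (partial j F) x + x 0 j ^+ 2 * partial i (partial i F) x
    - x 0 i * x 0 j * partial j (partial i F) x
    - x 0 j * x 0 i * partial i (partial j F) x
    - (i != j)%:R * (x 0 i * partial i F x + x 0 j * partial j F x).
Proof.
move=> [_ CF] Ux; rewrite {1}/rot.
have CC k l := C1_onM (C1_on_coord k) (CF l).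
rewrite !(partialB _ (CC i j) (CC j i))//.
have E k l m : partial k (fun y => y 0 l * partial m F y) x =
    (l == k)%:R * partial m F x + x 0 l * partial k (partial m F) x.
  by rewrite (partialM k (C1_on_coord l) (CF m) Ux) partial_coord.
rewrite (E j i j) (E j j i) (E i i j) (E i j i) !eqxx [j == i]eq_sym.
case: (eqVneq i j) => [<-|ij] /=.
  by move: (partial i _ x) (partial i F x) (x 0 i) => A B C; ring.
move: (partial i (partial i F) x) (partial j (partial j F) x)
  (partial i (partial j F) x) (partial j (partial i F) x)
  (partial i F x) (partial j F x) (x 0 i) (x 0 j) => A B C D I J X Y; ring.
Qed.

(** Each [a i] occurs in 2 (n - 1) ordered pairs of distinct indices. *)
Lemma sum_offdiag (a : 'I_n -> R) :
  \sum_i \sum_j (i != j)%:R * (a i + a j) = 2 * (n%:R - 1) * \sum_i a i.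
Proof.
have E i : \sum_j (i != j)%:R * (a i + a j) =
    (n%:R - 2) * a i + \sum_j a j.
  transitivity (\sum_j ((a i + a j) - (j == i)%:R * (a i + a j))).
    apply: eq_bigr => j _; rewrite eq_sym.
    by case: (eqVneq j i) => _ /=; ring.
  rewrite sumrB sum_deltal big_split/= sumr_const card_ord -mulr_natl; ring.
under eq_bigr do rewrite E.
by rewrite big_split/= -mulr_sumr sumr_const card_ord -mulr_natl; ring.
Qed.

Definition lap F (x : 'rV[R]_n) : R := \sum_i partial i (partial i F) x.

(** The decomposition |x|^2 Lap = E^2 + (n-2) E + Lap_S with E the Euler field and Lap_S the
    Laplacian of the spheres. Summing over ordered pairs counts every rotation twice, hence the
    factor 2. *)
Lemma sum_rot2 F x : C2_on U F -> U x ->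
  \sum_i \sum_j rot i j (rot i j F) x =
    2 * (enorm x ^+ 2 * lap F x - euler (euler F) x - (n%:R - 2) * euler F x).
Proof.
move=> CF Ux; under eq_bigr do under eq_bigr do rewrite (rot2E _ _ CF Ux).
under eq_bigr do rewrite !big_split/=.
rewrite !big_split/=.
have E1 : \sum_i \sum_j x 0 i ^+ 2 * partial j (partial j F) x =
    enorm x ^+ 2 * lap F x.
  rewrite enorm_sqr mulr_suml; apply: eq_bigr => i _.
  by rewrite mulr_sumr.
have E2 : \sum_i \sum_j x 0 j ^+ 2 * partial i (partial i F) x =
    enorm x ^+ 2 * lap F x by rewrite exchange_big E1.
have E3 : \sum_i \sum_j - (x 0 i * x 0 j * partial j (partial i F) x) =
    - (euler (euler F) x - euler F x).
  rewrite (euler2E CF Ux) addrAC subrr add0r -sumrN.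
  by apply: eq_bigr => i _; rewrite sumrN.
have E4 : \sum_i \sum_j - (x 0 j * x 0 i * partial i (partial j F) x) =
    - (euler (euler F) x - euler F x) by rewrite exchange_big E3.
have E5 : \sum_i \sum_j - ((i != j)%:R * (x 0 i * partial i F x + x 0 j * partial j F x))
    = - (2 * (n%:R - 1) * euler F x).
  rewrite -(sum_offdiag (fun i => x 0 i * partial i F x)) -sumrN.
  by apply: eq_bigr => i _; rewrite sumrN.
apply: (etrans (congr2 +%R (congr2 +%R (congr2 +%R (congr2 +%R E1 E2) E3) E4) E5)).
by move: (lap F x) (euler (euler F) x) (euler F x) => L E E'; ring.
Qed.

End C1_rules.

(** * Moments against zonal weights *)

Section zonal.
Context {R : realType} (n : nat) (w : 'rV[R]_n).
Implicit Types (i j : 'I_n) (y : 'rV[R]_n).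

Lemma is_derive_dot y i : is_derive y (delta_mx 0 i) (dot w) (w 0 i).
Proof.
apply: (is_derive_eq (is_derive_bigsum (fun k => is_derive_cmul (w 0 k)
  (is_derive_coord y (delta_mx 0 i) k)))).
by under eq_bigr do rewrite delta_rV mulrC; rewrite sum_deltal.
Qed.

Lemma rot_zonal k i j : rot i j (fun y => dot w y ^+ k) =
  fun y => k%:R * (dot w y ^+ k.-1 * (y 0 i * w 0 j - y 0 j * w 0 i)).
Proof.
apply/funext => y; rewrite /rot.
have E l : partial l (fun y => dot w y ^+ k) y = k%:R * dot w y ^+ k.-1 * w 0 l.
  exact: (partial_val (is_derive_pow k (is_derive_dot y l))).
by rewrite !E; ring.
Qed.

Lemma rot2_zonal k i j y : rot i j (rot i j (fun y => dot w y ^+ k)) y =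
  k%:R * (k.-1%:R * dot w y ^+ k.-2 * (y 0 i * w 0 j - y 0 j * w 0 i) ^+ 2 -
    (i != j)%:R * dot w y ^+ k.-1 * (y 0 i * w 0 i + y 0 j * w 0 j)).
Proof.
rewrite rot_zonal {1}/rot.
have E l : partial l (fun y => k%:R * (dot w y ^+ k.-1 *
      (y 0 i * w 0 j - y 0 j * w 0 i))) y =
    k%:R * (k.-1%:R * dot w y ^+ k.-2 * w 0 l * (y 0 i * w 0 j - y 0 j * w 0 i) +
      dot w y ^+ k.-1 * ((i == l)%:R * w 0 j - (j == l)%:R * w 0 i)).
  apply: partial_val.
  apply: (is_derive_eq (is_derive_cmul k%:R (is_derive_mul
    (is_derive_pow k.-1 (is_derive_dot y l))
    (is_derive_sub
      (is_derive_mul (is_derive_coord y _ i) (is_derive_const (w 0 j) y _))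
      (is_derive_mul (is_derive_coord y _ j) (is_derive_const (w 0 i) y _)))))).
  by rewrite !delta_rV !mulr0 !addr0.
rewrite !E !eqxx [j == i]eq_sym.
move: (dot w y ^+ k.-2) (dot w y ^+ k.-1) => A B.
by case: (eqVneq i j) => [<-|_] /=; ring.
Qed.

(** On a sphere the result only involves the zonal polynomials of orders k and k - 2, which makes
    the induction on moments possible. For k < 2 the factor [k * k.-1] vanishes, so the truncated
    [k.-2] is harmless. *)
Lemma sum_rot2_zonal k y : enorm w = 1 ->
  \sum_i \sum_j rot i j (rot i j (fun y => dot w y ^+ k)) y =
  2 * (k%:R * k.-1%:R * dot w y ^+ k.-2 * (enorm y ^+ 2 - dot w y ^+ 2) -
    (n%:R - 1) * (k%:R * dot w y ^+ k)).
Proof.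
move=> w1; under eq_bigr do under eq_bigr do rewrite rot2_zonal.
set A := dot w y ^+ k.-2; set B := dot w y ^+ k.-1.
transitivity (\sum_i \sum_j (k%:R * k.-1%:R * A *
    (y 0 i ^+ 2 * w 0 j ^+ 2 + y 0 j ^+ 2 * w 0 i ^+ 2
     - 2 * (w 0 i * y 0 i) * (w 0 j * y 0 j))) -
  \sum_i \sum_j (k%:R * B * ((i != j)%:R * (w 0 i * y 0 i + w 0 j * y 0 j)))).
  rewrite -sumrB; apply: eq_bigr => i _; rewrite -sumrB; apply: eq_bigr => j _.
  by ring.
have -> : \sum_i \sum_j (k%:R * B * ((i != j)%:R * (w 0 i * y 0 i + w 0 j * y 0 j)))
    = k%:R * B * (2 * (n%:R - 1) * dot w y).
  under eq_bigr do rewrite -mulr_sumr.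
  by rewrite -mulr_sumr sum_offdiag.
have -> : \sum_i \sum_j (k%:R * k.-1%:R * A *
    (y 0 i ^+ 2 * w 0 j ^+ 2 + y 0 j ^+ 2 * w 0 i ^+ 2
     - 2 * (w 0 i * y 0 i) * (w 0 j * y 0 j))) =
    k%:R * k.-1%:R * A * (2 * (enorm y ^+ 2 - dot w y ^+ 2)).
  under eq_bigr do rewrite -mulr_sumr.
  rewrite -mulr_sumr; congr (_ * _).
  have E i : \sum_j (y 0 i ^+ 2 * w 0 j ^+ 2 + y 0 j ^+ 2 * w 0 i ^+ 2 -
      2 * (w 0 i * y 0 i) * (w 0 j * y 0 j)) =
      y 0 i ^+ 2 + enorm y ^+ 2 * w 0 i ^+ 2 - 2 * dot w y * (w 0 i * y 0 i).
    rewrite sumrB big_split/= -!mulr_sumr -mulr_suml -!enorm_sqr w1 -/(dot w y).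
    by ring.
  under eq_bigr do rewrite E.
  by rewrite sumrB big_split/= -!mulr_sumr -!enorm_sqr w1 -/(dot w y); ring.
rewrite (_ : k%:R * dot w y ^+ k = k%:R * B * dot w y); first by ring.
by rewrite /B; case: k {A B} => [|k]; rewrite ?mul0r// exprSr mulrA.
Qed.

End zonal.

Section moments.
Context {R : realType} (n : nat).

Definition zweight (w : 'rV[R]_n) (k : nat) (x : 'rV[R]_n) : R :=
  bump x * dot w (unitv x) ^+ k.

(* Up to a constant factor, the integral of (w . x/|x|)^k F over the sphere of
   radius r. *)
Definition moment (w : 'rV[R]_n) (k : nat) (F : 'rV[R]_n -> R) (r : R) : R :=
  shell_int (fun x => zweight w k x * F (r *: unitv x)).

Lemma continuous_pow (V : topologicalType) (F : V -> R) (x : V) k :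
  {for x, continuous F} -> {for x, continuous (fun y => F y ^+ k)}.
Proof.
move=> cF; elim: k => [|k IH].
  rewrite (_ : (fun y => _) = fun=> 1); first exact: cst_continuous.
  by apply/funext => y; rewrite expr0.
rewrite (_ : (fun y => _) = (fun y => F y * F y ^+ k)); first exact: continuousM.
by apply/funext => y; rewrite exprS.
Qed.

Lemma dot_unitv_continuous (w x : 'rV[R]_n) : x != 0 ->
  {for x, continuous (fun x => dot w (unitv x))}.
Proof.
move=> x0; apply: continuous_bigsum => k.
by apply: continuousM; [exact: cst_continuous|exact: unitv_coord_continuous].
Qed.

Lemma shell_weight_zweight w k : shell_weight (zweight w k).
Proof.
apply: shell_weightM; first exact: shell_weight_bump.
move=> x x0; apply: continuous_pow; exact: dot_unitv_continuous.
Qed.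

(** Here t stands for w . x/|x|, so that r t is w . y at y = r x/|x|. Modulo the Helmholtz equation,
    the integrand of the radial equation is a multiple of P Lap_S f - f Lap_S P, with P the zonal
    polynomial; its integral is 0 by [int_sumG]. *)
Let moment_algebra (r Lam L EE E F t B : R) k : 0 < r ->
  (1 - r ^+ 2) / 4 * ((1 - r ^+ 2) * L + 2 * (n%:R - 2) * E) = - Lam * F ->
  (Lam * r ^+ 2 - (1 - r ^+ 2) ^+ 2 / 4 * (k%:R * (k%:R + n%:R - 2))) * (B * t ^+ k * F) +
  ((1 - r ^+ 2) ^+ 2 / 4 * (n%:R - 2) + (1 - r ^+ 2) * r ^+ 2 * (n%:R - 2) / 2) *
    (B * t ^+ k * E) +
  (1 - r ^+ 2) ^+ 2 / 4 * (B * t ^+ k * EE) +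
  (1 - r ^+ 2) ^+ 2 / 4 * (k%:R * k.-1%:R) * (B * t ^+ k.-2 * F) =
  - ((1 - r ^+ 2) ^+ 2 / 4) / (2 * r ^+ k) *
  (B * ((r * t) ^+ k * (2 * (r ^+ 2 * L - EE - (n%:R - 2) * E)) -
    F * (2 * (k%:R * k.-1%:R * (r * t) ^+ k.-2 * (r ^+ 2 - (r * t) ^+ 2) -
    (n%:R - 1) * (k%:R * (r * t) ^+ k))))).
Proof.
move=> r0 pde; have rk : r ^+ k != 0 by rewrite expf_neq0// gt_eqF.
have H1 : k%:R * k.-1%:R = k%:R * (k%:R - 1) :> R.
  by case: k {rk} => [|k]; rewrite ?mul0r//= -addn1 natrD addrK.
(* By homogeneity a factor r^k comes out; for k < 2 both sides are 0. *)
have H2 : k%:R * k.-1%:R * (r * t) ^+ k.-2 * (r ^+ 2 - (r * t) ^+ 2) =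
    r ^+ k * (k%:R * (k%:R - 1) * (t ^+ k.-2 - t ^+ k)).
  rewrite H1; case: k {rk H1} => [|[|k]] /=.
  - by rewrite !mul0r mulr0.
  - by rewrite subrr mulr0 !mul0r mulr0.
  - by rewrite !exprMn !exprS expr0; ring.
rewrite H2 H1 exprMn.
move: (r ^+ k) rk (t ^+ k) (t ^+ k.-2) (k%:R : R) (n%:R : R) pde
  => rho rho0 T T2 K N pde.
apply/eqP; rewrite -subr_eq0; apply/eqP.
(* The difference of the two sides is a multiple of the residual of the equation. *)
transitivity (B * T * r ^+ 2 * ((1 - r ^+ 2) / 4 *
   ((1 - r ^+ 2) * L + 2 * (N - 2) * E) + Lam * F)); first by field.
by rewrite pde; ring.
Qed.

Let moment_regroup (q g L k c N M2 M1 M0 M' : R) :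
  q * (M2 + N * M1 + k * M' - c * M0) + g * N / 2 * M1 + L * M0 =
  (L - q * c) * M0 + (q * N + g * N / 2) * M1 + q * M2 + q * k * M'.
Proof. by ring. Qed.

Section helmholtz.
Variables (a b Lam : R) (f : 'rV[R]_n -> R) (w : 'rV[R]_n).
Hypotheses (a0 : 0 <= a) (b1 : b <= 1) (w1 : enorm w = 1).
Let U : set 'rV[R]_n := annulus a b.
Hypothesis Cf : C2_on U f.
Hypothesis Hf : forall x, U x -> hlaplacian f x = - Lam * f x.

Let oU : open U := @open_annulus R n a b.

Lemma shell_weight_comp (phi F : 'rV[R]_n -> R) r : shell_weight phi ->
  a < r < b -> (forall y, U y -> {for y, continuous F}) ->
  shell_weight (fun x => phi x * F (r *: unitv x)).
Proof.
move=> sw arb cF; apply: shell_weightM => // x x0.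
exact: (annulus_comp_continuous a0 arb cF x0).
Qed.

Lemma shell_weight_moment k F r : a < r < b -> (forall y, U y -> {for y, continuous F}) ->
  shell_weight (fun x => zweight w k x * F (r *: unitv x)).
Proof. by apply: shell_weight_comp; exact: shell_weight_zweight. Qed.

Lemma is_derive_moment k F r : a < r < b -> C1_on U F ->
  is_derive r 1 (moment w k F) (r^-1 * moment w k (euler F) r).
Proof.
by move=> arb CF; apply: is_derive_shell_int arb CF => //; exact: shell_weight_zweight.
Qed.

Let P k (y : 'rV[R]_n) := dot w y ^+ k.

Let CP k : C1_on U (P k).
Proof. by apply: C1_on_pow => //; exact: C1_on_dot. Qed.

Let CrP k i j : C1_on U (rot i j (P k)).
Proof.
rewrite rot_zonal.
exact: (C1_onM oU (C1_on_const oU _) (C1_onM oU (@CP k.-1) (C1_onB oU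
  (C1_onM oU (C1_on_coord oU i) (C1_on_const oU (w 0 j)))
  (C1_onM oU (C1_on_coord oU j) (C1_on_const oU (w 0 i)))))).
Qed.

Let rot_continuous F i j y : C1_on U F -> U y -> {for y, continuous (rot i j F)}.
Proof.
move=> CF Uy; exact: (continuousB
  (continuousM (@coord_continuous_rV R n i y) (CF y Uy j).2)
  (continuousM (@coord_continuous_rV R n j y) (CF y Uy i).2)).
Qed.

Let Crf i j : C1_on U (rot i j f) := C1_on_rot oU i j Cf.

Let cf y : U y -> {for y, continuous f}.
Proof. exact: C1_on_continuous oU Cf.1. Qed.

Let G k i j y := P k y * rot i j (rot i j f) y - f y * rot i j (rot i j (P k)) y.

Let cG k i j y : U y -> {for y, continuous (G k i j)}.
Proof.
move=> Uy; exact: (continuousB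
  (continuousM (C1_on_continuous oU (@CP k) Uy) (@rot_continuous _ i j _ (@Crf i j) Uy))
  (continuousM (cf Uy) (@rot_continuous _ i j _ (@CrP k i j) Uy))).
Qed.

Let leibniz_cancel (p p1 p2 q q1 q2 : R) :
  p * q2 - q * p2 = p1 * q1 + p * q2 - (q1 * p1 + q * p2).
Proof. by ring. Qed.

(* Integrating the rotation field over spheres moves it from [f] to the
   zonal polynomial. *)
Let int_G k i j r : a < r < b ->
  shell_int (fun x => bump x * G k i j (r *: unitv x)) = 0.
Proof.
move=> arb; have [<-|ij] := eqVneq i j.
  have r0 F : rot i i F = fun=> 0 by apply/funext => y; rewrite /rot subrr.
  rewrite (_ : (fun x => _) = (fun x => 0 * (0 : R))).
    by rewrite (shell_intZ 0 (shell_weight_cst0 n)) mul0r.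
  by apply/funext => x; rewrite /G !r0; ring.
(* By the product rule [G] is the rotation derivative of P rot f - f rot P: Green's identity on the
   sphere. *)
have CH := C1_onB oU (C1_onM oU (@CP k) (@Crf i j)) (C1_onM oU Cf.1 (@CrP k i j)).
rewrite -(shell_int_rot ij a0 arb CH); congr shell_int; apply/funext => x.
have [->|x0] := eqVneq x 0.
  by rewrite (shell_weight0 (shell_weight_bump n)) !mul0r.
have Uy : U (r *: unitv x) by exact: annulus_scale_unitv.
congr (_ * _); rewrite (rotB i j (C1_onM oU (@CP k) (@Crf i j)) (C1_onM oU Cf.1 (@CrP k i j)) Uy).
rewrite (rotM i j (@CP k) (@Crf i j) Uy) (rotM i j Cf.1 (@CrP k i j) Uy).
exact: leibniz_cancel.
Qed.

Let S1 y := \sum_i \sum_j rot i j (rot i j f) y.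
Let S2 k y := \sum_i \sum_j rot i j (rot i j (P k)) y.

Let int_sumG k r : a < r < b -> shell_int (fun x => bump x *
   (P k (r *: unitv x) * S1 (r *: unitv x) -
    f (r *: unitv x) * S2 k (r *: unitv x))) = 0.
Proof.
move=> arb.
have sw i j : shell_weight (fun x => bump x * G k i j (r *: unitv x)).
  by apply: shell_weight_comp => //; [exact: shell_weight_bump|exact: cG].
transitivity (\sum_i \sum_j shell_int (fun x => bump x * G k i j (r *: unitv x))).
  rewrite -(eq_bigr _ (fun i _ => shell_int_sum _ (sw i))).
  rewrite -shell_int_sum; last by move=> i; apply: shell_weight_sum => j; exact: sw.
  congr shell_int; apply/funext => x.
  transitivity (bump x * \sum_i \sum_j G k i j (r *: unitv x)).
    congr (bump x * _); rewrite /S1 /S2 !mulr_sumr -sumrB; apply: eq_bigr => i _.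
    by rewrite !mulr_sumr -sumrB.
  by rewrite mulr_sumr; apply: eq_bigr => i _; rewrite mulr_sumr.
by rewrite big1// => i _; rewrite big1// => j _; exact: int_G.
Qed.

#[local] Opaque rot.

(** Green's identity replaces the angular part of the Laplacian of f by that of the zonal
    polynomial. [k (k + n - 2)] is the eigenvalue of the sphere in degree k, and the moment of order
    k - 2 appears because (w . y)^k is not harmonic. *)
Lemma moment_ode k r : a < r < b ->
  (1 - r ^+ 2) ^+ 2 / 4 * (moment w k (euler (euler f)) r +
      (n%:R - 2) * moment w k (euler f) r +
      k%:R * k.-1%:R * moment w k.-2 f r -
      k%:R * (k%:R + n%:R - 2) * moment w k f r) +
    (1 - r ^+ 2) * r ^+ 2 * (n%:R - 2) / 2 * moment w k (euler f) r +
    Lam * r ^+ 2 * moment w k f r = 0.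
Proof.
move=> arb; have r0 : 0 < r by move: arb => /andP[/(le_lt_trans a0)].
have CE : C1_on U (euler f) := C1_on_euler oU Cf.
have cE y : U y -> {for y, continuous (euler f)} := C1_on_continuous oU CE.
have cEE y : U y -> {for y, continuous (euler (euler f))} := euler_continuous CE.
have sm0 := shell_weight_moment k arb cf.
have sm1 := shell_weight_moment k arb cE.
have sm2 := shell_weight_moment k arb cEE.
have sm3 := shell_weight_moment k.-2 arb cf.
set q := (1 - r ^+ 2) ^+ 2 / 4.
set c0 := Lam * r ^+ 2 - q * (k%:R * (k%:R + n%:R - 2)).
set c1 := q * (n%:R - 2) + (1 - r ^+ 2) * r ^+ 2 * (n%:R - 2) / 2.
set c3 := q * (k%:R * k.-1%:R).
transitivity (c0 * moment w k f r + c1 * moment w k (euler f) r +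
    q * moment w k (euler (euler f)) r + c3 * moment w k.-2 f r).
  exact: moment_regroup.
rewrite /moment -!shell_intZ// -!shell_intD//;
  try by (do ?apply: shell_weightD; exact: shell_weightZ).
have I0 := int_sumG k arb.
have sw0 : shell_weight (fun x => bump x *
   (P k (r *: unitv x) * S1 (r *: unitv x) -
    f (r *: unitv x) * S2 k (r *: unitv x))).
  apply: (@shell_weight_comp _ (fun y => P k y * S1 y - f y * S2 k y)) => //.
    exact: shell_weight_bump.
  move=> y Uy; apply: (continuousB (continuousM (C1_on_continuous oU (@CP k) Uy) _)
    (continuousM (cf Uy) _)).
    by do 2!apply: continuous_bigsum => ?; exact: rot_continuous (@Crf _ _) Uy.
  by do 2!apply: continuous_bigsum => ?; exact: rot_continuous (@CrP _ _ _) Uy.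
(* The 2 undoes the double count of rotations and r^k the homogeneity of the zonal polynomial. *)
rewrite -(mulr0 (- q / (2 * r ^+ k))) -I0 -shell_intZ//.
congr shell_int; apply/funext => x.
have [->|x0] := eqVneq x 0.
  by rewrite /zweight (shell_weight0 (shell_weight_bump n)) !(mul0r, mulr0, addr0).
have Uy : U (r *: unitv x) by exact: annulus_scale_unitv.
have E1 : S1 (r *: unitv x) = _ := sum_rot2 oU Cf Uy.
have E2 : S2 k (r *: unitv x) = _ := @sum_rot2_zonal R n w k (r *: unitv x) w1.
rewrite {}E1 {}E2 /P.
have ey : enorm (r *: unitv x) = r.
  by rewrite enormZ enorm_unitv// mulr1 ger0_norm// ltW.
have := Hf Uy; rewrite /hlaplacian -/(lap f _) -/(euler f _) ey.
rewrite dotZr /zweight.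
move: (lap f _) (euler (euler f) _) (euler f _) (f _) (dot w _) (bump x)
  => L EE E F t B pde.
exact: moment_algebra.
Qed.

End helmholtz.
End moments.

(** * The radial equation *)

Section hyperbolic_functions.
Context {R : realType}.
Implicit Types x y t : R.

Definition sinh t : R := (expR t - expR (- t)) / 2.
Definition cosh t : R := (expR t + expR (- t)) / 2.

Lemma is_derive_expRN t : is_derive t 1 (fun t => expR (- t)) (- expR (- t)).
Proof.
have D := is_derive_opp (is_derive_id t (1 : R)).
apply: (is_derive_eq (is_derive_comp1 (g := @expR R) D (is_derive_expR (- t)))).
by rewrite mulrN1.
Qed.

Lemma is_derive_sinh t : is_derive t 1 sinh (cosh t).
Proof.
apply: (is_derive_eq (is_derive_mul (is_derive_sub (is_derive_expR t)
  (is_derive_expRN t)) (is_derive_const 2^-1 t 1))).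
by rewrite mulr0 addr0 opprK.
Qed.

Lemma is_derive_cosh t : is_derive t 1 cosh (sinh t).
Proof.
apply: (is_derive_eq (is_derive_mul (is_derive_add (is_derive_expR t)
  (is_derive_expRN t)) (is_derive_const 2^-1 t 1))).
by rewrite mulr0 addr0.
Qed.

Lemma cosh2 t : cosh t ^+ 2 = 1 + sinh t ^+ 2.
Proof.
rewrite /cosh /sinh expRN; have := expR_gt0 t; move: (expR t) => e e0.
by field; rewrite gt_eqF.
Qed.

Lemma cosh_ge1 t : 1 <= cosh t.
Proof.
rewrite /cosh expRN; have := expR_gt0 t; move: (expR t) => e e0.
rewrite -subr_ge0 (_ : _ - _ = (e - 1) ^+ 2 / (2 * e)).
  by rewrite divr_ge0 ?sqr_ge0// mulr_ge0// ltW.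
by field; rewrite gt_eqF.
Qed.

Lemma sinh_ge t : 0 <= t -> t / 2 <= sinh t.
Proof.
move=> t0; have := expR_ge1Dx t.
have : expR (- t) <= 1 by rewrite -expR0 ler_expR; lra.
by rewrite /sinh; lra.
Qed.

Lemma sinh_gt0 t : 0 < t -> 0 < sinh t.
Proof. by move=> t0; apply: lt_le_trans (sinh_ge (ltW t0)); lra. Qed.

Lemma tanh_half t : tanh (t / 2) = sinh t / (1 + cosh t).
Proof.
rewrite /tanh /sinh /cosh [in RHS](_ : t = t / 2 + t / 2); last by field.
rewrite opprD !expRD !expRN.
have := expR_gt0 (t / 2); move: (expR _) => e e0.
have e2 : 0 < e ^+ 2 by rewrite exprn_gt0.
by field; rewrite ?gt_eqF//=; nra.
Qed.

Lemma tanh_half_gt0 t : 0 < t -> 0 < tanh (t / 2).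
Proof.
by move=> t0; rewrite tanh_half divr_gt0 ?sinh_gt0//; have := cosh_ge1 t; lra.
Qed.

Lemma onem_tanh_half2 t : 1 - tanh (t / 2) ^+ 2 = 2 / (1 + cosh t).
Proof.
have c1 := cosh_ge1 t; have := cosh2 t; rewrite tanh_half.
move: (cosh t) (sinh t) c1 => c s c1 E.
have -> : 1 - (s / (1 + c)) ^+ 2 = ((1 + c) ^+ 2 - s ^+ 2) / (1 + c) ^+ 2.
  by field; rewrite gt_eqF//; lra.
have -> : s ^+ 2 = c ^+ 2 - 1 by lra.
by field; rewrite gt_eqF//; lra.
Qed.

Lemma tanh_half_lt1 t : 0 < t -> tanh (t / 2) < 1.
Proof.
move=> t0; have := tanh_half_gt0 t0; have := onem_tanh_half2 t.
have : 0 < 2 / (1 + cosh t) by rewrite divr_gt0//; have := cosh_ge1 t; lra.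
by move: (tanh _) => r; nra.
Qed.

(** So r d/dr becomes sinh t d/dt in the hyperbolic radius t. *)
Lemma is_derive_tanh_half t : 0 < t ->
  is_derive t 1 (fun t => tanh (t / 2)) (tanh (t / 2) / sinh t).
Proof.
move=> t0; have s0 := sinh_gt0 t0; have c1 := cosh_ge1 t; have cs := cosh2 t.
rewrite (_ : (fun t => _) = (fun t => sinh t * (1 + cosh t)^-1)); last first.
  by apply/funext => x; rewrite tanh_half.
have cn : 1 + cosh t != 0 by rewrite gt_eqF//; lra.
have D1 : is_derive t 1 (fun t => 1 + cosh t) (sinh t).
  apply: (is_derive_eq (is_derive_add (is_derive_const 1 t 1) (is_derive_cosh t))).
  by rewrite add0r.
have D2 := is_derive_inv (f := fun t => 1 + cosh t) cn D1.
apply: (is_derive_eq (is_derive_mul (is_derive_sinh t) D2)).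
rewrite tanh_half; move: (cosh t) (sinh t) s0 c1 cn cs => c s s0 c1 cn cs.
transitivity ((c * (1 + c) - s ^+ 2) / (1 + c) ^+ 2); first by field.
have -> : s ^+ 2 = c ^+ 2 - 1 by lra.
by field; rewrite cn gt_eqF.
Qed.

Lemma nondecreasing_of_derive (G dG : R -> R) x y : x <= y ->
  (forall t, x <= t <= y -> is_derive t 1 G (dG t)) ->
  (forall t, x <= t <= y -> 0 <= dG t) -> G x <= G y.
Proof.
move=> xy DG dG0.
have [||c /itvP cxy E] := @MVT_segment _ G dG x y xy.
- by move=> t txy; apply: DG; rewrite !(itvP txy).
- apply: derivable_within_continuous => t txy.
  by have [] := DG t; rewrite ?(itvP txy).
- by rewrite -subr_ge0 E mulr_ge0 ?subr_ge0// dG0// !cxy.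
Qed.

End hyperbolic_functions.

Section radial_ode.
Context {R : realType}.
Variables (a mu lam : R) (J : set R) (M M1 M2 : R -> R).
Hypothesis mu0 : 0 < mu.
Hypothesis J0 : forall t, J t -> 0 < t.
Hypothesis J_itv : forall x y t, J x -> J y -> x <= t <= y -> J t.
Hypothesis DM : forall t, J t -> is_derive t 1 M (M1 t / sinh t).
Hypothesis DM1 : forall t, J t -> is_derive t 1 M1 (M2 t / sinh t).
(** As [M1] = sinh M' and [M2] = sinh M1', division by sinh^2 gives M'' + 2 a coth M' + (a^2 + mu^2)
    M = lam M / sinh^2. *)
Hypothesis ode : forall t, J t ->
  M2 t + (2 * a - 1) * cosh t * M1 t + (a ^+ 2 + mu ^+ 2) * sinh t ^+ 2 * M t
  = lam * M t.

(* [p = sinh^a]; [w = p M] satisfies w'' = - mu^2 w + K w / sinh^2, [z] is w'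
   and [E] the energy, which varies by a bounded factor since 1 / sinh^2 is
   the derivative of - coth. *)
Let p t := expR (a * ln (sinh t)).
Let w t := p t * M t.
Let z t := p t * (M1 t + a * cosh t * M t) / sinh t.
Let K := a ^+ 2 - a + lam.
Let E t := z t ^+ 2 + mu ^+ 2 * w t ^+ 2.
Let C : R := `|K| / mu.

Let Dp t : J t -> is_derive t 1 p (p t * (a * cosh t / sinh t)).
Proof.
move=> Jt; have s0 := sinh_gt0 (J0 Jt).
have D1 := is_derive_comp1 (is_derive_sinh t) (is_derive1_ln s0).
have D2 := is_derive_cmul a D1.
apply: (is_derive_eq (is_derive_comp1 (g := @expR R) D2 (is_derive_expR _))).
by rewrite /p; field; rewrite gt_eqF.
Qed.

Let Dw t : J t -> is_derive t 1 w (z t).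
Proof.
move=> Jt; have s0 := sinh_gt0 (J0 Jt).
apply: (is_derive_eq (is_derive_mul (Dp Jt) (DM Jt))).
by rewrite /z; field; rewrite gt_eqF.
Qed.

Let dz t : R := - mu ^+ 2 * w t + K * w t / sinh t ^+ 2.

Let Dz t : J t -> is_derive t 1 z (dz t).
Proof.
move=> Jt; have s0 := sinh_gt0 (J0 Jt).
have sn : sinh t != 0 by rewrite gt_eqF.
have D1 := is_derive_add (DM1 Jt) (is_derive_mul (is_derive_cmul a (is_derive_cosh t)) (DM Jt)).
have D2 := is_derive_mul (is_derive_mul (Dp Jt) D1) (is_derive_inv sn (is_derive_sinh t)).
apply: (is_derive_eq D2); have := ode Jt; have := cosh2 t.
rewrite /dz /w /K; move: (p t) (sinh t) (cosh t) (M t) (M1 t) (M2 t) sn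
  => P s c m m1 m2 sn cs o.
have -> : m2 = lam * m - (2 * a - 1) * c * m1 - (a ^+ 2 + mu ^+ 2) * s ^+ 2 * m.
  by rewrite -o; ring.
apply/eqP; rewrite -subr_eq0; apply/eqP.
transitivity (P * m * (a ^+ 2 - a) / s ^+ 2 * (c ^+ 2 - (1 + s ^+ 2))); first by field.
by rewrite cs subrr mulr0.
Qed.

Let DE t : J t -> is_derive t 1 E (2 * K * z t * w t / sinh t ^+ 2).
Proof.
move=> Jt; have s0 := sinh_gt0 (J0 Jt).
apply: (is_derive_eq (is_derive_add (is_derive_pow 2 (Dz Jt))
  (is_derive_cmul (mu ^+ 2) (is_derive_pow 2 (Dw Jt))))).
by rewrite !expr1 /dz; field; rewrite gt_eqF.
Qed.

Let E_ge0 t : 0 <= E t.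
Proof. by rewrite addr_ge0 ?sqr_ge0// mulr_ge0 ?sqr_ge0. Qed.

Let C_ge0 : 0 <= C.
Proof. by rewrite divr_ge0// ltW. Qed.

(** 2 mu |z w| <= E, whence the constant [C] = |K| / mu. *)
Let dE_le t : J t -> `|2 * K * z t * w t / sinh t ^+ 2| <= C * E t / sinh t ^+ 2.
Proof.
move=> Jt; have s0 := sinh_gt0 (J0 Jt).
rewrite normrM [X in _ * X]ger0_norm ?invr_ge0 ?sqr_ge0//.
rewrite ler_wpM2r ?invr_ge0 ?sqr_ge0//.
have -> : `|2 * K * z t * w t| = `|K| * (2 * `|z t| * `|w t|).
  by rewrite !normrM ger0_norm//; ring.
rewrite /C -[leRHS]mulrA ler_wpM2l// [leRHS]mulrC ler_pdivlMr//.
rewrite /E -(real_normK (num_real (z t))) -(real_normK (num_real (w t))).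
have := sqr_ge0 (`|z t| - mu * `|w t|).
by lra.
Qed.

Let coth (t : R) : R := cosh t * (sinh t)^-1.

Let Dcoth t : J t -> is_derive t 1 coth (- (sinh t) ^- 2).
Proof.
move=> Jt; have s0 := sinh_gt0 (J0 Jt).
have sn : sinh t != 0 by rewrite gt_eqF.
apply: (is_derive_eq (is_derive_mul (is_derive_cosh t) (is_derive_inv sn (is_derive_sinh t)))).
have := cosh2 t; move: (sinh t) (cosh t) sn => s c sn cs.
transitivity ((s ^+ 2 - c ^+ 2) / s ^+ 2); first by field.
by rewrite cs; field.
Qed.

(** Integrating factor: the choice k = - C makes the product nondecreasing and k = C makes it
    nonincreasing. *)
Let DG (k : R) t : J t -> is_derive t 1 (fun t => E t * expR (k * coth t))
  ((2 * K * z t * w t / sinh t ^+ 2 - k * E t / sinh t ^+ 2) * expR (k * coth t)).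
Proof.
move=> Jt; have s0 := sinh_gt0 (J0 Jt).
apply: (is_derive_eq (is_derive_mul (DE Jt) (is_derive_comp1 (g := @expR R)
  (is_derive_cmul k (Dcoth Jt)) (is_derive_expR _)))).
by field; rewrite gt_eqF.
Qed.

Let energy_le x y : J x -> J y -> x <= y ->
  E x * expR (- C * coth x) <= E y * expR (- C * coth y).
Proof.
move=> Jx Jy xy; have Jt t : x <= t <= y -> J t by exact: J_itv.
apply: (nondecreasing_of_derive xy (fun t txy => DG (- C) (Jt t txy))) => t /Jt{}Jt.
rewrite mulr_ge0 ?expR_ge0//; have := dE_le Jt; rewrite ler_norml => /andP[+ _].
by rewrite mulNr mulNr opprK; lra.
Qed.

Let energy_ge x y : J x -> J y -> x <= y ->
  E y * expR (C * coth y) <= E x * expR (C * coth x).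
Proof.
move=> Jx Jy xy; have Jt t : x <= t <= y -> J t by exact: J_itv.
rewrite -lerN2.
apply: (nondecreasing_of_derive xy (fun t txy => is_derive_opp (DG C (Jt t txy)))) => t /Jt{}Jt.
rewrite oppr_ge0 mulr_le0_ge0 ?expR_ge0//; have := dE_le Jt; rewrite ler_norml => /andP[_ +].
by lra.
Qed.

Let energy0 t : J t -> E t = 0 -> M t = 0.
Proof.
move=> Jt; rewrite /E => E0.
have w0 : 0 <= mu ^+ 2 * w t ^+ 2 by rewrite mulr_ge0 ?sqr_ge0.
have /eqP : mu ^+ 2 * w t ^+ 2 = 0 by have := sqr_ge0 (z t); lra.
rewrite mulf_eq0 !expf_eq0/= gt_eqF//=.
by rewrite /w mulf_eq0 gt_eqF ?expR_gt0//= => /eqP.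
Qed.

Lemma radial_ode_cauchy x y : J x -> J y -> x <= y -> M x = 0 -> M1 x = 0 ->
  M y = 0.
Proof.
move=> Jx Jy xy Mx M1x; apply: energy0 => //.
have : E y * expR (C * coth y) <= 0.
  apply: le_trans (energy_ge Jx Jy xy) _.
  by rewrite /E /z /w Mx M1x !(mulr0, addr0, mul0r) expr0n/= mulr0 addr0 mul0r.
rewrite pmulr_lle0 ?expR_gt0// => Ey.
by apply/eqP; rewrite eq_le Ey E_ge0.
Qed.

(* As [w'' + mu^2 w = O(w)], the decay of [w] forces that of [w'], hence of the
   almost conserved energy [E]. *)
Lemma radial_ode_decay x : J x -> (forall y, x <= y -> J y) ->
  (expR (a * ln (sinh t)) * M t) @[t --> +oo] --> 0 -> M x = 0.
Proof.
move=> Jx Jy w0; apply: energy0 => //.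
(* [B e] will bound w': the 2 comes from a difference of two values of w, the rest from w'' on an
   interval of length at most 1. *)
pose B := 2 + mu ^+ 2 + `|K|.
have B0 : 0 < B by rewrite /B; have := sqr_ge0 mu; have := normr_ge0 K; lra.
have small e : 0 < e -> exists2 y, x <= y & E y <= e ^+ 2 * (B ^+ 2 + mu ^+ 2).
  move=> e0.
  have /cvgr0_norm_le/(_ _ e0)[A [_ HA]] := w0.
  (* Beyond [A] one has |w| <= e; beyond 2 one has sinh >= 1, so the potential K / sinh^2 is at most
     |K|. *)
  pose y := Num.max (A + 1) (Num.max x 2).
  have yA : A < y by rewrite /y lt_max; apply/orP; left; lra.
  have yx : x <= y by rewrite /y !le_max lexx orbT.
  have y2 : 2 <= y by rewrite /y !le_max lexx !orbT.
  have we t : y <= t -> `|w t| <= e by move=> yt; apply: HA; lra.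
  have Jt t : y <= t -> J t by move=> yt; apply: Jy; lra.
  have s1 t : y <= t -> 1 <= sinh t.
    by move=> yt; have := @sinh_ge _ t; lra.
  have dze t : y <= t -> `|dz t| <= (mu ^+ 2 + `|K|) * e.
    move=> yt; have st := s1 _ yt.
    have -> : dz t = (- mu ^+ 2 + K / sinh t ^+ 2) * w t.
      by rewrite /dz; field; rewrite gt_eqF//; lra.
    rewrite normrM ler_pM// ?we//.
    apply: le_trans (ler_normD _ _) _; rewrite normrN ger0_norm ?sqr_ge0//.
    rewrite lerD2l normrM ler_piMr// ger0_norm ?invr_ge0 ?sqr_ge0//.
    by rewrite invf_le1 ?exprn_gt0 ?exprn_ege1//; lra.
  have mvt (f df : R -> R) u v : u <= v -> y <= u ->
      (forall t, J t -> is_derive t 1 f (df t)) ->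
      exists2 c, u <= c <= v & f v - f u = df c * (v - u).
    move=> uv yu Df.
    have [||c /itvP cuv Ec] := @MVT_segment _ f df u v uv.
    + by move=> t /itvP tuv; apply/Df/Jt/(le_trans yu); rewrite tuv.
    + apply: derivable_within_continuous => t /itvP tuv.
      by have [] // := Df t; apply/Jt/(le_trans yu); rewrite tuv.
    + by exists c; rewrite ?cuv.
  (* On [y, y + 1] the increment of w equals w' at some c, hence w'(c) is small; a second mean
     value, for w', brings the bound from c back to y. *)
  have [c cy Ec] := mvt w z y (y + 1) (ler_wpDr ler01 (lexx y)) (lexx y) Dw.
  have [yc cy1] := andP cy.
  have [d dy Ed] := mvt z dz y c yc (lexx y) Dz.
  have [yd _] := andP dy.
  have zy : `|z y| <= B * e.
    have -> : z y = (w (y + 1) - w y) - dz d * (c - y).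
      rewrite Ec -Ed; ring.
    apply: le_trans (ler_normB _ _) _.
    have h1 : `|w (y + 1) - w y| <= e + e.
      by apply: le_trans (ler_normB _ _) (lerD (we _ _) (we _ _)); lra.
    have h2 : `|dz d * (c - y)| <= (mu ^+ 2 + `|K|) * e.
      rewrite normrM; apply: le_trans (dze _ yd).
      by rewrite ler_piMr// ger0_norm; lra.
    by rewrite /B; lra.
  exists y => //; rewrite /E.
  rewrite -(real_normK (num_real (z y))) -(real_normK (num_real (w y))).
  have h1 : `|z y| ^+ 2 <= (B * e) ^+ 2.
    by rewrite ler_pXn2r ?nnegrE// mulr_ge0// ltW.
  have h2 : `|w y| ^+ 2 <= e ^+ 2 by rewrite ler_pXn2r ?nnegrE ?we// ltW.
  have h3 : mu ^+ 2 * `|w y| ^+ 2 <= mu ^+ 2 * e ^+ 2 by rewrite ler_wpM2l ?sqr_ge0.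
  by rewrite exprMn in h1; lra.
apply/eqP; rewrite eq_le E_ge0 andbT.
rewrite -(pmulr_lle0 _ (expR_gt0 (- C * coth x))).
apply/ler_addgt0Pr => e e0; rewrite add0r.
pose D := B ^+ 2 + mu ^+ 2.
have D0 : 0 < D by rewrite addr_gt0 ?exprn_gt0.
have e1 : 0 < Num.sqrt (e / D) by rewrite sqrtr_gt0 divr_gt0.
(* At accuracy sqrt(e / D) the bound of [small] is exactly e. [energy_le] carries it from the far
   point y back to x, where the factor exp(- C coth y) is at most 1. *)
have [y xy Ey] := small _ e1.
apply: le_trans (energy_le Jx (Jy _ xy) xy) _.
rewrite sqr_sqrtr in Ey; last by rewrite divr_ge0// ltW.
rewrite divfK in Ey; last by rewrite gt_eqF.
apply: le_trans Ey; rewrite ler_piMr ?E_ge0// -expR0 ler_expR mulNr oppr_le0.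
have s0 := sinh_gt0 (J0 (Jy _ xy)).
rewrite mulr_ge0// mulr_ge0 ?invr_ge0 ?(ltW s0)//.
by have := cosh_ge1 y; lra.
Qed.

End radial_ode.

(** * Concentration of zonal weights: vanishing moments force vanishing values *)

Section peak.
Context {R : realType} (n : nat).
Local Notation T := (measurableTypeR R).

Lemma shell_int_le (phi psi : 'rV[R]_n -> R) : shell_weight phi -> shell_weight psi ->
  (forall x, phi x <= psi x) -> shell_int phi <= shell_int psi.
Proof.
by move=> s1 s2 le12; apply: le_Rintegral => //; exact: shell_integrable.
Qed.

Lemma shell_int_ge0 (phi : 'rV[R]_n -> R) :
  (forall x, 0 <= phi x) -> 0 <= shell_int phi.
Proof. by move=> H; apply: Rintegral_ge0 => t _; exact: H. Qed.

Lemma shell_intE (phi : 'rV[R]_n -> R) : shell_weight phi ->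
  (\int[lebesgue_tuple n]_t (phi (vec_of_tuple t))%:E = (shell_int phi)%:E)%E.
Proof.
move=> sw; rewrite /shell_int /Rintegral fineK//.
by apply: integrable_fin_num => //; exact: shell_integrable.
Qed.

Lemma shell_int_gt0 (phi : 'rV[R]_n -> R) x0 : shell_weight phi ->
  (forall x, 0 <= phi x) -> 0 < phi x0 -> 0 < shell_int phi.
Proof.
move=> sw phi0 px0.
have : \forall y \near x0, phi x0 / 2 < phi y.
  by have := sw.1 x0; move/cvgr_gt; apply; lra.
move=> /nbhs_ballP[e /= e0 He].
pose A : set (n.-tuple T) := cube (fun i => x0 0 i) (e / 2).
have mA : measurable A := measurable_cube _ _.
rewrite -lte_fin -shell_intE//.
apply: (@lt_le_trans _ _ ((phi x0 / 2)%:E * lebesgue_tuple n A)%E).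
  rewrite lebesgue_cube; last by rewrite divr_ge0// ltW.
  rewrite -EFinM lte_fin mulr_gt0//; first by rewrite divr_gt0.
  by rewrite exprn_gt0// mulr_gt0// divr_gt0.
rewrite -integral_cst//.
apply: (@le_trans _ _ (\int[lebesgue_tuple n]_(t in A) (phi (vec_of_tuple t))%:E)%E).
  apply: ge0_le_integral => //.
  - by move=> t _; rewrite lee_fin; apply: ltW; rewrite divr_gt0.
  - apply/measurable_EFinP; apply: measurable_funTS; exact: measurable_shell.
  - move=> t At; rewrite lee_fin; apply/ltW/He.
    rewrite -ball_normE /= -opprB normrN; apply: le_lt_trans (_ : e / 2 < e); last by lra.
    apply: normr_rV_le => [|i]; first by rewrite divr_ge0// ltW.
    by rewrite !mxE; exact: At.
apply: ge0_subset_integral => //.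
  by apply/measurable_EFinP; exact: measurable_shell.
by move=> t _; rewrite lee_fin.
Qed.

Variables (a b r : R) (f : 'rV[R]_n -> R) (w : 'rV[R]_n).
Hypotheses (a0 : 0 <= a) (b1 : b <= 1) (arb : a < r < b) (w1 : enorm w = 1).
Hypothesis cf : forall y, annulus a b y -> {for y, continuous f}.
Hypothesis mom0 : forall k, moment w k f r = 0.

Let w0 : w != 0.
Proof. by rewrite -enorm_eq0 w1 oner_eq0. Qed.

Let r_gt0 : 0 < r.
Proof. by move: arb => /andP[/(le_lt_trans a0)]. Qed.

Let r_lt1 : r < 1.
Proof. by have /andP[_ rb] := arb; exact: lt_le_trans rb b1. Qed.

Let tw (x : 'rV[R]_n) := dot w (unitv x).

Let tw_le (x : 'rV[R]_n) : x != 0 -> -1 <= tw x <= 1.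
Proof.
move=> x0; rewrite -ler_norml.
by apply: le_trans (normr_dot_le _ _) _; rewrite w1 enorm_unitv// mulr1.
Qed.

Let swf k : shell_weight (fun x => zweight w k x * f (r *: unitv x)).
Proof. exact: (shell_weight_moment w a0 k arb cf). Qed.

(** By the binomial formula the peaked weight is a combination of zonal weights. *)
Let peak_moment0 k :
  shell_int (fun x => bump x * ((1 + tw x) / 2) ^+ k * f (r *: unitv x)) = 0.
Proof.
transitivity (shell_int (fun x => \sum_(i < k.+1)
    ((2^-1) ^+ k * 'C(k, i)%:R) * (zweight w i x * f (r *: unitv x)))).
  congr shell_int; apply/funext => x.
  rewrite exprMn exprDn mulr_suml mulr_sumr mulr_suml; apply: eq_bigr => i _.
  by rewrite expr1n mul1r -mulr_natr /zweight -/(tw x); ring.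
rewrite shell_int_sum; last by move=> i; apply: shell_weightZ; exact: swf.
rewrite big1// => i _; rewrite shell_intZ; last exact: swf.
by rewrite -/(moment w i f r) mom0 mulr0.
Qed.

(* For large k the weight ((1 + w . x/|x|) / 2)^k concentrates at the direction
   w, so a positive value there would make a moment positive. *)
Lemma peak_le0 : f (r *: w) <= 0.
Proof.
rewrite leNgt; apply/negP => c0; set c := f (r *: w) in c0.
have uw : unitv w = w by rewrite /unitv w1 invr1 scale1r.
have Uw : annulus a b (r *: w) by rewrite -[in r *: w]uw; exact: annulus_scale_unitv.
have : \forall y \near (r *: w), c / 2 < f y.
  by have := cf Uw; move/cvgr_gt; apply; rewrite -/c; lra.
move=> /nbhs_ballP[d /= d0 Hd].
(* For unit vectors |w - v|^2 = 2 (1 - w . v), so w . v > 1 - d^2/2 puts v at distance less than d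
   from w. The bound by 1 keeps [q0] positive. *)
pose eta := Num.min 1 (d ^+ 2 / 2).
have eta0 : 0 < eta by rewrite lt_min ltr01 divr_gt0// exprn_gt0.
have eta1 : eta <= 1 by rewrite ge_min lexx.
have near_w x : x != 0 -> 1 - eta < tw x -> c / 2 < f (r *: unitv x).
  move=> x0 tx; apply: Hd; rewrite -ball_normE /= -scalerBr.
  apply: le_lt_trans (normr_le_enorm _) _; rewrite enormZ ger0_norm ?(ltW r_gt0)//.
  apply: le_lt_trans (_ : enorm (w - unitv x) < d).
    by rewrite ler_piMl ?enorm_ge0// ltW.
  rewrite -(ltr_pXn2r (n := 2))// ?nnegrE ?enorm_ge0 ?(ltW d0)//.
  rewrite -dotxx !(dotDl, dotDr, dotNl, dotNr) !dotxx (dotC (unitv x)) -/(tw x).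
  rewrite w1 enorm_unitv// expr1n.
  have : eta <= d ^+ 2 / 2 by rewrite ge_min lexx orbT.
  by move: tx; lra.
have [C [C0 HC]] : exists C, 0 <= C /\ forall x, x != 0 -> `|f (r *: unitv x)| <= C.
  have cS (y : 'rV[R]_n) : r <= enorm y <= r -> {for y, continuous f}.
    by move=> ry; apply: cf; rewrite /annulus/=; move: arb ry; lra.
  have [C HC] := compact_fun_bounded (@closed_annulus_compact R n r r) cS.
  exists `|C|; split => // x x0; apply: le_trans (ler_norm C); apply: HC => /=.
  by rewrite enormZ enorm_unitv// mulr1 ger0_norm ?lexx// ltW.
(* Thresholds for (1 + w . v) / 2: above [q0] the value of f exceeds c / 2; [q1] is strictly larger,
   so (q0 / q1)^k tends to 0. *)
pose q0 := 1 - eta / 2; pose q1 := 1 - eta / 4.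
have q0_gt0 : 0 < q0 by rewrite /q0; lra.
have q01 : q0 < q1 by rewrite /q0 /q1; lra.
have q1_gt0 : 0 < q1 by lra.
(* A continuous substitute for the indicator of the cap above [q1], at most 1 there. *)
pose psi (x : 'rV[R]_n) := Num.max 0 ((1 + tw x) / 2 - q1).
have cpsi x : x != 0 -> {for x, continuous psi}.
  move=> x0; have c1 := dot_unitv_continuous (w := w) x0.
  have c2 := continuousD (@cst_continuous _ _ (1 : R) x) c1.
  have c3 := continuousM c2 (@cst_continuous _ _ (2^-1 : R) x).
  have c4 := continuousB c3 (@cst_continuous _ _ q1 x).
  exact: (@continuous_max R _ (fun=> 0) _ x (@cst_continuous _ _ 0 x) c4).
have swpsi : shell_weight (fun x => bump x * psi x).
  by apply: shell_weightM => //; exact: shell_weight_bump.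
set A := shell_int (fun x => bump x * psi x); set S := shell_int (@bump R n).
have A0 : 0 < A.
  (* 3/8 is a radius inside the shell, where [bump] is positive, and w is the centre of the cap. *)
  apply: (@shell_int_gt0 _ ((3/8) *: w)) => //.
    by move=> x; rewrite mulr_ge0 ?bump_ge0// le_max lexx.
  have x0 : (3/8) *: w != 0 by rewrite scaler_eq0 negb_or w0 andbT; lra.
  have -> : psi ((3/8) *: w) = eta / 4.
    rewrite /psi /tw /unitv enormZ w1 mulr1 scalerA ger0_norm; last by lra.
    rewrite mulVf; last by lra.
    rewrite scale1r dotxx w1 max_r /q1; first by lra.
    by rewrite expr1n; lra.
  rewrite mulr_gt0//; last by lra.
  rewrite /bump -enorm_sqr enormZ w1 mulr1 ger0_norm; last by lra.
  by rewrite exprn_gt0// lt_max; apply/orP; right; lra.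
(* Pointwise comparison in three zones: up to [q0] the weight is at most q0^k and |f| <= C; between
   [q0] and [q1] f is positive and [psi] is 0; above [q1] the weight is at least q1^k and f > c / 2.
   The total integral is 0. *)
have key k : c / 2 * q1 ^+ k * A <= C * q0 ^+ k * S.
  have swk : shell_weight (fun x => bump x * ((1 + tw x) / 2) ^+ k * f (r *: unitv x)).
    apply: (shell_weight_comp a0) _ arb cf; apply: shell_weightM; first exact: shell_weight_bump.
    move=> x x0; apply: continuous_pow.
    have c1 := dot_unitv_continuous (w := w) x0.
    have c2 := continuousD (@cst_continuous _ _ (1 : R) x) c1.
    exact: (continuousM c2 (@cst_continuous _ _ (2^-1 : R) x)).
  rewrite -subr_le0 -(peak_moment0 k) -shell_intZ// -shell_intZ; last exact: shell_weight_bump.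
  rewrite -shell_intB; [|by apply: shell_weightZ|by apply: shell_weightZ; exact: shell_weight_bump].
  apply: shell_int_le => //.
    by apply: shell_weightB; apply: shell_weightZ => //; exact: shell_weight_bump.
  move=> x; have [->|x0] := eqVneq x 0.
    by rewrite (shell_weight0 (shell_weight_bump n)) !(mul0r, mulr0) subrr.
  rewrite (_ : _ - _ = bump x * (c / 2 * q1 ^+ k * psi x - C * q0 ^+ k)); last first.
    by move: (bump x) (psi x) => B p; ring.
  rewrite -[leRHS]mulrA.
  rewrite ler_wpM2l ?bump_ge0//.
  have := tw_le x0; have := HC x x0; rewrite ler_norml /psi => /andP[Cf _] /andP[t0 t1].
  set t := (1 + tw x) / 2.
  have tge0 : 0 <= t by rewrite /t; lra.
  have t_le1 : t <= 1 by rewrite /t; lra.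
  have [tq|tq] := leP t q0.
    rewrite max_l; last by lra.
    rewrite mulr0 sub0r.
    have tk : t ^+ k <= q0 ^+ k by apply: lerXn2r; rewrite ?nnegrE //; apply: ltW.
    have tk0 : 0 <= t ^+ k by rewrite exprn_ge0.
    apply: le_trans (_ : t ^+ k * (- C) <= _); last by rewrite ler_wpM2l.
    by rewrite mulrN lerN2 mulrC ler_wpM2l.
  have fc : c / 2 < f (r *: unitv x).
    by apply: near_w => //; move: tq; rewrite /t /q0; lra.
  have tk0 : 0 <= t ^+ k by rewrite exprn_ge0.
  have Cq : 0 <= C * q0 ^+ k by rewrite mulr_ge0// exprn_ge0// ltW.
  have [tq1|tq1] := leP t q1.
    rewrite max_l; last by lra.
    rewrite mulr0 sub0r; apply: le_trans (_ : 0 <= _); first by lra.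
    by rewrite mulr_ge0//; lra.
  rewrite max_r; last by lra.
  have tk : q1 ^+ k <= t ^+ k by apply: lerXn2r; rewrite ?nnegrE //; apply: ltW.
  have q1k : 0 <= q1 ^+ k by rewrite exprn_ge0// ltW.
  apply: le_trans (_ : c / 2 * q1 ^+ k <= _).
    rewrite lerBlDr -[leLHS]addr0 lerD// ler_piMr//; last by rewrite /q1 in tq1 *; lra.
    by rewrite mulr_ge0//; lra.
  by rewrite mulrC ler_pM//; lra.
have lim0 : (q0 / q1) ^+ k @[k --> \oo] --> (0 : R).
  apply: cvg_expr; rewrite ger0_norm; last by rewrite divr_ge0// ltW.
  by rewrite ltr_pdivrMr// mul1r.
have lim1 : C * S * (q0 / q1) ^+ k @[k --> \oo] --> C * S * 0.
  by apply: cvgM => //; exact: cvg_cst.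
rewrite mulr0 in lim1.
have bound k : c / 2 * A <= C * S * (q0 / q1) ^+ k.
  have q1k : 0 < q1 ^+ k by rewrite exprn_gt0.
  rewrite expr_div_n mulrA ler_pdivlMr//.
  by have := key k; rewrite mulrAC [C * _ * S]mulrAC.
have : c / 2 * A <= 0.
  rewrite -(cvg_lim (@Rhausdorff R) lim1).
  by apply: limr_ge; [exact: (cvgP 0)|apply: nearW => k; exact: bound].
by apply/negP; rewrite -ltNge mulr_gt0// divr_gt0.
Qed.

End peak.

Lemma moments_eq0 {R : realType} (n : nat) (a b r : R) (f : 'rV[R]_n -> R)
    (w : 'rV[R]_n) :
  0 <= a -> b <= 1 -> a < r < b -> enorm w = 1 ->
  (forall y, annulus a b y -> {for y, continuous f}) ->
  (forall k, moment w k f r = 0) -> f (r *: w) = 0.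
Proof.
move=> a0 b1 arb w1 cf m0; apply/eqP; rewrite eq_le (peak_le0 a0 b1 arb w1 cf m0).
rewrite -oppr_le0; apply: (peak_le0 a0 b1 arb w1 (f := fun y => - f y)).
  by move=> y /cf; exact: continuousN.
move=> k; rewrite /moment.
rewrite (_ : (fun x => _) = (fun x => (-1) * (zweight w k x * f (r *: unitv x)))).
  rewrite shell_intZ; last exact: shell_weight_moment arb cf.
  by rewrite -/(moment w k f r) m0 mulr0.
by apply/funext => x; ring.
Qed.

(** * Vanishing on annuli *)

Section annulus_uniqueness.
Context {R : realType} (n : nat).

Lemma tanh_half_le (x y : R) : 0 < x -> x <= y -> tanh (x / 2) <= tanh (y / 2).
Proof.
move=> x0 xy; have t0 t : x <= t <= y -> 0 < t by move=> /andP[/(lt_le_trans x0)].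
apply: (nondecreasing_of_derive xy (fun t txy => is_derive_tanh_half (t0 t txy))).
move=> t /t0 tt; rewrite divr_ge0//; apply: ltW; first exact: tanh_half_gt0.
exact: sinh_gt0.
Qed.

Lemma tanh_half_lt (x y : R) : 0 < y -> tanh (x / 2) < tanh (y / 2) -> x < y.
Proof.
move=> y0; rewrite !ltNge; apply: contra => yx; exact: tanh_half_le.
Qed.

Lemma tanh_half_surj (r : R) : 0 < r < 1 -> exists2 t, 0 < t & tanh (t / 2) = r.
Proof.
move=> /andP[r0 r1]; pose e := (1 + r) / (1 - r).
have e1 : 1 < e by rewrite /e ltr_pdivlMr; lra.
exists (ln e); first by rewrite ln_gt0.
rewrite tanh_half /sinh /cosh expRN lnK ?posrE; last by lra.
rewrite /e; field.
by apply/and3P; split; rewrite gt_eqF//; nra.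
Qed.

Variables (a b mu : R) (f : 'rV[R]_n -> R).
Hypotheses (a0 : 0 <= a) (b1 : b <= 1) (mu0 : 0 < mu).
Hypothesis Cf : C2_on (annulus a b) f.
Hypothesis Hf : forall x, annulus a b x ->
  hlaplacian f x = - (((n%:R - 1) / 2) ^+ 2 + mu ^+ 2) * f x.

Let r_ (t : R) : R := tanh (t / 2).
(** Hyperbolic radii of the spheres contained in the annulus. *)
Let J : set R := [set t | 0 < t /\ a < r_ t < b].

Let J0 t : J t -> 0 < t. Proof. by case. Qed.

Let J_itv x y t : J x -> J y -> x <= t <= y -> J t.
Proof.
move=> [x0 /andP[ax _]] [y0 /andP[_ yb]] /andP[xt ty].
have t0 : 0 < t by exact: lt_le_trans xt.
split=> //; apply/andP; split.
  by apply: lt_le_trans ax _; exact: tanh_half_le.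
by apply: le_lt_trans yb; exact: tanh_half_le.
Qed.

Let oU : open (@annulus R n a b) := @open_annulus R n a b.

Let DM (w : 'rV[R]_n) k (F : 'rV[R]_n -> R) t : J t -> C1_on (annulus a b) F ->
  is_derive t 1 (fun t => moment w k F (r_ t)) (moment w k (euler F) (r_ t) / sinh t).
Proof.
move=> [t0 arb] CF.
have D := is_derive_comp1 (g := moment w k F) (is_derive_tanh_half t0)
  (is_derive_moment w a0 k arb CF).
apply: (is_derive_eq D).
have r0 : r_ t != 0 by rewrite gt_eqF// tanh_half_gt0.
by rewrite mulrACA mulVf// mul1r.
Qed.

(** With r^2 = (c - 1)/(c + 1) the factor (1 - r^2)^2 / 4 is 1/(1 + c)^2, so multiplying by (1 +
    c)^2 gives the hyperbolic form. The summand [0] is the place of the source of order k - 2. *)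
Let ode_algebra (c s r N m2 m1 m0 L k : R) : 1 <= c -> c ^+ 2 = 1 + s ^+ 2 ->
  r = s / (1 + c) ->
  (1 - r ^+ 2) ^+ 2 / 4 * (m2 + (N - 2) * m1 + 0 - k * m0) +
    (1 - r ^+ 2) * r ^+ 2 * (N - 2) / 2 * m1 + L * r ^+ 2 * m0 = 0 ->
  m2 + (2 * ((N - 1) / 2) - 1) * c * m1 + L * s ^+ 2 * m0 = k * m0.
Proof.
move=> c1 cs rE H.
have cn : 1 + c != 0 by rewrite gt_eqF//; lra.
have r2 : r ^+ 2 = (c - 1) / (1 + c).
  rewrite rE expr_div_n (_ : s ^+ 2 = c ^+ 2 - 1); last by lra.
  by field.
rewrite (_ : s ^+ 2 = c ^+ 2 - 1); last by lra.
rewrite r2 in H; apply/eqP; rewrite -subr_eq0; apply/eqP.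
rewrite -(mulr0 ((1 + c) ^+ 2)) -H; field.
exact: cn.
Qed.

Let ode (w : 'rV[R]_n) k t : enorm w = 1 -> J t ->
  k%:R * k.-1%:R * moment w k.-2 f (r_ t) = 0 ->
  moment w k (euler (euler f)) (r_ t) +
   (2 * ((n%:R - 1) / 2) - 1) * cosh t * moment w k (euler f) (r_ t) +
   (((n%:R - 1) / 2) ^+ 2 + mu ^+ 2) * sinh t ^+ 2 * moment w k f (r_ t) =
  k%:R * (k%:R + n%:R - 2) * moment w k f (r_ t).
Proof.
move=> w1 [t0 arb] m0.
have := moment_ode a0 w1 Cf Hf k arb; rewrite m0.
exact: ode_algebra (cosh_ge1 t) (cosh2 t) (tanh_half t).
Qed.

(* Only the moment of order k - 2 enters the radial equation of order k. *)
Let moment_ind (w : 'rV[R]_n) : enorm w = 1 ->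
  (forall k, (forall t, J t -> k%:R * k.-1%:R * moment w k.-2 f (r_ t) = 0) ->
     forall t, J t -> moment w k f (r_ t) = 0) ->
  forall k t, J t -> moment w k f (r_ t) = 0.
Proof.
move=> w1 H k; elim/ltn_ind: k => -[|[|k]] IH t Jt; apply: H => // s Js.
- by rewrite !mul0r.
- by rewrite /= mulr0 mul0r.
- by rewrite /= IH ?mulr0.
Qed.

Let vanish : (forall w : 'rV[R]_n, enorm w = 1 -> forall k t, J t -> moment w k f (r_ t) = 0) ->
  forall x, annulus a b x -> f x = 0.
Proof.
move=> H x Ux; have x0 : x != 0.
  by rewrite -enorm_gt0; move: Ux => /andP[/(le_lt_trans a0)].
have [t t0 rE] : exists2 t, 0 < t & tanh (t / 2) = enorm x.
  apply: tanh_half_surj; rewrite enorm_gt0 x0/=.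
  by move: Ux => /andP[_ /lt_le_trans]; apply.
have Jt : J t by split => //; rewrite /r_ rE.
have xE : x = r_ t *: unitv x.
  by rewrite /r_ rE scalerA mulfV ?scale1r// enorm_eq0.
rewrite xE; apply: (moments_eq0 a0 b1).
- by case: Jt.
- exact: enorm_unitv.
- by move=> y; exact: C1_on_continuous oU Cf.1.
- by move=> k; apply: H => //; exact: enorm_unitv.
Qed.

(** Zeros spread outwards from an inner annulus; with a = 0 this is the local step of unique
    continuation. *)
Lemma annulus_cauchy (c : R) : a < c -> (forall x : 'rV[R]_n, annulus a c x -> f x = 0) ->
  forall x, annulus a b x -> f x = 0.
Proof.
move=> ac f0 x Ux; case: (ltP (enorm x) c) => xc.
  by apply: f0; rewrite /annulus/=; case/andP: Ux => ->.
apply: vanish Ux => w w1; apply: moment_ind => // k mk t Jt.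
have m0 F s : J s -> r_ s < c -> (forall y, annulus a c y -> F y = 0) ->
    moment w k F (r_ s) = 0.
  move=> Js sc F0; rewrite /moment.
  rewrite (_ : (fun x => _) = (fun x => 0 * (0 : R))).
    by rewrite (shell_intZ 0 (shell_weight_cst0 n)) mul0r.
  apply/funext => y; rewrite mul0r; have [->|y0] := eqVneq y 0.
    by rewrite (shell_weight0 (shell_weight_zweight w k)) mul0r.
  rewrite F0 ?mulr0//; apply: annulus_scale_unitv => //.
  by case: Js => _ /andP[-> _].
case: (ltP (r_ t) c) => [tc|ct]; first exact: m0.
have r_t1 : r_ t < 1 := tanh_half_lt1 (J0 Jt).
have c1 : c < 1 := le_lt_trans ct r_t1.
have c0 : 0 < c := le_lt_trans a0 ac.
(* A radius strictly inside the zero annulus: both the moment and its radial derivative vanish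
   there, which are zero Cauchy data. *)
have [s s0 sE] : exists2 s, 0 < s & tanh (s / 2) = (a + c) / 2.
  apply: tanh_half_surj; apply/andP; split; first exact: le_lt_trans (midf_lt ac).1.
  exact: lt_trans (midf_lt ac).2 c1.
have sc : r_ s < c by rewrite /r_ sE (midf_lt ac).2.
have Js : J s.
  split => //; case: Jt => _ /andP[_ tb]; apply/andP; split.
    by rewrite /r_ sE (midf_lt ac).1.
  exact: lt_trans sc (le_lt_trans ct tb).
have st : s <= t by apply/ltW/tanh_half_lt; [exact: J0|exact: lt_le_trans ct].
have CE : C1_on (annulus a b) (euler f) := C1_on_euler oU Cf.
apply: (radial_ode_cauchy mu0 J0 J_itv (fun t Jt => DM w k Jt Cf.1)
  (fun t Jt => DM w k Jt CE) (fun t Jt => ode w1 Jt (mk t Jt)) Js Jt st).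
  exact: m0.
apply: m0 => // y yac; rewrite /euler big1// => i _.
rewrite (_ : partial i f y = 0) ?mulr0//; apply: partial_val.
apply: (near_eq_is_derive _ (is_derive_const (0 : R) y (delta_mx 0 i))).
by apply: filterS (near_in_open (@open_annulus R n a c) yac) => z /f0.
Qed.

Lemma annulus_decay : b = 1 -> a < 1 ->
  (forall (w : 'rV[R]_n) k, enorm w = 1 ->
    expR ((n%:R - 1) / 2 * ln (sinh t)) * moment w k f (tanh (t / 2))
      @[t --> +oo] --> 0) ->
  forall x, annulus a b x -> f x = 0.
Proof.
move=> bE a1 dec; apply: vanish => w w1; apply: moment_ind => // k mk t Jt.
have CE : C1_on (annulus a b) (euler f) := C1_on_euler oU Cf.
apply: (radial_ode_decay mu0 J0 J_itv (fun t Jt => DM w k Jt Cf.1)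
  (fun t Jt => DM w k Jt CE) (fun t Jt => ode w1 Jt (mk t Jt)) Jt _ (dec w k w1)).
move=> y ty; have t0 := J0 Jt; have y0 : 0 < y by exact: lt_le_trans ty.
split=> //; rewrite bE; case: Jt => _ /andP[at1 _].
rewrite tanh_half_lt1// andbT; apply: lt_le_trans at1 _.
exact: tanh_half_le.
Qed.

End annulus_uniqueness.

(** * From the decay of surface integrals to the decay of moments *)

Section sphere_decay.
Context {R : realType} (n : nat).
Local Notation T := (measurableTypeR R).
Implicit Types (G f : 'rV[R]_n -> R).

Lemma bump_le1 (x : 'rV[R]_n) : bump x <= 1.
Proof.
have [->|x0] := eqVneq (bump x) 0; first exact: ler01.
have := (@shell_weight_bump R n).2 x x0; rewrite /bump -enorm_sqr => /andP[h1 h2].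
have q1 : 1/16 < enorm x ^+ 2 by nra.
have q2 : enorm x ^+ 2 < 1/4 by have := enorm_ge0 x; nra.
rewrite expr_le1//; last by rewrite le_max lexx.
by rewrite ge_max ler01/=; nra.
Qed.

Lemma unitv_scale (c : R) (x : 'rV[R]_n) : 0 < c -> unitv (c *: x) = unitv x.
Proof.
move=> c0; rewrite /unitv enormZ gtr0_norm// scalerA invfM mulrAC.
by rewrite mulVf ?mul1r// gt_eqF.
Qed.

Lemma vec_of_radial (r : R) (t : n.-tuple T) :
  vec_of_tuple (radial r t) = r *: unitv (vec_of_tuple t).
Proof. by apply/rowP => i; rewrite !mxE tnth_mktuple mulrA. Qed.

Lemma sinh_le_cosh (t : R) : sinh t <= 1 + cosh t.
Proof. by rewrite /sinh /cosh; have := expR_gt0 (- t); lra. Qed.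

(** The cone measure pulls the sphere integral back to the ball |t| <= r, which contains the shell
    as soon as r >= 1/2. There [bump] is at most 1, and the density 2 / (1 - r^2) equals 1 + cosh
    rho, which is at least sinh rho. *)
Lemma hsphere_integral_ge (a rho : R) G : (0 < n)%N -> 0 <= a -> 0 < rho ->
  a < tanh (rho / 2) -> 1/2 <= tanh (rho / 2) ->
  (forall y, annulus a 1 y -> {for y, continuous G}) -> (forall y, 0 <= G y) ->
  ((sinh rho ^+ n.-1 *
    shell_int (fun x => bump x * G (tanh (rho / 2) *: unitv x)))%:E
   <= hsphere_integral G rho)%E.
Proof.
move=> n0 a0 rho0 ar r2 cG G0; rewrite /hsphere_integral.
have r1 := tanh_half_lt1 rho0; have r0 := tanh_half_gt0 rho0.
have kE := onem_tanh_half2 rho.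
set r := tanh (rho / 2) in ar r2 r1 r0 kE *.
set D := [set t | _].
have mD : measurable D.
  rewrite -[D]setTI; exact: (@measurable_enorm_tuple R n measurableT _ (measurable_set1 r)).
(* Scaling by [c] sends the sphere |x| = r to |x| = 3/8, inside the shell, where [bump] takes the
   constant value [b0]. *)
pose c := 3 / (8 * r); have c0 : 0 < c by rewrite divr_gt0// mulr_gt0.
pose b0 : R := ((9/64 - 1/16) * (1/4 - 9/64)) ^+ 2.
have b0_gt0 : 0 < b0 by rewrite exprn_gt0// mulr_gt0//; lra.
have bumpD (x : 'rV[R]_n) : enorm x = r -> bump (c *: x) = b0.
  move=> xr; rewrite /bump -enorm_sqr enormZ xr gtr0_norm//.
  have -> : (c * r) ^+ 2 = 9 / 64 by rewrite /c; field; rewrite gt_eqF.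
  by rewrite max_r//; rewrite mulr_ge0//; lra.
have a1 : a < r < 1 by rewrite ar r1.
pose kap : R := (1 + cosh rho) ^+ n.-1.
have kap0 : 0 <= kap by rewrite exprn_ge0//; have := cosh_ge1 rho; lra.
pose Phi (y : 'rV[R]_n) := bump y * G (r *: unitv y).
have swPhi : shell_weight Phi.
  by apply: (shell_weight_comp a0 _ a1 cG); exact: shell_weight_bump.
(* [G] is continuous on the annulus only; [h] is continuous everywhere, hence measurable, and equals
   [G * kap] on the sphere. *)
pose h (x : 'rV[R]_n) := kap / b0 * Phi (c *: x).
have ch : continuous h.
  move=> x; have c1 : {for x, continuous (fun x : 'rV[R]_n => c *: x)}.
    by apply: scaler_continuous.
  have c2 := continuous_comp c1 (swPhi.1 (c *: x)).
  exact: (continuousM (@cst_continuous _ _ (kap / b0) x) c2).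
have h0 x : 0 <= h x.
  by rewrite mulr_ge0 ?divr_ge0 ?(ltW b0_gt0)// mulr_ge0 ?bump_ge0.
have hE x : enorm x = r -> h x = G x * kap.
  move=> xr; rewrite /h /Phi bumpD// unitv_scale//.
  have -> : r *: unitv x = x.
    by rewrite /unitv xr scalerA mulfV ?scale1r// gt_eqF.
  by field; rewrite gt_eqF.
have mh : measurable_fun [set: n.-tuple T] (fun t => h (vec_of_tuple t)).
  exact: measurable_continuous_vec.
have -> : (\int[sphere_measure n r]_(t in D) (G (vec_of_tuple t) *
     (2 / (1 - enorm (vec_of_tuple t) ^+ 2)) ^+ n.-1)%:E =
   \int[sphere_measure n r]_(t in D) (h (vec_of_tuple t))%:E)%E.
  apply: eq_integral => t; rewrite inE => tr; rewrite hE// tr kE.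
  congr ((_ * _ ^+ _)%:E); field.
  by rewrite gt_eqF//; have := cosh_ge1 rho; lra.
rewrite /sphere_measure ge0_integral_mscale//; last 2 first.
- by apply/measurable_EFinP; apply: measurable_funTS; exact: mh.
- by move=> t _; rewrite lee_fin.
rewrite ge0_integral_pushforward//; last 2 first.
- by apply/measurable_EFinP; apply: measurable_funTS; exact: mh.
- by move=> t _; rewrite lee_fin.
set A := radial r @^-1` D.
have mA : measurable A.
  by rewrite -[A]setTI; exact: (measurable_radial r measurableT mD).
pose B : set (n.-tuple T) := [set t | enorm (vec_of_tuple t) <= r].
have mB : measurable B := measurable_eball_tuple r.
have mhr : measurable_fun [set: n.-tuple T]
    (EFin \o (fun t => h (vec_of_tuple (radial r t)))).
  apply/measurable_EFinP; apply: (measurableT_comp mh); exact: measurable_radial.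
have swb : shell_weight (fun x => bump x * G (r *: unitv x)) by exact: swPhi.
have L1 : ((sinh rho ^+ n.-1 * shell_int (fun x => bump x * G (r *: unitv x)))%:E
    <= \int[lebesgue_tuple n]_(t in A `&` B) (h (vec_of_tuple (radial r t)))%:E)%E.
  rewrite -shell_intZ// -shell_intE; last exact: shell_weightZ.
  pose ps (x : 'rV[R]_n) := sinh rho ^+ n.-1 * (bump x * G (r *: unitv x)).
  have sw : shell_weight ps by exact: shell_weightZ.
  have s0 := sinh_gt0 rho0.
  have ps0 x : 0 <= ps x.
    by rewrite mulr_ge0 ?exprn_ge0 ?(ltW s0)// mulr_ge0 ?bump_ge0.
  (* [ps] is supported in the shell, which lies in [B] since r >= 1/2 and in [A] since nonzero
     points project onto the sphere. *)
  have -> : (\int[lebesgue_tuple n]_t (ps (vec_of_tuple t))%:E =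
      \int[lebesgue_tuple n]_(t in A `&` B) (ps (vec_of_tuple t))%:E)%E.
    rewrite [RHS]integral_mkcond; apply: eq_integral => t _.
    rewrite /patch; case: ifPn => // tAB.
    have [->//|/sw.2/andP[p1 p2]] := eqVneq (ps (vec_of_tuple t)) 0.
    case/negP: tAB; rewrite inE; split; last by rewrite /B/=; lra.
    rewrite /A /D /= vec_of_radial enormZ enorm_unitv ?mulr1 ?gtr0_norm//.
    by rewrite -enorm_gt0; lra.
  apply: ge0_le_integral => //.
  - exact: measurableI.
  - by move=> t _; rewrite lee_fin.
  - have mps : measurable_fun [set: n.-tuple T]
        (EFin \o (fun t => ps (vec_of_tuple t))).
      by apply/measurable_EFinP; exact: (measurable_shell sw).
    exact: (measurable_funS measurableT (@subsetT _ _) mps).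
  - exact: (measurable_funS measurableT (@subsetT _ _) mhr).
  - move=> t [tA _]; rewrite lee_fin hE//.
    rewrite vec_of_radial /ps [leLHS]mulrC.
    apply: ler_pM => //.
    + by rewrite mulr_ge0 ?bump_ge0.
    + by rewrite exprn_ge0// ltW.
    + by rewrite ler_piMl// bump_le1.
    + apply: lerXn2r; rewrite ?nnegrE ?(ltW s0)//; last exact: sinh_le_cosh.
      by have := cosh_ge1 rho; lra.
apply: le_trans L1 _.
have L2 : (\int[lebesgue_tuple n]_(t in A `&` B) (h (vec_of_tuple (radial r t)))%:E =
   \int[mrestr (lebesgue_tuple n) (measurable_eball_tuple r)]_(t in A `&` B)
     (h (vec_of_tuple (radial r t)))%:E)%E.
  apply: eq_measure_integral => C mC CAB /=; rewrite /mrestr; congr (lebesgue_tuple n _).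
  by apply/seteqP; split=> [t Ct|t []//]; split => //; exact: (CAB t Ct).2.
rewrite L2.
have L3 : (\int[mrestr (lebesgue_tuple n) (measurable_eball_tuple r)]_(t in A `&` B)
     (h (vec_of_tuple (radial r t)))%:E <=
   \int[mrestr (lebesgue_tuple n) (measurable_eball_tuple r)]_(t in A)
     (h (vec_of_tuple (radial r t)))%:E)%E.
  apply: ge0_subset_integral => //.
  - exact: measurableI.
  - exact: (measurable_funS measurableT (@subsetT _ _) mhr).
  - by move=> t _; rewrite lee_fin.
apply: le_trans L3 _.
(* The factor n / r of the cone measure is at least 1, as r < 1 <= n. *)
rewrite -[leLHS]mul1e; apply: lee_wpmul2r.
  by apply: integral_ge0 => t _; rewrite lee_fin.
rewrite lee_fin /=; apply: le_trans (ler_norm _).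
  by rewrite ler_pdivlMr// mul1r (le_trans (ltW r1))// ler1n.
exact: measurable_radial.
Qed.

(** Plays the part of Cauchy-Schwarz: the free parameter d turns smallness of the integral of v^2
    into smallness of the integral of v. *)
Let weighted_am_gm (d P v : R) : 0 < d ->
  `|P * v| <= d / 2 + P ^+ 2 * v ^+ 2 / (2 * d).
Proof.
move=> d0; rewrite -exprMn -real_normK ?num_real//; set y := `|P * v|.
rewrite -subr_ge0 (_ : _ - _ = (y - d) ^+ 2 / (2 * d)).
  by rewrite divr_ge0 ?sqr_ge0// mulr_ge0// ltW.
by field; rewrite gt_eqF.
Qed.

(** The square of the prefactor is sinh^(n-1), the factor in [hsphere_integral_ge], so the moment is
    controlled by the surface integral of [G]. *)
Lemma moment_decay (a : R) f G (w : 'rV[R]_n) k : (0 < n)%N -> 0 <= a -> a < 1 ->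
  enorm w = 1 ->
  (forall y, annulus a 1 y -> {for y, continuous f}) ->
  (forall y, annulus a 1 y -> {for y, continuous G}) ->
  (forall y, f y ^+ 2 <= G y) ->
  hsphere_integral G rho @[rho --> +oo] --> 0%E ->
  expR ((n%:R - 1) / 2 * ln (sinh t)) * moment w k f (tanh (t / 2))
    @[t --> +oo] --> 0.
Proof.
move=> n0 a0 a1 w1 cf cG fG dec.
have G0 y : 0 <= G y by apply: le_trans (fG y); exact: sqr_ge0.
apply/cvgr0Pnorm_le => e e0.
pose S0 := shell_int (@bump R n).
have S00 : 0 <= S0 by apply: shell_int_ge0 => x; exact: bump_ge0.
(* [S0] is the mass of [bump]: the first term of the weighted inequality contributes d S0 / 2 <= e /
   2, and the second e d / (2 d) = e / 2 once the surface integral is below e d. *)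
pose d := e / (S0 + 1).
have S1 : 0 < S0 + 1 by lra.
have d0 : 0 < d by rewrite divr_gt0.
have ed : 0 < e * d by rewrite mulr_gt0.
have I_small : \forall rho \near +oo, (hsphere_integral G rho < (e * d)%:E)%E.
  apply: (dec [set y | (y < (e * d)%:E)%E]).
  exact: (@nbhs_open_ereal_lt _ 0 (fun=> e * d)).
(* Past this radius [f] and [G] are continuous and [hsphere_integral_ge] applies. *)
pose a' := Num.max a (1/2).
have a'0 : 0 < a' by rewrite /a' lt_max; apply/orP; right; lra.
have a'1 : a' < 1 by rewrite gt_max a1/=; lra.
have [t1 t10 t1E] : exists2 t, 0 < t & tanh (t / 2) = (a' + 1) / 2.
  by apply: tanh_half_surj; lra.
near=> t.
have tt1 : t1 <= t by near: t; apply: nbhs_pinfty_ge; exact: num_real.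
have It : (hsphere_integral G t < (e * d)%:E)%E by near: t.
have t0 : 0 < t by exact: lt_le_trans tt1.
have ra' : a' < tanh (t / 2).
  by apply: lt_le_trans (tanh_half_le t10 tt1); rewrite t1E; lra.
have ra : a < tanh (t / 2) by apply: le_lt_trans ra'; rewrite le_max lexx.
have r2 : 1/2 <= tanh (t / 2).
  by apply: le_trans (ltW ra'); rewrite le_max lexx orbT.
have arb : a < tanh (t / 2) < 1 by rewrite ra tanh_half_lt1.
have s0 := sinh_gt0 t0.
have low := hsphere_integral_ge n0 a0 t0 ra r2 cG G0.
have := le_lt_trans low It; rewrite lte_fin {low It}.
set r := tanh (t / 2) in arb *; set P := expR _ => It.
have P2 : P ^+ 2 = sinh t ^+ n.-1.
  rewrite /P -expRM_natl.
  have -> : 2%:R * ((n%:R - 1) / 2 * ln (sinh t)) = n.-1%:R * ln (sinh t).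
    have -> : n.-1%:R = n%:R - 1 :> R by rewrite -subn1 natrB.
    by field.
  by rewrite expRM_natl lnK.
have swG : shell_weight (fun x => bump x * G (r *: unitv x)).
  by apply: (shell_weight_comp a0 _ arb cG); exact: shell_weight_bump.
have swf := shell_weight_moment w a0 k arb cf.
pose Q (x : 'rV[R]_n) := d / 2 * bump x +
  P ^+ 2 / (2 * d) * (bump x * G (r *: unitv x)).
have swQ : shell_weight Q.
  by apply: shell_weightD; apply: shell_weightZ => //; exact: shell_weight_bump.
have QE : shell_int Q <= e.
  rewrite shell_intD; [|by apply: shell_weightZ; exact: shell_weight_bump|exact: shell_weightZ].
  rewrite !shell_intZ//; last exact: shell_weight_bump.
  rewrite -/S0 P2.
  have h1 : d / 2 * S0 <= e / 2.
    have -> : d / 2 * S0 = e / 2 * (S0 / (S0 + 1)).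
      by rewrite /d; field; rewrite gt_eqF.
    by rewrite ler_piMr ?divr_ge0 ?(ltW e0)// ler_pdivrMr// mul1r; lra.
  have h2 : sinh t ^+ n.-1 / (2 * d) * shell_int (fun x => bump x * G (r *: unitv x))
      <= e / 2.
    rewrite mulrAC ler_pdivrMr; last exact: mulr_gt0.
    have -> : e / 2 * (2 * d) = e * d by rewrite mulrA divfK.
    exact: ltW.
  by apply: le_trans (lerD h1 h2) _; lra.
have bnd x : `|P * (zweight w k x * f (r *: unitv x))| <= Q x.
  have [->|x0] := eqVneq x 0.
    by rewrite /zweight /Q (shell_weight0 (shell_weight_bump n)) !(mul0r, mulr0) normr0 addr0.
  rewrite (_ : P * _ = bump x * (dot w (unitv x) ^+ k * (P * f (r *: unitv x)))); last first.
    by rewrite /zweight; ring.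
  rewrite (_ : Q x = bump x * (d / 2 + P ^+ 2 * G (r *: unitv x) / (2 * d))); last first.
    by rewrite /Q; field; rewrite gt_eqF.
  rewrite normrM ger0_norm ?bump_ge0// ler_wpM2l ?bump_ge0// normrM.
  apply: le_trans (_ : `|P * f (r *: unitv x)| <= _).
    rewrite ler_piMl// normrX exprn_ile1//.
    by apply: le_trans (normr_dot_le _ _) _; rewrite w1 enorm_unitv// mulr1.
  apply: le_trans (weighted_am_gm P (f (r *: unitv x)) d0) _.
  rewrite lerD2l; apply: ler_wpM2r; last exact: ler_wpM2l (sqr_ge0 P) _ _ (fG _).
  by rewrite invr_ge0 mulr_ge0// ltW.
rewrite /moment -shell_intZ//; apply: le_trans QE.
rewrite ler_norml; apply/andP; split; last first.
  by apply: shell_int_le => // [|x]; [exact: shell_weightZ|exact: le_trans (ler_norm _) (bnd x)].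
rewrite lerNl -mulN1r -shell_intZ; last exact: shell_weightZ.
apply: shell_int_le => // [|x]; first by do 2!apply: shell_weightZ.
by rewrite mulN1r; apply: le_trans (bnd x); rewrite -normrN ler_norm.
Unshelve. all: by end_near. Qed.

End sphere_decay.

(** * Inversions preserving the ball *)

Section inversion.
Context {R : realType} (n : nat).
Implicit Types (x y z : 'rV[R]_n) (U V : set 'rV[R]_n).

Lemma C1_on_inv U (F : 'rV[R]_n -> R) : open U -> C1_on U F ->
  (forall x, U x -> F x != 0) -> C1_on U (fun y => (F y)^-1).
Proof.
move=> oU CF F0; apply: (C1_onI oU (dF := fun i x => - (F x) ^- 2 * partial i F x)).
  by move=> x Ux i; apply: is_derive_inv; [exact: F0|exact: C1_on_derive CF Ux].
move=> x Ux i; have cF := C1_on_continuous oU CF Ux.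
have F20 : F x ^+ 2 != 0 by rewrite expf_neq0// F0.
have c1 : {for x, continuous (fun y => - (F y ^+ 2)^-1)}.
  apply: continuousN; apply: (continuousV (s := fun y => F y ^+ 2)) => //.
  exact: continuous_pow.
exact: (continuousM c1 (CF x Ux i).2).
Qed.

Lemma C1_on_subset U V (F : 'rV[R]_n -> R) : V `<=` U -> C1_on U F -> C1_on V F.
Proof. by move=> VU CF x /VU; exact: CF. Qed.

Lemma C1_on_comp U V (F : 'rV[R]_n -> R) (g : 'rV[R]_n -> 'rV[R]_n) :
  open U -> open V -> (forall x, V x -> U (g x)) -> C1_on U F ->
  (forall k, C1_on V (fun x => g x 0 k)) -> C1_on V (fun x => F (g x)).
Proof.
move=> oU oV VU CF Cg.
apply: (C1_onI oV (dF := fun i x =>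
    \sum_k partial k F (g x) * partial i (fun x => g x 0 k) x)).
  move=> x Vx i; apply: (C1_on_is_derive_comp oU CF (VU _ Vx)) => k.
  exact: C1_on_derive (Cg k) Vx.
move=> x Vx i; apply: continuous_bigsum => k.
have cg : {for x, continuous g}.
  apply: (@cvg_rV _ _ (nbhs x)) => l.
  exact: (C1_on_continuous oV (Cg l) Vx).
have c1 := continuous_comp cg (CF _ (VU _ Vx) k).2.
exact: (continuousM c1 (Cg k x Vx i).2).
Qed.

Lemma partial_comp U V (F : 'rV[R]_n -> R) (g : 'rV[R]_n -> 'rV[R]_n) x i :
  open U -> (forall x, V x -> U (g x)) -> C1_on U F ->
  (forall k, C1_on V (fun x => g x 0 k)) -> V x ->
  partial i (fun x => F (g x)) x =
    \sum_k partial k F (g x) * partial i (fun x => g x 0 k) x.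
Proof.
move=> oU VU CF Cg Vx; apply: partial_val.
apply: (C1_on_is_derive_comp oU CF (VU _ Vx)) => k.
exact: C1_on_derive (Cg k) Vx.
Qed.

Variable a : 'rV[R]_n.
Hypothesis a1 : 1 < dot a a.

(* Inversion in the sphere centred at [a] orthogonal to the unit sphere: a
   hyperbolic isometry. *)
Definition inversion x : 'rV[R]_n :=
  a + ((dot a a - 1) / dot (x - a) (x - a)) *: (x - a).

Local Notation S := inversion.
Local Notation rho := (dot a a - 1).
Let N x := dot (x - a) (x - a).

Let NE x : N x = dot x x - 2 * dot a x + dot a a.
Proof. by rewrite /N dotDl !dotDr !dotNl !dotNr (dotC x a); ring. Qed.

Let N_gt0 x : x != a -> 0 < N x.
Proof. by move=> xa; rewrite /N dotxx exprn_gt0// enorm_gt0 subr_eq0. Qed.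

Lemma pball_dot x : pball x <-> dot x x < 1.
Proof.
rewrite dotxx /pball/=; have := enorm_ge0 x => e0.
by split=> h; nra.
Qed.

Let pball_neq x : pball x -> x != a.
Proof. by move=> /pball_dot xb; apply/eqP => xa; move: xb a1; rewrite xa; lra. Qed.

Let Npb x : pball x -> 0 < N x.
Proof. by move=> /pball_neq/N_gt0. Qed.

Lemma inversionK x : x != a -> S (S x) = x.
Proof.
move=> /N_gt0 N0.
have E : S x - a = (rho / N x) *: (x - a) by rewrite addrC addKr.
rewrite {1}/inversion E dotZl dotZr -/(N x) scalerA.
have -> : rho / (rho / N x * (rho / N x * N x)) * (rho / N x) = 1.
  have r0 : rho != 0 by rewrite subr_eq0 gt_eqF.
  by move: (N x) N0 rho r0 => M M0 r r0; field; rewrite r0 gt_eqF.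
by rewrite scale1r addrC subrK.
Qed.

Let dot_axpy c x y : dot (x + c *: y) (x + c *: y) =
  dot x x + 2 * c * dot x y + c ^+ 2 * dot y y.
Proof. by rewrite !(dotDl, dotDr, dotZl, dotZr) (dotC y x); ring. Qed.

(** The conformal factor rho / |x - a|^2 of the inversion is the ratio of the weights 1 - |.|^2,
    which is why the inversion preserves the ball and its metric. *)
Lemma onem_inversion x : x != a ->
  1 - dot (S x) (S x) = rho * (1 - dot x x) / dot (x - a) (x - a).
Proof.
move=> /N_gt0 N0; rewrite /inversion.
rewrite dot_axpy -/(N x).
have -> : dot a (x - a) = dot a x - dot a a by rewrite dotDr dotNr.
have := NE x; move: N0; move: (N x) (dot a a) (dot x x) (dot a x) => M A X B M0 E.
rewrite (_ : X = M + 2 * B - A); last by rewrite E; ring.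
by field; rewrite gt_eqF.
Qed.

Lemma open_pball : open (@pball R n).
Proof.
rewrite (_ : pball = @enorm R n @^-1` [set t | t < 1]).
  by apply: open_comp; [move=> x _; exact: enorm_continuous|exact: open_lt].
by apply/seteqP; split.
Qed.

Let C1N : C1_on pball N.
Proof.
have oB := open_pball.
apply: (C1_on_sum oB) => k.
have C := C1_onD oB (C1_on_coord oB k) (C1_on_const oB ((- a) 0 k)).
have C2 := C1_onM oB C C.
rewrite (_ : (fun y => _) = (fun y : 'rV[R]_n => (y 0 k + (- a) 0 k) * (y 0 k + (- a) 0 k)))//.
by apply/funext => y; rewrite mxE.
Qed.

Let y_ k x : R := x 0 k - a 0 k.

Let yE k x : (x - a) 0 k = y_ k x.
Proof. by rewrite !mxE. Qed.

Let Dy k x i : is_derive x (delta_mx 0 i) (y_ k) ((k == i)%:R).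
Proof.
apply: (is_derive_eq (is_derive_sub (is_derive_coord x _ k) (is_derive_const (a 0 k) x _))).
by rewrite delta_rV subr0.
Qed.

Let DN x i : is_derive x (delta_mx 0 i) N (2 * y_ i x).
Proof.
have D k : is_derive x (delta_mx 0 i) (fun y : 'rV[R]_n => (y - a) 0 k) ((k == i)%:R).
  by rewrite (_ : (fun y => _) = y_ k); [exact: Dy|apply/funext => y; exact: yE].
apply: (is_derive_eq (is_derive_bigsum (fun k => is_derive_mul (D k) (D k)))).
under eq_bigr do rewrite [_ * (_ == _)%:R]mulrC -mulrDr.
by rewrite sum_deltal yE; ring.
Qed.

Let SE k x : S x 0 k = a 0 k + rho * (y_ k x / N x).
Proof. by rewrite !mxE -/(N x) /y_; ring. Qed.

Let dS i k x : R := rho * ((k == i)%:R / N x - 2 * y_ k x * y_ i x / N x ^+ 2).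

Let DS x i k : pball x -> is_derive x (delta_mx 0 i) (fun x => S x 0 k) (dS i k x).
Proof.
move=> xb; have N0 : N x != 0 by rewrite gt_eqF// Npb.
under eq_fun do rewrite SE.
apply: (is_derive_eq (is_derive_add (is_derive_const (a 0 k) x _)
  (is_derive_cmul rho (is_derive_mul (Dy k x i) (is_derive_inv N0 (DN x i)))))).
by rewrite /dS; move: (N x) N0 => M M0; field.
Qed.

Let d2S i k x : R := rho * (- 2 * (2 * (k == i)%:R * y_ i x + y_ k x) / N x ^+ 2 +
  8 * y_ k x * y_ i x ^+ 2 / N x ^+ 3).

Let DdS x i k : pball x -> is_derive x (delta_mx 0 i) (dS i k) (d2S i k x).
Proof.
move=> xb; have N0 : N x != 0 by rewrite gt_eqF// Npb.
have N2 : N x ^+ 2 != 0 by rewrite expf_neq0.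
have D1 := is_derive_cmul (k == i)%:R (is_derive_inv N0 (DN x i)).
have D2 := is_derive_mul (is_derive_mul (is_derive_cmul 2 (Dy k x i)) (Dy i x i))
  (is_derive_inv (f := fun x => N x ^+ 2) N2 (is_derive_pow 2 (DN x i))).
apply: (is_derive_eq (is_derive_cmul rho (is_derive_sub D1 D2))).
rewrite /d2S eqxx /= expr1; move: (N x) N0 {N2} => M M0; field.
exact: M0.
Qed.

Let C1dS i k : C1_on pball (dS i k).
Proof.
have oB := open_pball.
have Cy l : C1_on pball (y_ l).
  exact: (C1_onB oB (C1_on_coord oB l) (C1_on_const oB (a 0 l))).
have N0 x : pball x -> N x != 0 by move=> xb; rewrite gt_eqF// Npb.
have N2 x : pball x -> N x ^+ 2 != 0 by move=> xb; rewrite expf_neq0 ?N0.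
have C1 := C1_onM oB (C1_on_const oB (k == i)%:R) (C1_on_inv oB C1N N0).
have C2 := C1_onM oB (C1_onM oB (C1_onM oB (C1_on_const oB 2) (Cy k)) (Cy i))
  (C1_on_inv oB (C1_on_pow oB 2 C1N) N2).
exact: (C1_onM oB (C1_on_const oB rho) (C1_onB oB C1 C2)).
Qed.

Let C1S k : C1_on pball (fun x => S x 0 k).
Proof.
move=> x xb i; have oB := open_pball.
have : C1_on pball (fun x => S x 0 k).
  apply: (C1_onI oB (dF := fun i => dS i k)); first by move=> z zb l; exact: DS.
  by move=> z zb l; exact: (C1_on_continuous oB (@C1dS l k) zb).
exact.
Qed.

Let partialS x i k : pball x -> partial i (fun x => S x 0 k) x = dS i k x.
Proof. by move=> xb; apply: partial_val; exact: DS. Qed.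

Variables (U : set 'rV[R]_n) (f : 'rV[R]_n -> R).
Hypotheses (oU : open U) (Cf : C2_on U f).

Let V : set 'rV[R]_n := pball `&` S @^-1` U.

Lemma open_inversion_preimage : open (pball `&` S @^-1` U).
Proof.
rewrite openE => x [xb Ux].
have cS : {for x, continuous S}.
  apply: (@cvg_rV _ _ (nbhs x)) => l.
  exact: (C1_on_continuous open_pball (@C1S l) xb).
apply: filterI; first by apply: open_nbhs_nbhs; split => //; exact: open_pball.
by apply: cS; apply: open_nbhs_nbhs.
Qed.

Let oV : open V := open_inversion_preimage.
Let VU x : V x -> U (S x). Proof. by case. Qed.
Let CSV k : C1_on V (fun x => S x 0 k).
Proof. by apply: C1_on_subset (@C1S k) => x []. Qed.

Let partial_fS F x i : C1_on U F -> V x ->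
  partial i (fun x => F (S x)) x = \sum_k partial k F (S x) * dS i k x.
Proof.
move=> CF Vx; rewrite (partial_comp _ oU VU CF CSV Vx); apply: eq_bigr => k _.
by rewrite partialS//; case: Vx.
Qed.

Let C1fS i : C1_on V (fun x => \sum_k partial k f (S x) * dS i k x).
Proof.
apply: (C1_on_sum oV) => k; apply: (C1_onM oV).
  exact: (C1_on_comp oU oV VU (Cf.2 k) CSV).
by apply: C1_on_subset (@C1dS i k) => x [].
Qed.

Lemma near_partial (F G : 'rV[R]_n -> R) x i : (\forall y \near x, F y = G y) ->
  derivable G x (delta_mx 0 i) ->
  derivable F x (delta_mx 0 i) /\ partial i F x = partial i G x.
Proof.
move=> FG /derivableP DG.
have GF : \forall y \near x, G y = F y by apply: filterS FG => y ->.
have D := near_eq_is_derive GF DG.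
by split; [case: D|rewrite (partial_val D)].
Qed.

Lemma C1_on_eq W (F G : 'rV[R]_n -> R) : open W -> (forall x, W x -> F x = G x) ->
  C1_on W G -> C1_on W F.
Proof.
move=> oW FG CG x Wx i.
have nFG y : W y -> \forall z \near y, F z = G z.
  by move=> Wy; apply: filterS (near_in_open oW Wy) => z /FG.
have [D E] := near_partial (nFG x Wx) (CG x Wx i).1.
split => //.
suff : partial i F y @[y --> x] --> partial i G x by rewrite -E.
apply: (@cvg_near_eq _ _ (nbhs x) _ (partial i G)); last exact: (CG x Wx i).2.
apply: filterS (near_in_open oW Wx) => y Wy.
by rewrite (near_partial (nFG y Wy) (CG y Wy i).1).2.
Qed.

Lemma C2_on_inversion : C2_on (pball `&` S @^-1` U) (fun x => f (S x)).
Proof.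
split; first exact: (C1_on_comp oU oV VU Cf.1 CSV).
move=> i; apply: (C1_on_eq oV _ (@C1fS i)) => x Vx.
exact: partial_fS Cf.1 Vx.
Qed.

Let partial2_fS x i : V x -> partial i (partial i (fun x => f (S x))) x =
  \sum_k ((\sum_l partial l (partial k f) (S x) * dS i l x) * dS i k x +
    partial k f (S x) * d2S i k x).
Proof.
move=> Vx.
have E : \forall y \near x, partial i (fun x => f (S x)) y =
    \sum_k partial k f (S y) * dS i k y.
  apply: filterS (near_in_open oV Vx) => y Vy; exact: partial_fS Cf.1 Vy.
rewrite (near_partial E (@C1fS i x Vx i).1).2; apply: partial_val.
apply: is_derive_bigsum => k; apply: is_derive_mul.
  have CF := C1_on_comp oU oV VU (Cf.2 k) CSV.
  apply: (is_derive_eq (C1_on_derive i CF Vx)).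
  exact: partial_fS (Cf.2 k) Vx.
by apply: DdS; case: Vx.
Qed.

(** The Jacobian is [rho / N] times the reflection I - 2 v v^T with v = (x - a)/|x - a|. Its columns
    are orthogonal, so no mixed second derivative of f survives in the Laplacian. *)
Let sum_dS x l k : pball x ->
  \sum_i dS i l x * dS i k x = (k == l)%:R * (rho / N x) ^+ 2.
Proof.
move=> xb; have N0 : N x != 0 by rewrite gt_eqF// Npb.
have E i : dS i l x * dS i k x = (rho / N x) ^+ 2 *
   ((i == l)%:R * (k == i)%:R - 2 * (y_ k x / N x) * ((i == l)%:R * y_ i x)
    - 2 * (y_ l x / N x) * ((i == k)%:R * y_ i x)
    + 4 * (y_ l x * y_ k x / N x ^+ 2) * (y_ i x * y_ i x)).
  by rewrite /dS [l == i]eq_sym [k == i]eq_sym; move: (N x) N0 => M M0; field.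
rewrite (eq_bigr _ (fun i _ => E i)) -mulr_sumr big_split/= !sumrB -!mulr_sumr.
rewrite !sum_deltal.
have -> : \sum_i y_ i x * y_ i x = N x.
  by apply: eq_bigr => i _; rewrite !yE.
by move: (N x) N0 => M M0; field.
Qed.

Let sum_d2S x k : pball x ->
  \sum_i d2S i k x = - 2 * rho * (n%:R - 2) * y_ k x / N x ^+ 2.
Proof.
move=> xb; have N0 : N x != 0 by rewrite gt_eqF// Npb.
have E i : d2S i k x = rho / N x ^+ 2 * (- 4 * ((i == k)%:R * y_ i x) +
    (- 2 * y_ k x) + 8 * y_ k x / N x * (y_ i x * y_ i x)).
  by rewrite /d2S [k == i]eq_sym; move: (N x) N0 => M M0; field.
rewrite (eq_bigr _ (fun i _ => E i)) -mulr_sumr !big_split/= -!mulr_sumr sum_deltal.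
rewrite sumr_const card_ord.
have -> : \sum_i y_ i x * y_ i x = N x.
  by apply: eq_bigr => i _; rewrite !yE.
by rewrite -mulr_natr; move: (N x) N0 => M M0; field.
Qed.

Let sum_xdS x k : pball x -> \sum_i x 0 i * dS i k x =
  rho * (x 0 k / N x - 2 * y_ k x * (dot x x - dot a x) / N x ^+ 2).
Proof.
move=> xb; have N0 : N x != 0 by rewrite gt_eqF// Npb.
have E i : x 0 i * dS i k x = rho * ((i == k)%:R * (x 0 i / N x) -
    2 * y_ k x / N x ^+ 2 * (x 0 i * y_ i x)).
  by rewrite /dS [k == i]eq_sym; move: (N x) N0 => M M0; field.
rewrite (eq_bigr _ (fun i _ => E i)) -mulr_sumr sumrB -!mulr_sumr sum_deltal.
have -> : \sum_i x 0 i * y_ i x = dot x x - dot a x.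
  by rewrite dotC -sumrB; apply: eq_bigr => i _; rewrite /y_; ring.
by move: (N x) N0 => M M0; field.
Qed.

Lemma hlaplacianE (F : 'rV[R]_n -> R) x : hlaplacian F x =
  (1 - dot x x) / 4 * ((1 - dot x x) * lap F x + 2 * (n%:R - 2) * euler F x).
Proof. by rewrite /hlaplacian -(dotxx x). Qed.

Let E1 x := \sum_k partial k f (S x) * (- 2 * rho * (n%:R - 2) * y_ k x / N x ^+ 2).
Let E2 x := \sum_k partial k f (S x) * (rho * (x 0 k / N x -
       2 * y_ k x * (dot x x - dot a x) / N x ^+ 2)).

Let lap_inversion x : V x -> lap (fun x => f (S x)) x =
  (rho / N x) ^+ 2 * lap f (S x) + E1 x.
Proof.
move=> Vx; have xb : pball x by case: Vx.
transitivity (\sum_i \sum_k (\sum_l partial l (partial k f) (S x) * dS i l x) * dS i k x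
    + \sum_i \sum_k partial k f (S x) * d2S i k x).
  rewrite -big_split; apply: eq_bigr => i _.
  by rewrite -big_split; exact: partial2_fS.
congr (_ + _); last first.
  rewrite exchange_big; apply: eq_bigr => k _.
  by rewrite -mulr_sumr sum_d2S.
rewrite exchange_big /lap mulr_sumr; apply: eq_bigr => k _.
under eq_bigr do rewrite mulr_suml.
rewrite exchange_big/=.
transitivity (\sum_l (l == k)%:R * (partial l (partial k f) (S x) * (rho / N x) ^+ 2)).
  apply: eq_bigr => l _; under eq_bigr do rewrite -mulrA.
  by rewrite -mulr_sumr sum_dS// [k == l]eq_sym mulrCA.
by rewrite sum_deltal mulrC.
Qed.

Let euler_inversion x : V x -> euler (fun x => f (S x)) x = E2 x.
Proof.
move=> Vx; have xb : pball x by case: Vx.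
transitivity (\sum_i \sum_k x 0 i * (partial k f (S x) * dS i k x)).
  apply: eq_bigr => i _; rewrite -mulr_sumr; congr (_ * _).
  exact: partial_fS Cf.1 Vx.
rewrite exchange_big; apply: eq_bigr => k _.
by rewrite -sum_xdS// mulr_sumr; apply: eq_bigr => i _; rewrite mulrCA.
Qed.

(** [E1] comes from the Laplacian of the components of the inversion and [E2] from the drift term at
    x; together they give the drift term at the image point. *)
Let first_order x : V x -> (1 - dot x x) * E1 x + 2 * (n%:R - 2) * E2 x =
  2 * (n%:R - 2) * (rho / N x) * euler f (S x).
Proof.
move=> [xb Ux]; have N0 : N x != 0 by rewrite gt_eqF// Npb.
rewrite /E1 /E2 /euler !mulr_sumr -big_split; apply: eq_bigr => k _ /=.
rewrite SE /y_; have := NE x; move: N0.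
move: (N x) (partial k f (S x)) (x 0 k) (a 0 k) (dot x x) (dot a x) (dot a a)
  => M p X A xx ax aa M0 E.
rewrite (_ : xx = M + 2 * ax - aa); last by rewrite E; ring.
by field.
Qed.

Let combine (X M r L e1 e2 e3 K : R) : M != 0 ->
  (1 - X) * e1 + K * e2 = K * (r / M) * e3 ->
  (1 - X) / 4 * ((1 - X) * ((r / M) ^+ 2 * L + e1) + K * e2) =
  r * (1 - X) / M / 4 * (r * (1 - X) / M * L + K * e3).
Proof.
move=> M0 key.
transitivity ((1 - X) / 4 * ((1 - X) * ((r / M) ^+ 2 * L) +
   ((1 - X) * e1 + K * e2))); first by ring.
by rewrite key; field.
Qed.

Lemma hlaplacian_inversion x : pball x -> U (S x) ->
  hlaplacian (fun x => f (S x)) x = hlaplacian f (S x).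
Proof.
move=> xb Ux; have Vx : V x by [].
have N0 : N x != 0 by rewrite gt_eqF// Npb.
rewrite (hlaplacianE _ x) (hlaplacianE _ (S x)) (onem_inversion (pball_neq xb)).
rewrite (lap_inversion Vx) (euler_inversion Vx).
exact: combine N0 (first_order Vx).
Qed.

End inversion.

(** * Euclidean estimates for the inversion exchanging 0 and q *)

Section inversion_estimates.
Context {R : realType} (n : nat).
Implicit Types (x z p q : 'rV[R]_n).

Lemma enorm_sub_ge x y : enorm y - enorm x <= enorm (x - y).
Proof.
rewrite lerBlDl; have := enorm_triangle x (y - x).
by rewrite addrC subrK -(enormN (y - x)) opprB.
Qed.

Variable q : 'rV[R]_n.
Hypotheses (q0 : q != 0) (q1 : pball q).

(* The inversion centred at [pole] swaps 0 and q. *)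
Definition pole : 'rV[R]_n := (dot q q)^-1 *: q.

Let Q := dot q q.

Let Q0 : 0 < Q.
Proof. by rewrite /Q dotxx exprn_gt0// enorm_gt0. Qed.

Let Q1 : Q < 1.
Proof. exact/pball_dot. Qed.

Lemma dot_pole : dot pole pole = Q^-1.
Proof. by rewrite /pole dotZl dotZr -/Q; field; rewrite gt_eqF. Qed.

Lemma dot_pole_gt1 : 1 < dot pole pole.
Proof. by rewrite dot_pole invf_gt1. Qed.

Let dpx x : dot pole x = dot q x / Q.
Proof. by rewrite dotZl mulrC. Qed.

(** |q|^2 |x - pole|^2: the denominator of the inversion, rescaled so as to remain bounded when q
    approaches 0. *)
Let D x := 1 - 2 * dot q x + Q * dot x x.

Let D_ge x : (1 - enorm q * enorm x) ^+ 2 <= D x.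
Proof.
rewrite /D /Q !dotxx; have := dot_le_enorm q x.
move: (enorm q) (enorm x) (dot q x) => s t d h.
by rewrite sqrrB expr1n mul1r exprMn; lra.
Qed.

Let D_gt0 x : pball x -> 0 < D x.
Proof.
move=> x1; apply: lt_le_trans (D_ge x); rewrite exprn_gt0// subr_gt0.
rewrite (le_lt_trans _ (x1 : enorm x < 1))// ler_piMl ?enorm_ge0//.
exact: ltW.
Qed.

Let NE x : dot (x - pole) (x - pole) = D x / Q.
Proof.
rewrite !(dotDl, dotDr, dotNl, dotNr) (dotC x pole) dot_pole dpx /D.
by field; rewrite gt_eqF.
Qed.

(** From |S x - q|^2 = (1 - |q|^2)^2 |x|^2 / D and 1 - |q|^2 <= 2 (1 - |q|) <= 2 (1 - |q| |x|). The
    constant 2 is uniform in q, so radii can be fixed before q is chosen. *)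
Lemma dist_inversion x : pball x -> enorm (inversion pole x - q) <= 2 * enorm x.
Proof.
move=> xb; have D0 := D_gt0 xb.
have E : enorm (inversion pole x - q) ^+ 2 = (1 - Q) ^+ 2 * enorm x ^+ 2 / D x.
  rewrite -!dotxx /inversion NE dot_pole.
  have -> : pole + ((Q^-1 - 1) / (D x / Q)) *: (x - pole) - q =
      ((1 - Q) / D x) *: x + (Q^-1 - 1 - (1 - Q) / D x / Q) *: q.
    apply/rowP => j; rewrite /pole !mxE -/Q.
    by move: (D x) D0 Q Q0 Q1 => d d0 P P0 P1; field; rewrite !gt_eqF.
  rewrite !(dotDl, dotDr, dotZl, dotZr) (dotC x q) -/Q.
  have : D x = 1 - 2 * dot q x + Q * dot x x by [].
  move: D0; move: (D x) (dot q x) (dot x x) Q Q0 => d B X P P0 d0 DE.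
  rewrite (_ : B = (1 + P * X - d) / 2); last by rewrite DE; field.
  by field; rewrite !gt_eqF.
rewrite -(ler_pXn2r (n := 2))// ?nnegrE ?mulr_ge0 ?enorm_ge0// E exprMn.
rewrite ler_pdivrMr// [leRHS]mulrAC; apply: ler_wpM2r; first exact: sqr_ge0.
have h := D_ge x; have x1 : enorm x < 1 := xb; have xg := enorm_ge0 x.
have s1 : enorm q < 1 := q1; have sg := enorm_ge0 q.
have QE : Q = enorm q ^+ 2 by rewrite /Q dotxx.
apply: le_trans (_ : 2 ^+ 2 * (1 - enorm q * enorm x) ^+ 2 <= _); last by rewrite ler_wpM2l.
have h1 : enorm q * enorm x <= enorm q by rewrite ler_piMr// ltW.
rewrite -exprMn; apply: lerXn2r; rewrite ?nnegrE ?subr_ge0 ?(ltW Q1)//; first by lra.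
by rewrite QE; have := sqr_ge0 (1 - enorm q); lra.
Qed.

(** Here |S z|^2 = |z - q|^2 / D z and D z >= (1 - |z|)^2, again uniformly in q. *)
Lemma enorm_inversion z : pball z ->
  enorm (inversion pole z) <= enorm (z - q) / (1 - enorm z).
Proof.
move=> zb; have D0 := D_gt0 zb; have z1 : enorm z < 1 := zb.
have zp : z != pole.
  apply/eqP => zE; have := dot_pole_gt1; rewrite -zE.
  by move/pball_dot : zb; lra.
have E : enorm (inversion pole z) ^+ 2 = enorm (z - q) ^+ 2 / D z.
  rewrite -!dotxx; have := onem_inversion zp.
  rewrite NE dot_pole => /eqP; rewrite subr_eq addrC -subr_eq => /eqP <-.
  rewrite !(dotDl, dotDr, dotNl, dotNr) (dotC z q) -/Q.
  move: D0; rewrite /D; move: (dot q z) (dot z z) Q Q0 => B X P P0 D0.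
  by field; rewrite !gt_eqF.
rewrite -(ler_pXn2r (n := 2))// ?nnegrE ?divr_ge0 ?enorm_ge0 ?subr_ge0 ?(ltW z1)//.
rewrite E expr_div_n ler_wpM2l ?sqr_ge0// lef_pV2 ?posrE//; last first.
  by rewrite exprn_gt0// subr_gt0.
have s1 : enorm q < 1 := q1.
have h1 : enorm q * enorm z <= enorm z by rewrite ler_piMl ?enorm_ge0// ltW.
by apply: le_trans (D_ge z); apply: lerXn2r; rewrite ?nnegrE; lra.
Qed.

End inversion_estimates.

(** * Unique continuation from an open set *)

Section unique_continuation.
Context {R : realType} (n : nat).
Variables (W : set 'rV[R]_n) (mu : R) (f : 'rV[R]_n -> R).
Hypotheses (n0 : (0 < n)%N) (mu0 : 0 < mu).
Hypotheses (oW : open W) (Wb : W `<=` pball).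
Hypothesis Cf : C2_on W f.
Hypothesis Hf : forall x, W x ->
  hlaplacian f x = - (((n%:R - 1) / 2) ^+ 2 + mu ^+ 2) * f x.

(** Vanishing near the point, so that [Z] is open and provides whole balls of zeros; connectedness
    then asks for closedness in [W]. *)
Let Z : set 'rV[R]_n := [set x | W x /\ \forall y \near x, f y = 0].

Let oZ : open Z.
Proof.
rewrite openE => x [Wx fx].
have h1 := near_in_open oW Wx; have h2 := nbhs_interior fx.
by apply: filterS (filterI h1 h2) => y [].
Qed.

Lemma near_enorm_ball (p : 'rV[R]_n) (d : R) : 0 < d -> \forall y \near p, enorm (y - p) < d.
Proof.
move=> d0.
have c1 : y - p @[y --> p] --> p - p.
  apply: (@cvg_rV _ _ (nbhs p)) => k; rewrite !mxE.
  under eq_fun do rewrite !mxE.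
  by apply: (@cvgB _ _ _ (nbhs p)); [exact: coord_continuous_rV|exact: cvg_cst].
have : enorm (y - p) @[y --> p] --> (0 : R).
  rewrite -(@enorm0 R n) -(subrr p).
  exact: (@cvg_comp _ _ _ (fun y => y - p) (@enorm R n) (nbhs p) (nbhs (p - p))
    (nbhs (enorm (p - p))) c1 (@enorm_continuous R n (p - p))).
by move/cvgr_lt; apply.
Qed.

(** [pole q] requires a nonzero q; if the nearby point of [Z] is the origin, openness of [Z] leaves
    room to shift it. *)
Let Z_nonzero p d : closure Z p -> 0 < d ->
  exists q, [/\ Z q, enorm (q - p) < d & q != 0].
Proof.
move=> clp d0; have [q' [Zq' q'd]] := clp _ (near_enorm_ball p d0).
have [q0|q0] := eqVneq q' 0; last by exists q'.
have nZ : \forall y \near q', Z y /\ enorm (y - p) < d.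
  have h1 := near_in_open oZ Zq'.
  have e0 : 0 < d - enorm (q' - p) by rewrite subr_gt0.
  apply: filterS (filterI h1 (near_enorm_ball q' e0)) => y [Zy yq]; split => //.
  have -> : y - p = (y - q') + (q' - p) by rewrite addrA subrK.
  by apply: le_lt_trans (enorm_triangle _ _) _; rewrite -ltrBrDr.
have /nbhs_ballP[e /= e0 He] := nZ.
pose v : 'rV[R]_n := (e / 2) *: delta_mx 0 (Ordinal n0).
have vn : enorm v = e / 2.
  by rewrite enormZ ger0_norm ?divr_ge0 ?(ltW e0)// enorm_delta mulr1.
exists v; have [|Zv vd] := He v.
  rewrite -ball_normE /= q0 sub0r normrN.
  by apply: le_lt_trans (normr_le_enorm _) _; rewrite vn; lra.
by split => //; rewrite -enorm_gt0 vn divr_gt0.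
Qed.

(* [p] lies in a geodesic ball of [W] around a nearby point [q] of [Z]; move [q]
   to the origin by an inversion and spread the zero set along spheres. *)
Let closed_Z p : W p -> closure Z p -> Z p.
Proof.
move=> Wp clp; split => //; have p1 : enorm p < 1 := Wb Wp.
have [eps eps0 Heps] := open_sball oW Wp.
have HW y : enorm (y - p) < eps -> W y.
  by move=> h; apply: Heps; exact: le_lt_trans (normr_le_enorm _) h.
(* For |x| < r the image is at distance at most 2 r <= eps / 2 from q, and q will be within eps / 2
   of p, so the image lies in [W]. *)
pose r := Num.min 1 (eps / 4).
have r0 : 0 < r by rewrite lt_min ltr01 divr_gt0.
have r1 : r <= 1 by rewrite ge_min lexx.
have re : r <= eps / 4 by rewrite ge_min lexx orbT.
(* The third bound gives 1 - |z| > (1 - |p|) / 2 when |z - p| < d; with the second, |z - q| / (1 -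
   |z|) < r, so the whole d-ball around p is reached from the r-ball around 0. *)
pose d := Num.min (eps / 2) (Num.min (r * (1 - enorm p) / 4) ((1 - enorm p) / 2)).
have p1' : 0 < 1 - enorm p by rewrite subr_gt0.
have d0 : 0 < d by rewrite !lt_min !divr_gt0 ?mulr_gt0.
have d1 : d <= eps / 2 by rewrite ge_min lexx.
have d2 : d <= r * (1 - enorm p) / 4 by rewrite !ge_min lexx !orbT.
have d3 : d <= (1 - enorm p) / 2 by rewrite !ge_min lexx !orbT.
have [q [[Wq fq] qd q0]] := Z_nonzero clp d0.
have q1 : pball q := Wb Wq.
pose S := inversion (pole q).
have a1 := dot_pole_gt1 q0 q1.
have inW x : enorm x < r -> W (S x).
  move=> xr; apply: HW; have xb : pball x by exact: lt_le_trans xr r1.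
  have -> : S x - p = (S x - q) + (q - p) by rewrite addrA subrK.
  apply: le_lt_trans (enorm_triangle _ _) _.
  have := dist_inversion q0 q1 xb; rewrite -/S.
  by lra.
have annV : annulus 0 r `<=` pball `&` S @^-1` W.
  by move=> x /andP[_ xr]; split; [exact: lt_le_trans xr r1|exact: inW].
have CS : C2_on (annulus 0 r) (fun x => f (S x)).
  have [C1 C2] := C2_on_inversion a1 oW Cf.
  by split; [exact: C1_on_subset annV C1|move=> i; exact: C1_on_subset annV (C2 i)].
have HS x : annulus 0 r x -> hlaplacian (fun x => f (S x)) x =
    - (((n%:R - 1) / 2) ^+ 2 + mu ^+ 2) * f (S x).
  move=> /annV[xb Wx]; rewrite -(Hf Wx).
  exact: (hlaplacian_inversion a1 oW Cf xb Wx).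
have /nbhs_ballP[s /= s0 Hs] := fq.
(* f vanishes on the s-ball around q, and |S x - q| <= 2 |x|. *)
pose c := Num.min (s / 2) r.
have c0 : 0 < c by rewrite lt_min divr_gt0.
have cs : c <= s / 2 by rewrite ge_min lexx.
have cr : c <= r by rewrite ge_min lexx orbT.
have fS0 x : annulus 0 c x -> f (S x) = 0.
  move=> /andP[_ xc]; apply: Hs; rewrite -ball_normE /= -normrN opprB.
  apply: le_lt_trans (normr_le_enorm _) _.
  have xb : pball x by apply: lt_le_trans r1; exact: lt_le_trans cr.
  by have := dist_inversion q0 q1 xb; rewrite -/S; lra.
have fS := annulus_cauchy (lexx 0) r1 mu0 CS HS c0 fS0.
apply: filterS (near_enorm_ball p d0) => z zd.
have zn : enorm z < (1 + enorm p) / 2.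
  have := enorm_triangle (z - p) p; rewrite subrK; lra.
have zb : pball z by rewrite /pball/=; lra.
have za : z != pole q.
  by apply/eqP => zE; move/pball_dot : zb; rewrite zE; move: a1; lra.
have zq : enorm (z - q) < 2 * d.
  have -> : z - q = (z - p) + (p - q) by rewrite addrA subrK.
  apply: le_lt_trans (enorm_triangle _ _) _.
  by rewrite -(enormN (p - q)) opprB; lra.
have Sz : enorm (S z) < r.
  apply: le_lt_trans (enorm_inversion q0 q1 zb) _.
  have z1 : 0 < 1 - enorm z by lra.
  rewrite ltr_pdivrMr//; apply: lt_le_trans zq _.
  have : r * ((1 - enorm p) / 2) <= r * (1 - enorm z).
    by rewrite ler_wpM2l ?(ltW r0)//; lra.
  by lra.
rewrite -(inversionK a1 za) -/S.
(* The annulus omits the centre; it corresponds to z = q, where f vanishes already. *)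
have [Sz0|Sz0] := eqVneq (S z) 0; last first.
  by apply: fS; rewrite /annulus/= enorm_gt0 Sz0.
have -> : S (S z) = q; last exact: nbhs_singleton fq.
have := dist_inversion q0 q1 (_ : pball (S z)); rewrite -/S Sz0 enorm0 mulr0.
rewrite /pball/= enorm0 => /(_ ltr01) h.
by apply/eqP; rewrite -subr_eq0 -enorm_eq0 eq_le h enorm_ge0.
Qed.

Lemma unique_continuation : connected W -> (exists x, Z x) ->
  forall x, W x -> f x = 0.
Proof.
move=> cW [z Zz] x Wx.
suff ZW : Z = W by move: Wx; rewrite -ZW => -[_ /nbhs_singleton].
apply: cW; first by exists z.
- by exists Z => //; apply/seteqP; split => [y Zy|y []//]; split => //; case: Zy.
- exists (closure Z); first exact: closed_closure.
  apply/seteqP; split => [y Zy|y [Wy cy]]; last exact: closed_Z.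
  by split; [case: Zy|exact: subset_closure].
Qed.

End unique_continuation.

(** * Exterior domains *)

Section exterior.
Context {R : realType} (n : nat).
Implicit Types (E : set 'rV[R]_n) (f : 'rV[R]_n -> R).

Lemma within_continuous_interior E f x : {within E, continuous f} -> E° x ->
  {for x, continuous f}.
Proof.
move=> cf Ex; have := continuous_subspaceW (@interior_subset _ E) cf.
rewrite continuous_open_subspace; last exact: open_interior.
by apply; rewrite inE.
Qed.

(** On the interior the continuous extensions coincide with the derivatives, which are therefore
    continuous there. *)
Lemma C2_interior E f : C2 E f -> C2_on E° f.
Proof.
have ext g x : extends_continuously E g -> E° x -> {for x, continuous g}.
  move=> [h ch hg] Ex; suff : g y @[y --> x] --> h x by rewrite hg.
  apply: (@cvg_near_eq _ _ (nbhs x) _ h); last exact: within_continuous_interior ch Ex.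
  by apply: filterS (near_in_open (@open_interior _ E) Ex) => y /hg.
move=> [cf D1 c1 D2 c2]; split=> [x Ex i|i x Ex j].
  by split; [exact: D1|exact: ext (c1 i) Ex].
by split; [exact: D2|exact: ext (c2 i j) Ex].
Qed.

(** Zeros on a dense part extend by relative continuity; this is how boundary points of the exterior
    are reached. *)
Lemma within_continuous_eq0 E A f : {within E, continuous f} -> A `<=` E ->
  E `<=` closure A -> (forall x, A x -> f x = 0) -> forall x, E x -> f x = 0.
Proof.
move=> cf AE EA f0 x Ex; apply/eqP/negPn/negP => fx.
have fx0 : 0 < `|f x| by rewrite normr_gt0.
have C : f @ within E (nbhs x) --> f x by rewrite (nbhs_subspace_in Ex); exact: cf.
have H := (@cvgrPdist_lt _ _ _ (within E (nbhs x)) _ f (f x)).1 C _ fx0.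
have [y [Ay /= yE]] := EA x Ex _ (H _).
by have := yE (AE _ Ay); rewrite (f0 y Ay) subr0 ltxx.
Qed.

Lemma arcosh_ge (t : R) : 1 <= t -> ln t <= arcosh t.
Proof.
move=> t1; rewrite /arcosh ler_ln ?posrE; last 2 first.
- by lra.
- by apply: ltr_pwDl; [lra|exact: sqrtr_ge0].
by rewrite lerDl sqrtr_ge0.
Qed.

(** Fix y in the set. A point x close to the unit sphere stays at Euclidean distance at least d from
    y, so a bound on the hyperbolic distance bounds 1 - |x|^2 from below. *)
Lemma hbounded_enorm (A : set 'rV[R]_n) : A !=set0 -> A `<=` pball -> hbounded A ->
  exists a : R, [/\ 0 <= a, a < 1 & forall x, A x -> enorm x <= a].
Proof.
move=> [y Ay] Ab [M HM]; have y1 : enorm y < 1 := Ab y Ay; have y0 := enorm_ge0 y.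
(* |x - y| >= d as soon as |x| > (1 + |y|) / 2; points with smaller norm satisfy the first bound of
   the maximum below. *)
pose d := (1 - enorm y) / 2; have d0 : 0 < d by rewrite /d; lra.
pose k := 2 * d ^+ 2 / expR M.
have k0 : 0 < k by rewrite divr_gt0 ?expR_gt0// mulr_gt0// exprn_gt0.
exists (Num.max ((1 + enorm y) / 2) (1 - k / 2)); split.
- by rewrite le_max; apply/orP; left; lra.
- by rewrite gt_max; apply/andP; split; lra.
move=> x Ax; have x1 : enorm x < 1 := Ab x Ax; have x0 := enorm_ge0 x.
rewrite le_max; case: (leP (enorm x) ((1 + enorm y) / 2)) => //= xy.
have X1 : 0 < 1 - enorm x ^+ 2 by nra.
have Y1 : 0 < 1 - enorm y ^+ 2 by nra.
have de : d <= enorm (x - y).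
  have := enorm_sub_ge y x; rewrite -(enormN (x - y)) opprB /d; lra.
have := HM x y Ax Ay; rewrite /hdist.
set t := 1 + _ => tM.
have t1 : 1 <= t.
  by rewrite /t lerDl; apply: divr_ge0; apply: mulr_ge0; rewrite ?sqr_ge0 ?(ltW X1) ?(ltW Y1).
have tE : t <= expR M.
  rewrite -ler_ln ?posrE ?expR_gt0//; last by lra.
  by rewrite expRK; exact: le_trans (arcosh_ge t1) tM.
have : 2 * d ^+ 2 / (1 - enorm x ^+ 2) <= expR M.
  apply: le_trans tE; apply: le_trans (_ : 2 * enorm (x - y) ^+ 2 /
      ((1 - enorm x ^+ 2) * (1 - enorm y ^+ 2)) <= _); last by rewrite lerDr.
  rewrite invfM [leRHS]mulrA; apply: le_trans (_ : 2 * enorm (x - y) ^+ 2 / (1 - enorm x ^+ 2) <= _).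
    apply: ler_wpM2r; first by rewrite invr_ge0 ltW.
    by rewrite ler_pM2l//; apply: lerXn2r; rewrite ?nnegrE ?(ltW d0) ?enorm_ge0.
  apply: ler_peMr.
    by apply: divr_ge0; [rewrite mulr_ge0// sqr_ge0|exact: ltW].
  by rewrite invf_ge1// lerBlDr lerDl sqr_ge0.
rewrite ler_pdivrMr// [leRHS]mulrC -ler_pdivrMr ?expR_gt0// -/k.
(* 2 z <= 1 + z^2 turns the lower bound on 1 - z^2 into an upper bound on z. *)
have F (K z : R) : K <= 1 - z ^+ 2 -> z <= 1 - K / 2.
  by have := sqr_ge0 (1 - z); rewrite !expr2; lra.
exact: F.
Qed.

Lemma annulus_sub_interior (Omega : set 'rV[R]_n) (a : R) : 0 <= a ->
  (forall x, Omega x -> enorm x <= a) ->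
  annulus a 1 `<=` (pball `\` Omega)°.
Proof.
move=> a0 Oa x ann; apply: filterS (near_in_open (@open_annulus R n a 1) ann).
by move=> y /andP[ay y1]; split => // /Oa; rewrite leNgt ay.
Qed.

Lemma annulus_nonempty (a : R) : (0 < n)%N -> 0 <= a -> a < 1 ->
  exists x : 'rV[R]_n, annulus a 1 x.
Proof.
move=> n0 a0 a1; exists (((1 + a) / 2) *: delta_mx 0 (Ordinal n0)).
rewrite /annulus/= enormZ ger0_norm; last by lra.
by rewrite enorm_delta; lra.
Qed.

(** [G] will be |u|^2, which dominates the squares of both the real and the imaginary part: one
    decay hypothesis serves the two applications. *)
Lemma rellich_real (mu : R) (Omega : set 'rV[R]_n) f (G : 'rV[R]_n -> R) :
  (2 <= n)%N -> 0 < mu -> is_domain Omega -> Omega `<=` pball -> hbounded Omega ->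
  connected (pball `\` Omega)° -> pball `\` Omega `<=` closure (pball `\` Omega)° ->
  C2 (pball `\` Omega) f ->
  (forall x, (pball `\` Omega)° x ->
     hlaplacian f x = - ((n.-1)%:R ^+ 2 / 4 + mu ^+ 2) * f x) ->
  (forall x, (pball `\` Omega)° x -> {for x, continuous G}) ->
  (forall x, f x ^+ 2 <= G x) ->
  hsphere_integral G rho @[rho --> +oo] --> 0%E ->
  forall x, (pball `\` Omega) x -> f x = 0.
Proof.
move=> hn mu0 [nO _ _] Ob Obd conn reg Cf Hf cG fG dec.
have n0 : (0 < n)%N by apply: leq_trans hn.
set E := pball `\` Omega in conn reg Cf Hf cG *.
have [a [a0 a1 Oa]] := hbounded_enorm nO Ob Obd.
have annE : annulus a 1 `<=` E° := annulus_sub_interior a0 Oa.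
have Cf2 := C2_interior Cf.
have oE : open E° := @open_interior _ E.
have Hf' x : E° x -> hlaplacian f x = - (((n%:R - 1) / 2) ^+ 2 + mu ^+ 2) * f x.
  move=> /Hf ->; have -> : n.-1%:R = n%:R - 1 :> R by rewrite -subn1 natrB.
  by congr (- (_ + _) * _); field.
have Cfa : C2_on (annulus a 1) f.
  have [C1 C2] := Cf2.
  by split; [exact: C1_on_subset annE C1|move=> i; exact: C1_on_subset annE (C2 i)].
have fa : forall x, annulus a 1 x -> f x = 0.
  apply: (annulus_decay a0 (lexx 1) mu0 Cfa (fun x ax => Hf' x (annE x ax)) erefl a1).
  move=> w k w1; apply: (moment_decay k n0 a0 a1 w1 _ _ fG dec).
    by move=> y /annE Ey; exact: C1_on_continuous oE Cf2.1 Ey.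
  by move=> y /annE Ey; exact: cG.
have fE : forall x, E° x -> f x = 0.
  apply: (unique_continuation n0 mu0 oE _ Cf2 Hf' conn).
    by move=> x /interior_subset[].
  have [x ax] := annulus_nonempty n0 a0 a1; exists x; split; first exact: annE.
  by apply: filterS (near_in_open (@open_annulus R n a 1) ax) => y /fa.
(* The equation gives f = 0 on the interior; the points of the exterior outside its interior follow
   by density. *)
by case: Cf => cf _ _ _ _; exact: within_continuous_eq0 cf (@interior_subset _ E) reg fE.
Qed.

End exterior.

Unset Implicit Arguments.
Set Strict Implicit.
Set Printing Implicit Defensive.

Theorem theorem4p4 (R : realType) (n : nat) (mu : R) (Omega : set 'rV[R]_n)
    (u : 'rV[R]_n -> R[i])
    (hn : (2 <= n)%N) (hmu : 0 < mu)
    (Omega_domain : is_domain Omega)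
    (Omega_ball : Omega `<=` pball)
    (Omega_bounded : hbounded Omega)
    (ext_connected : connected (pball `\` Omega)°)
    (ext_regular : pball `\` Omega `<=` closure (pball `\` Omega)°)
    (u_C2 : C2_complex (pball `\` Omega) u)
    (u_helmholtz : forall x, (pball `\` Omega)° x ->
       - hlaplacian_complex u x - ((n.-1)%:R ^+ 2 / 4)%:C * u x
         - (mu ^+ 2)%:C * u x = 0)
    (u_decay : hsphere_integral (fun x => Normc.normc (u x) ^+ 2) rho
                 @[rho --> +oo] --> 0%E) :
  forall x, (pball `\` Omega) x -> u x = 0.
Proof.
have [Cre Cim] := u_C2.
have normE x : Normc.normc (u x) ^+ 2 = re_fun u x ^+ 2 + im_fun u x ^+ 2.
  rewrite /re_fun /im_fun; case: (u x) => p q /=.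
  by rewrite sqr_sqrtr// addr_ge0 ?sqr_ge0.
have cG x : (pball `\` Omega)° x ->
    {for x, continuous (fun x => Normc.normc (u x) ^+ 2)}.
  move=> Ex; rewrite (funext normE).
  have c1 := C1_on_continuous (@open_interior _ _) (C2_interior Cre).1 Ex.
  have c2 := C1_on_continuous (@open_interior _ _) (C2_interior Cim).1 Ex.
  exact: (continuousD (continuous_pow (k := 2) c1) (continuous_pow (k := 2) c2)).
have H x : (pball `\` Omega)° x ->
    hlaplacian (re_fun u) x = - ((n.-1)%:R ^+ 2 / 4 + mu ^+ 2) * re_fun u x /\
    hlaplacian (im_fun u) x = - ((n.-1)%:R ^+ 2 / 4 + mu ^+ 2) * im_fun u x.
  move=> /u_helmholtz; rewrite /hlaplacian_complex.
  move: (hlaplacian _ x) (hlaplacian _ x) => A B.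
  rewrite /re_fun /im_fun; case: (u x) => p q /= /eqP.
  rewrite eq_complex /= => /andP[/eqP h1 /eqP h2].
  by split; [move: h1|move: h2]; rewrite !mul0r; lra.
move=> x Ex.
have re0 : re_fun u x = 0.
  apply: (rellich_real hn hmu Omega_domain Omega_ball Omega_bounded ext_connected
    ext_regular Cre _ cG _ u_decay Ex) => [y /H[]//|y].
  by rewrite normE lerDl sqr_ge0.
have im0 : im_fun u x = 0.
  apply: (rellich_real hn hmu Omega_domain Omega_ball Omega_bounded ext_connected
    ext_regular Cim _ cG _ u_decay Ex) => [y /H[]//|y].
  by rewrite normE lerDr sqr_ge0.
by apply/eqP; rewrite eq_complex; apply/andP; split; apply/eqP.
Qed.
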